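(* Let $q$ be a prime number different from $2$, $G=PGL(2,\mathbb{Q}_q)$, and let $\mu$ be a positive Borel measure on a compact space $X$ with $\mu(X)<\tfrac12$. Given three admissible partitions $\rho_0<\rho_1<\rho_2$ of $X$, there exist isometric embeddings $$j_{\rho_1,\rho_0}:H_{\rho_0}\to H_{\rho_1},\qquad j_{\rho_2,\rho_1}:H_{\rho_1}\to H_{\rho_2},\qquad j_{\rho_2,\rho_0}:H_{\rho_0}\to H_{\rho_2},$$ where each $j_{\rho_k,\rho_i}$ commutes with the action of $G_{\rho_i}$ (regarded as a subgroup of $G_{\rho_k}$), such that $$j_{\rho_2,\rho_1}\circ j_{\rho_1,\rho_0}=j_{\rho_2,\rho_0}.$$
   Context: An admissible partition $\rho$ of $X$ is a partition $X=\bigcup_{i=1}^nA_i$ into finitely many disjoint Borel subsets; $\rho_1<\rho_2$ means that $\rho_2$ is a refinement of $\rho_1$. $G_\rho$ is the group (under pointwise multiplication) of functions $X\to G$ that are constant on each $A_i$, so that $G_\rho\simeq G\times\dots\times G$ ($n$ factors); if $\rho_1<\rho_2$ then $G_{\rho_1}\subseteq G_{\rho_2}$. Put $z_i=\mu(A_i)$, $H_\rho=H_{z_1}\otimes\dots\otimes H_{z_n}$ and $\pi_\rho(g_1,\dots,g_n)=\pi_{z_1}(g_1)\otimes\dots\otimes\pi_{z_n}(g_n)$, where $(\pi_z,H_z)$, $0<z<\tfrac12$, are the complementary series representations defined below and, for $z=0$, $H_0=\mathbb{C}$ with trivial action. The group $G_\rho$ acts on $H_\rho$ by $\pi_\rho$.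 Complementary series: let $\mathcal{T}$ be the Bruhat–Tits tree of $G$, whose vertices are the homothety classes $[L]$ of $\mathbb{Z}_q$-lattices $L\subset\mathbb{Q}_q^2$, two distinct classes being adjacent if they have representatives with $qL\subsetneq L'\subsetneq L$; $d$ is the tree distance and $o=[\mathbb{Z}_q^2]$. The boundary $\Omega$ is the set of equivalence classes of geodesic rays (two rays being equivalent if they coincide up to a shift, from some point on), with its natural compact totally disconnected topology; $[v,\omega)$ is the unique ray from $v$ in the class $\omega$. For $g\in G$, $\omega\in\Omega$ put $b(g,\omega)=d(o,x)-d(g\cdot o,x)$, where $x$ is any vertex common to $[o,\omega)$ and $[g\cdot o,\omega)$. For $0<z<\tfrac12$, $\pi_z(g)F(\omega)=F(g^{-1}\omega)\,q^{z\,b(g,\omega)}$ on the space $\mathcal{C}^\infty(\Omega)$ of complex locally constant functions, and $H_z$ is the completion of $\mathcal{C}^\infty(\Omega)$ for the $\pi_z$-invariant inner product (unique up to a scalar, normalized so that the constant function $1$ has norm $1$); this is an irreducible unitary representation of $G$. *)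

(* Defs.v *)
From HB Require Import structures.
From mathcomp Require Import all_boot all_order all_algebra.
From mathcomp Require Import generic_quotient fraction sesquilinear complex.
From mathcomp Require Import all_classical all_reals all_analysis.

Set Implicit Arguments.
Unset Strict Implicit.
Unset Printing Implicit Defensive.

Import Order.TTheory GRing.Theory Num.Theory Num.Def.
Import numFieldNormedType.Exports.

Local Open Scope quotient_scope.
Local Open Scope classical_set_scope.
Local Open Scope ring_scope.

Record prime_number := PrimeNumber {
  prime_nat :> nat;
  prime_natP : prime prime_nat
}.

(* An element of the inverse limit of the rings Z/q^n, given by the sequence
   of its canonical representatives in [0, q^n[. *)
Record padic_int (q : prime_number) := PadicInt {
  padic_seq :> nat -> int;
  padic_seqP : `[< forall n, (padic_seq n.+1 %% (q ^ n)%N)%Z = padic_seq n >]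
}.
HB.instance Definition _ q := [isSub for @padic_seq q].
HB.instance Definition _ q := [Choice of padic_int q by <:].

Section PadicInt.
Variable q : prime_number.
Implicit Types x y z : padic_int q.

Lemma padic_intP x n : (x n.+1 %% (q ^ n)%N)%Z = x n.
Proof. by have /asboolP := padic_seqP x; apply. Qed.

Lemma padic_modK x n : (x n %% (q ^ n)%N)%Z = x n.
Proof. by rewrite -padic_intP modz_mod. Qed.

Lemma modz_expS (m : int) n :
  ((m %% (q ^ n.+1)%N)%Z %% (q ^ n)%N)%Z = (m %% (q ^ n)%N)%Z.
Proof.
rewrite [in RHS](divz_eq m (q ^ n.+1)%N) expnSr PoszM mulrA mulrAC.
by rewrite modzMDl.
Qed.

Lemma padic_proof (s : nat -> int) :
  (forall n, (s n.+1 %% (q ^ n)%N)%Z = (s n %% (q ^ n)%N)%Z) ->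
  `[< forall n, ((s n.+1 %% (q ^ n.+1)%N)%Z %% (q ^ n)%N)%Z
                = (s n %% (q ^ n)%N)%Z >].
Proof. by move=> sE; apply/asboolP => n; rewrite modz_expS. Qed.

Definition padic_of s sE := @PadicInt q (fun n => (s n %% (q ^ n)%N)%Z)
  (@padic_proof s sE).

Lemma padic_ext x y : x =1 y -> x = y.
Proof. by move=> xy; apply/val_inj/funext. Qed.

Fact padic_add_proof x y n :
  ((x n.+1 + y n.+1) %% (q ^ n)%N = (x n + y n) %% (q ^ n)%N)%Z.
Proof. by rewrite -modzDm !padic_intP. Qed.

Fact padic_mul_proof x y n :
  ((x n.+1 * y n.+1) %% (q ^ n)%N = (x n * y n) %% (q ^ n)%N)%Z.
Proof. by rewrite -modzMm !padic_intP. Qed.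

Fact padic_opp_proof x n :
  ((- x n.+1) %% (q ^ n)%N = (- x n) %% (q ^ n)%N)%Z.
Proof. by rewrite -modzNm padic_intP. Qed.

Definition padic_add x y := padic_of (padic_add_proof x y).
Definition padic_mul x y := padic_of (padic_mul_proof x y).
Definition padic_opp x := padic_of (padic_opp_proof x).
Definition padic_zero := @padic_of (fun=> 0) (fun=> erefl).
Definition padic_one := @padic_of (fun=> 1) (fun=> erefl).

Fact padic_addA : associative padic_add.
Proof. by move=> x y z; apply: padic_ext => n /=; rewrite modzDml modzDmr addrA. Qed.
Fact padic_addC : commutative padic_add.
Proof. by move=> x y; apply: padic_ext => n /=; rewrite addrC. Qed.
Fact padic_add0 : left_id padic_zero padic_add.
Proof. by move=> x; apply: padic_ext => n /=; rewrite modzDml add0r padic_modK. Qed.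
Fact padic_addN : left_inverse padic_zero padic_opp padic_add.
Proof. by move=> x; apply: padic_ext => n /=; rewrite modzDml addNr. Qed.
Fact padic_mulA : associative padic_mul.
Proof. by move=> x y z; apply: padic_ext => n /=; rewrite modzMml modzMmr mulrA. Qed.
Fact padic_mulC : commutative padic_mul.
Proof. by move=> x y; apply: padic_ext => n /=; rewrite mulrC. Qed.
Fact padic_mul1 : left_id padic_one padic_mul.
Proof. by move=> x; apply: padic_ext => n /=; rewrite modzMml mul1r padic_modK. Qed.
Fact padic_mulD : left_distributive padic_mul padic_add.
Proof.
by move=> x y z; apply: padic_ext => n /=; rewrite modzMml modzDm mulrDl.
Qed.
Fact padic_one_neq0 : padic_one != padic_zero.
Proof.
apply/eqP => /(congr1 (fun x : padic_int q => x 1%N)) /=.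
by rewrite expn1 mod0z modz_small // ltz_nat prime_gt1 // prime_natP.
Qed.

HB.instance Definition _ := GRing.isZmodule.Build (padic_int q)
  padic_addA padic_addC padic_add0 padic_addN.
HB.instance Definition _ := GRing.Zmodule_isComNzRing.Build (padic_int q)
  padic_mulA padic_mulC padic_mul1 padic_mulD padic_one_neq0.

Definition padic_unit : pred (padic_int q) := [pred x | `[< exists y, y * x = 1 >]].
Definition padic_inv x : padic_int q :=
  if pselect (exists y, y * x = 1) is left h then projT1 (cid h) else x.

Fact padic_mulV : {in padic_unit, left_inverse 1 padic_inv *%R}.
Proof.
move=> x /asboolP xu; rewrite /padic_inv; case: pselect => // h.
exact: projT2 (cid h).
Qed.
Fact padic_unitP x y : y * x = 1 -> padic_unit x.
Proof. by move=> yx; apply/asboolP; exists y. Qed.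
Fact padic_invr_out : {in [predC padic_unit], padic_inv =1 id}.
Proof.
move=> x /asboolP xu; rewrite /padic_inv; case: pselect => // h.
Qed.
HB.instance Definition _ := GRing.ComNzRing_hasMulInverse.Build (padic_int q)
  padic_mulV padic_unitP padic_invr_out.

Lemma padic_neq0 x : x != 0 -> exists m, forall n, ~~ ((q ^ m)%N %| x (m + n)%N)%Z.
Proof.
move=> x0; have [m xm] : exists m, x m != 0.
  apply: contrapT => h; move/eqP: x0; apply; apply: padic_ext => n /=.
  by rewrite mod0z; apply: contrapT => xn; apply: h; exists n; apply/eqP.
exists m => n; suff: (x (m + n)%N %% (q ^ m)%N)%Z = x m.
  by move=> xE; apply: contra xm => /dvdz_mod0P; rewrite xE => ->.
elim: n => [|n IHn]; first by rewrite addn0 padic_modK.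
rewrite addnS -IHn -(padic_intP x (m + n)).
move: (x _) => a; rewrite [in LHS](divz_eq a (q ^ (m + n))%N) expnD PoszM.
by rewrite mulrA mulrAC modzMDl.
Qed.

Fact padic_idom x y : x * y = 0 -> (x == 0) || (y == 0).
Proof.
move=> xy0; apply: contraT; rewrite negb_or => /andP[/padic_neq0 [m xm]].
move=> /padic_neq0 [k yk].
have /(congr1 (fun z : padic_int q => z (m + k)%N)) := xy0.
rewrite /= mod0z => /eqP; rewrite -/(dvdz _ _) => /eqP /dvdz_mod0P.
have := xm k; have := yk m; rewrite (addnC k).
rewrite !dvdzE abszM !absz_nat.
set a := `|_|%N; set b := `|_|%N => qa qb qab.
have a0 : (0 < a)%N by case: a qa {qab} => //; rewrite dvdn0.
have b0 : (0 < b)%N by case: b qb {qab} => //; rewrite dvdn0.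
move: qa qb qab; rewrite !pfactor_dvdn ?muln_gt0 ?a0 ?b0 ?prime_natP //.
rewrite lognM // -!ltnNge => ak bm; rewrite leqNgt.
by rewrite addnC (leq_trans (_ : _ < m + k)%N) // addnC -addnS leq_add // ltnW.
Qed.

HB.instance Definition _ :=
  GRing.ComUnitRing_isIntegral.Build (padic_int q) padic_idom.

End PadicInt.

Notation padic q := {fraction (padic_int q)}.


Record gl2 (K : fieldType) := GL2 {
  gl2_mx :> 'M[K]_2;
  gl2_unit : gl2_mx \in unitmx
}.
HB.instance Definition _ K := [isSub for @gl2_mx K].
HB.instance Definition _ K := [Choice of gl2 K by <:].

Section PGL2.
Variable K : fieldType.
Implicit Types A B : gl2 K.

Fact gl2_mul_unit A B : gl2_mx A *m gl2_mx B \in unitmx.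
Proof. by rewrite unitmx_mul !gl2_unit. Qed.
Fact gl2_inv_unit A : invmx A \in unitmx.
Proof. by rewrite unitmx_inv gl2_unit. Qed.

Definition gl2_one : gl2 K := GL2 (unitmx1 _ _).
Definition gl2_mul A B := GL2 (gl2_mul_unit A B).
Definition gl2_inv A := GL2 (gl2_inv_unit A).

Definition proportional A B : bool :=
  `[< exists2 c : K, c != 0 & gl2_mx B = c *: gl2_mx A >].

Fact proportional_refl : reflexive proportional.
Proof. by move=> A; apply/asboolP; exists 1; rewrite ?oner_neq0 ?scale1r. Qed.
Fact proportional_sym : symmetric proportional.
Proof.
suff h A B : proportional A B -> proportional B A.
  by move=> A B; apply/idP/idP; apply: h.
move=> /asboolP[c c0 BE]; apply/asboolP; exists c^-1; first by rewrite invr_neq0.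
by rewrite BE scalerA mulVf // scale1r.
Qed.
Fact proportional_trans : transitive proportional.
Proof.
move=> B A C /asboolP[c c0 BE] /asboolP[d d0 CE]; apply/asboolP.
by exists (d * c); rewrite ?mulf_neq0 // CE BE scalerA.
Qed.
Canonical proportional_equiv :=
  EquivRel proportional proportional_refl proportional_sym proportional_trans.

Definition pgl2 := {eq_quot proportional}.
HB.instance Definition _ := EqQuotient.on pgl2.
HB.instance Definition _ := Choice.on pgl2.

Implicit Types g h k : pgl2.

Definition pgl2_one : pgl2 := \pi_pgl2 gl2_one.
Definition pgl2_mul g h : pgl2 := \pi_pgl2 (gl2_mul (repr g) (repr h)).
Definition pgl2_inv g : pgl2 := \pi_pgl2 (gl2_inv (repr g)).

Lemma pgl2_eqP A B :
  reflect (exists2 c : K, c != 0 & gl2_mx B = c *: gl2_mx A)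
          (\pi_pgl2 A == \pi_pgl2 B).
Proof. by rewrite eqmodE; apply: asboolP. Qed.

Lemma pgl2_reprP A :
  exists2 c : K, c != 0 & gl2_mx (repr (\pi_pgl2 A)) = c *: gl2_mx A.
Proof. by apply/pgl2_eqP; rewrite reprK. Qed.

Lemma pgl2_mulE A B : pgl2_mul (\pi_pgl2 A) (\pi_pgl2 B) = \pi_pgl2 (gl2_mul A B).
Proof.
apply/eqP; rewrite eq_sym; apply/pgl2_eqP => /=.
have [c c0 ->] := pgl2_reprP A; have [d d0 ->] := pgl2_reprP B.
by exists (c * d); rewrite ?mulf_neq0 // -scalemxAl -scalemxAr scalerA.
Qed.

Lemma pgl2_invE A : pgl2_inv (\pi_pgl2 A) = \pi_pgl2 (gl2_inv A).
Proof.
apply/eqP; rewrite eq_sym; apply/pgl2_eqP => /=.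
have [c c0 ->] := pgl2_reprP A.
by exists c^-1; rewrite ?invr_neq0 // invmxZ // unitmxZ ?gl2_unit ?unitfE.
Qed.

Fact pgl2_mulA : associative pgl2_mul.
Proof.
elim/quotW => A; elim/quotW => B; elim/quotW => C; rewrite (pgl2_mulE A B) (pgl2_mulE B C) !pgl2_mulE.
by apply: (congr1 \pi_pgl2); apply/val_inj; rewrite /= mulmxA.
Qed.
Fact pgl2_mul1g : left_id pgl2_one pgl2_mul.
Proof.
elim/quotW => A; rewrite pgl2_mulE.
by apply: (congr1 \pi_pgl2); apply/val_inj; rewrite /= mul1mx.
Qed.
Fact pgl2_mulg1 : right_id pgl2_one pgl2_mul.
Proof.
elim/quotW => A; rewrite pgl2_mulE.
by apply: (congr1 \pi_pgl2); apply/val_inj; rewrite /= mulmx1.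
Qed.
Fact pgl2_mulVg : left_inverse pgl2_one pgl2_inv pgl2_mul.
Proof.
elim/quotW => A; rewrite pgl2_invE pgl2_mulE.
by apply: (congr1 \pi_pgl2); apply/val_inj; rewrite /= mulVmx ?gl2_unit.
Qed.
Fact pgl2_mulgV : right_inverse pgl2_one pgl2_inv pgl2_mul.
Proof.
elim/quotW => A; rewrite pgl2_invE pgl2_mulE.
by apply: (congr1 \pi_pgl2); apply/val_inj; rewrite /= mulmxV ?gl2_unit.
Qed.
HB.instance Definition _ := isGroup.Build pgl2
  pgl2_mulA pgl2_mul1g pgl2_mulg1 pgl2_mulVg pgl2_mulgV.

End PGL2.

Section Lattices.
Variables (O : comNzRingType) (K : fieldType) (iota : {rmorphism O -> K}).

(* The O-span of the columns of B. *)
Definition zspan (B : 'M[K]_2) : set 'cV[K]_2 :=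
  [set B *m map_mx iota x | x in [set: 'cV[O]_2]].

Definition is_lattice (L : set 'cV[K]_2) :=
  exists2 B : 'M[K]_2, B \in unitmx & L = zspan B.

Record lattice := Lattice {
  lattice_set :> set 'cV[K]_2;
  latticeP : `[< is_lattice lattice_set >]
}.
HB.instance Definition _ := [isSub for lattice_set].
HB.instance Definition _ := [Choice of lattice by <:].

Implicit Types (L : lattice) (A : gl2 K).

Fact standard_lattice_proof : `[< is_lattice (zspan 1%:M) >].
Proof. by apply/asboolP; exists 1%:M; rewrite ?unitmx1. Qed.
Definition standard_lattice := Lattice standard_lattice_proof.

Definition homothetic L L' : bool :=
  `[< exists2 c : K, c != 0 &
      (L' : set _) = [set c *: v | v in (L : set _)] >].

Fact homothetic_refl : reflexive homothetic.
Proof.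
move=> L; apply/asboolP; exists 1; rewrite ?oner_neq0 //.
by under eq_imagel do rewrite scale1r; rewrite image_id.
Qed.
Fact homothetic_sym : symmetric homothetic.
Proof.
suff h L L' : homothetic L L' -> homothetic L' L.
  by move=> L L'; apply/idP/idP; apply: h.
move=> /asboolP[c c0 LE]; apply/asboolP; exists c^-1; first by rewrite invr_neq0.
rewrite LE image_comp.
by under eq_imagel do rewrite /= scalerA mulVf // scale1r; rewrite image_id.
Qed.
Fact homothetic_trans : transitive homothetic.
Proof.
move=> L2 L1 L3 /asboolP[c c0 E1] /asboolP[d d0 E2]; apply/asboolP.
exists (d * c); rewrite ?mulf_neq0 // E2 E1 image_comp.
by apply: eq_imagel => v _ /=; rewrite scalerA.
Qed.
Canonical homothetic_equiv :=
  EquivRel homothetic homothetic_refl homothetic_sym homothetic_trans.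

Fact lattice_act_proof A L :
  `[< is_lattice [set gl2_mx A *m v | v in (L : set _)] >].
Proof.
have /asboolP[B Bu ->] := latticeP L; apply/asboolP.
exists (A *m B); first by rewrite unitmx_mul gl2_unit.
by rewrite /zspan image_comp; apply: eq_imagel => x _ /=; rewrite mulmxA.
Qed.
Definition lattice_act A L := Lattice (lattice_act_proof A L).

End Lattices.

Section Tree.
Variables (O : comNzRingType) (K : fieldType) (iota : {rmorphism O -> K}).
Variable q : nat.

Definition vertex := {eq_quot (@homothetic O K iota)}.
HB.instance Definition _ := EqQuotient.on vertex.
HB.instance Definition _ := Choice.on vertex.

Definition base_vertex : vertex := \pi_vertex (standard_lattice iota).
HB.instance Definition _ := isPointed.Build vertex base_vertex.

Implicit Types (v w : vertex) (g h : pgl2 K).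

Definition adjacent : rel vertex := fun v w =>
  (v != w) && `[< exists L L' : lattice iota,
    [/\ v = \pi_vertex L, w = \pi_vertex L',
        [set (q%:R : K) *: x | x in (L : set _)] `<` L'
      & (L' : set _) `<` L] >].

Definition joined_by v w (n : nat) : bool :=
  `[< exists p : seq vertex, [/\ path adjacent v p, last v p = w & size p = n] >].

(* 0 if v and w are not connected, which does not happen. *)
Definition tree_dist v w : nat :=
  if pselect (exists n, joined_by v w n) is left vw then ex_minn vw else 0%N.

Definition vertex_act g v : vertex := \pi_vertex (lattice_act (repr g) (repr v)).

Lemma vertex_eqP (L L' : lattice iota) :
  reflect (exists2 c : K, c != 0 &
             (L' : set _) = [set c *: v | v in (L : set _)])
          (\pi_vertex L == \pi_vertex L').
Proof. by rewrite eqmodE; apply: asboolP. Qed.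

Lemma vertex_actE (A : gl2 K) (L : lattice iota) :
  vertex_act (\pi_(pgl2 K) A) (\pi_vertex L) = \pi_vertex (lattice_act A L).
Proof.
apply/eqP; rewrite eq_sym; apply/vertex_eqP => /=.
have [c c0 ->] := pgl2_reprP A.
have : \pi_vertex L == \pi_vertex (repr (\pi_vertex L)) by rewrite reprK.
move=> /vertex_eqP[d d0 ->].
exists (c * d); rewrite ?mulf_neq0 // !image_comp; apply: eq_imagel => v _ /=.
by rewrite -scalemxAl -scalemxAr scalerA.
Qed.

Lemma vertex_act1 v : vertex_act 1%g v = v.
Proof.
elim/quotW: v => L; rewrite vertex_actE.
apply: (congr1 \pi_vertex); apply/val_inj => /=.
by under eq_imagel do rewrite mul1mx; rewrite image_id.
Qed.

Lemma vertex_actM g h v : vertex_act (g * h)%g v = vertex_act g (vertex_act h v).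
Proof.
elim/quotW: v => L; elim/quotW: g => A; elim/quotW: h => B.
rewrite [(_ * _)%g]pgl2_mulE (vertex_actE B L) !vertex_actE.
apply: (congr1 \pi_vertex); apply/val_inj => /=.
by rewrite image_comp; apply: eq_imagel => v _ /=; rewrite mulmxA.
Qed.

Lemma vertex_actK g : cancel (vertex_act g) (vertex_act g^-1%g).
Proof. by move=> v; rewrite -vertex_actM mulVg vertex_act1. Qed.

Lemma image_proper (T U : Type) (f : T -> U) (X Y : set T) :
  injective f -> X `<` Y -> f @` X `<` f @` Y.
Proof.
move=> f_inj [XY YX]; split; first exact: image_subset.
move=> fYX; apply: YX => y Yy.
by have [x Xx /f_inj <-] := fYX _ (imageP f Yy).
Qed.

Lemma adjacent_act g v w :
  adjacent v w -> adjacent (vertex_act g v) (vertex_act g w).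
Proof.
elim/quotW: g => A /andP[vw /asboolP[L [L' [vL wL' qLL' L'L]]]].
apply/andP; split.
  by apply: contraNneq vw => /(can_inj (vertex_actK _)) ->.
have A_inj : injective (fun x : 'cV[K]_2 => gl2_mx A *m x).
  by move=> x y /(congr1 (mulmx (invmx A))); rewrite !mulKmx ?gl2_unit.
apply/asboolP; exists (lattice_act A L), (lattice_act A L').
split; [by rewrite vL vertex_actE|by rewrite wL' vertex_actE| |].
- have /= := image_proper A_inj qLL'; congr (_ `<` _).
  by rewrite !image_comp; apply: eq_imagel => x _ /=; rewrite scalemxAr.
- exact: image_proper A_inj L'L.
Qed.

Lemma joined_by_act g v w n :
  joined_by (vertex_act g v) (vertex_act g w) n = joined_by v w n.
Proof.
suff h u x g' : joined_by u x n -> joined_by (vertex_act g' u) (vertex_act g' x) n.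
  by apply/idP/idP => [/(h _ _ g^-1%g)|]; [rewrite !vertex_actK|exact: h].
move=> /asboolP[p [up ux pn]]; apply/asboolP.
exists (map (vertex_act g') p); rewrite last_map ux size_map pn; split=> //.
rewrite path_map; apply: sub_path up => a b; exact: adjacent_act.
Qed.

Lemma tree_dist_act g v w :
  tree_dist (vertex_act g v) (vertex_act g w) = tree_dist v w.
Proof.
by rewrite /tree_dist (_ : joined_by _ _ = joined_by v w) //;
  apply/funext => n; exact: joined_by_act.
Qed.

End Tree.

Section Boundary.
Variables (O : comNzRingType) (K : fieldType) (iota : {rmorphism O -> K}).
Variable q : nat.
Local Notation vertex := (vertex iota).
Local Notation dist := (tree_dist q).

Record ray := Ray {
  ray_vertex :> nat -> vertex;
  rayP : `[< forall m n, (m <= n)%N ->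
             dist (ray_vertex m) (ray_vertex n) = (n - m)%N >]
}.
HB.instance Definition _ := [isSub for ray_vertex].
HB.instance Definition _ := [Choice of ray by <:].

Implicit Types (r s : ray) (g h : pgl2 K).

Definition cofinal r s : bool :=
  `[< exists m n, forall k, r (m + k)%N = s (n + k)%N >].

Fact cofinal_refl : reflexive cofinal.
Proof. by move=> r; apply/asboolP; exists 0%N, 0%N. Qed.
Fact cofinal_sym : symmetric cofinal.
Proof.
by move=> r s; apply/idP/idP => /asboolP[m [n rs]]; apply/asboolP; exists n, m.
Qed.
Fact cofinal_trans : transitive cofinal.
Proof.
move=> s r t /asboolP[m [n rs]] /asboolP[n' [p st]]; apply/asboolP.
exists (m + n')%N, (p + n)%N => k.
by rewrite -!addnA rs (addnCA n) st.
Qed.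
Canonical cofinal_equiv := EquivRel cofinal cofinal_refl cofinal_sym cofinal_trans.

Fact ray_act_proof g r : `[< forall m n, (m <= n)%N ->
  dist (vertex_act g (r m)) (vertex_act g (r n)) = (n - m)%N >].
Proof.
apply/asboolP => m n mn; rewrite tree_dist_act.
by have /asboolP := rayP r; apply.
Qed.
Definition ray_act g r := Ray (ray_act_proof g r).

Definition boundary := {eq_quot cofinal}.
HB.instance Definition _ := EqQuotient.on boundary.
HB.instance Definition _ := Choice.on boundary.

Implicit Types (v x : vertex) (w : boundary).

Definition boundary_act g w : boundary := \pi_boundary (ray_act g (repr w)).

Lemma boundary_actE g r : boundary_act g (\pi_boundary r) = \pi_boundary (ray_act g r).
Proof.
apply/eqP; rewrite eqmodE.
have : \pi_boundary (repr (\pi_boundary r)) == \pi_boundary r by rewrite reprK.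
rewrite eqmodE => /asboolP[m [n rs]]; apply/asboolP; exists m, n => k /=.
by rewrite rs.
Qed.

(* The set of the vertices of the ray [v, w). *)
Definition ray_to v w : set vertex :=
  [set x | exists r, [/\ r 0%N = v, w = \pi_boundary r & exists n, r n = x]].

(* The topology is generated by the sets of the ends w such that [o, w) goes
   through a given vertex. *)
HB.instance Definition _ := isSubBaseTopological.Build boundary
  setT (fun x : vertex => [set w | ray_to (base_vertex iota) w x]).

Definition busemann g w : int :=
  let o := base_vertex iota in
  let x := xget o (ray_to o w `&` ray_to (vertex_act g o) w) in
  (dist o x)%:Z - (dist (vertex_act g o) x)%:Z.

End Boundary.

Definition of_padic_int (q : prime_number) : {rmorphism padic_int q -> padic q} :=
  @tofrac (padic_int q).

Notation PGL2 q := (pgl2 (padic q)).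
Notation Omega q := (boundary (of_padic_int q) q).

Section ComplexComplete.
Variable R : realType.

Lemma normc_ge_Im (x : R[i]) : `|complex.Im x|%:C%C <= `|x|.
Proof.
rewrite normc_def lecR -sqrtr_sqr ler_wsqrtr // lerDr; exact: sqr_ge0.
Qed.

Lemma normc_le_ReIm (x : R[i]) : `|x| <= (`|complex.Re x| + `|complex.Im x|)%:C%C.
Proof.
case: x => a b; rewrite normc_def lecR /=.
rewrite -[leRHS]ger0_norm ?addr_ge0 // -sqrtr_sqr ler_wsqrtr //.
by rewrite sqrrD !real_normK ?num_real // lerD2r lerDl mulrn_wge0.
Qed.

Lemma complex_complete (F : set_system R[i]^o) :
  ProperFilter F -> cauchy F -> cvg F.
Proof.
move=> FF /cauchy_ballP F_cauchy.
have cauchy_part (p : R[i]^o -> R) :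
    (forall x y, `|p x - p y|%:C%C <= `|x - y|) -> cvg (p @ F).
  move=> p_le; apply/cauchy_cvgP/cauchy_ballP => _/posnumP[e].
  have e0 : 0 < (e%:num)%:C%C :> R[i] by rewrite (@ltcR R 0).
  have [[A B] /= [FA FB] AB] := F_cauchy _ e0.
  exists (p @` A, p @` B) => /=.
    by split; [apply: filterS FA|apply: filterS FB] => x Ax; exists x.
  move=> _ /= [[x Ax /= <-] [y By /= <-]]; have := AB (x, y) (conj Ax By).
  by rewrite /ball /= -ltcR; apply: le_lt_trans; exact: p_le.
have /cvg_ex[a Fa] : cvg ((fun x : R[i]^o => complex.Re x) @ F).
  by apply: cauchy_part => x y; have := normc_ge_Re (x - y); case: x y => ? ? [].
have /cvg_ex[b Fb] : cvg ((fun x : R[i]^o => complex.Im x) @ F).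
  by apply: cauchy_part => x y; have := normc_ge_Im (x - y); case: x y => ? ? [].
apply/cvg_ex; exists (Complex a b : R[i]^o); apply/cvgrPdist_lt => /= e e0.
have [r r0 ->] : exists2 r : R, 0 < r & e = r%:C%C.
  case: e e0 => x y; rewrite ltcE /= => /andP[/eqP -> x0]; by exists x.
have r20 : 0 < r / 2 by rewrite divr_gt0.
move/cvgrPdist_lt : Fa => /(_ _ r20); rewrite near_map => Fa.
move/cvgrPdist_lt : Fb => /(_ _ r20); rewrite near_map => Fb.
have ReB (u v : R[i]) : complex.Re (u - v) = complex.Re u - complex.Re v.
  by case: u v => ? ? [].
have ImB (u v : R[i]) : complex.Im (u - v) = complex.Im u - complex.Im v.
  by case: u v => ? ? [].
near=> x; apply: le_lt_trans (normc_le_ReIm _) _; rewrite ltcR.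
rewrite [r]splitr ltrD //.
- by rewrite ReB; near: x.
- by rewrite ImB; near: x.
Unshelve. all: by end_near. Qed.

(* R[i] as a normed space over itself; R[i]^o cannot be used directly, as the
   instance of complete space on _^o is the one of the reals. *)
Definition complex_space := R[i]^o.
HB.instance Definition _ := NormedModule.copy complex_space R[i]^o.
HB.instance Definition _ := Uniform_isComplete.Build complex_space complex_complete.

End ComplexComplete.

Record hilbertType (R : realType) := HilbertType {
  hilbert_sort :> completeNormedModType R[i];
  inner : {dot hilbert_sort for conjC};
  inner_norm : forall u, `|u| ^+ 2 = inner u u
}.
Arguments inner {R H} : rename.

Record unitary_rep (G : groupType) (R : realType) := UnitaryRep {
  rep_space :> hilbertType R;
  rep_act : G -> {linear rep_space -> rep_space};
  rep_act1 : forall u, rep_act 1%g u = u;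
  rep_actM : forall g h u, rep_act (g * h)%g u = rep_act g (rep_act h u);
  rep_isometry : forall g u v, inner (rep_act g u) (rep_act g v) = inner u v
}.

Arguments rep_act {G R V} g : rename.

Section TrivialRep.
Variable R : realType.

Definition complex_inner (u v : (complex_space R)) : R[i] := u * conjC v.

Fact complex_inner_linearl v : linear_for *%R (complex_inner ^~ v).
Proof. by move=> a u u'; rewrite /complex_inner mulrDl mulrA. Qed.
Fact complex_inner_linearr u : linear_for (conjC \; *%R) (complex_inner u).
Proof.
by move=> a v v'; rewrite /complex_inner /= rmorphD rmorphM mulrDr mulrCA.
Qed.
HB.instance Definition _ := bilinear_isBilinear.Build R[i] (complex_space R) (complex_space R) R[i]
  *%R (conjC \; *%R) complex_inner (complex_inner_linearl, complex_inner_linearr).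
Fact complex_inner_hermitian u v :
  complex_inner u v = (-1) ^+ false * conjC (complex_inner v u).
Proof. by rewrite /complex_inner expr0 mul1r rmorphM /= conjCK mulrC. Qed.
HB.instance Definition _ := isHermitianSesquilinear.Build R[i] (complex_space R) false
  conjC complex_inner complex_inner_hermitian.
Fact complex_inner_gt0 u : u != 0 -> 0 < complex_inner u u.
Proof. by move=> u0; rewrite /complex_inner mul_conjC_gt0. Qed.
HB.instance Definition _ := isDotProduct.Build R[i] (complex_space R) complex_inner
  complex_inner_gt0.
Fact complex_inner_norm (u : (complex_space R)) : `|u| ^+ 2 = complex_inner u u.
Proof. exact: normCK. Qed.

Definition complex_line : hilbertType R :=
  @HilbertType R (complex_space R) complex_inner complex_inner_norm.

Definition trivial_rep (G : groupType) : unitary_rep G R :=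
  @UnitaryRep G R complex_line (fun=> idfun)
    (fun=> erefl) (fun _ _ _ => erefl) (fun _ _ _ => erefl).

End TrivialRep.

(* The Hilbert tensor product of a finite family of Hilbert spaces, up to
   isomorphism. *)
Record hilbert_tensor (R : realType) n (H : 'I_n -> hilbertType R) := HilbertTensor {
  tensor_space :> hilbertType R;
  pure_tensor : (forall i, H i) -> tensor_space;
  pure_multilinear : forall (u : forall i, H i) i (a : R[i]) (x y : H i),
    pure_tensor (dfwith u i (a *: x + y)) =
    a *: pure_tensor (dfwith u i x) + pure_tensor (dfwith u i y);
  pure_inner : forall u v : (forall i, H i),
    inner (pure_tensor u) (pure_tensor v) = \prod_i inner (u i) (v i);
  pure_dense : dense [set w | exists m (a : 'I_m -> R[i]) (u : 'I_m -> forall i, H i),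
    w = \sum_(k < m) a k *: pure_tensor (u k)]
}.

(* The outer tensor product of unitary representations of G: a
   representation of G^n. *)
Record tensor_rep (G : groupType) (R : realType) n (V : 'I_n -> unitary_rep G R) :=
  TensorRep {
  tensor_rep_space :> hilbert_tensor V;
  tensor_act : ('I_n -> G) -> {linear tensor_rep_space -> tensor_rep_space};
  tensor_isometry : forall g u v,
    inner (tensor_act g u) (tensor_act g v) = inner u v;
  tensor_act_pure : forall g u,
    tensor_act g (pure_tensor tensor_rep_space u) =
    pure_tensor tensor_rep_space (fun i => rep_act (g i) (u i))
}.

Section LocallyConstant.
Variables (R : realType) (T : topologicalType).

Definition locally_constant (F : T -> R[i]) :=
  forall x, \forall y \near x, F y = F x.

Definition locally_constantb : {pred T -> R[i]} := fun F => `[< locally_constant F >].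

Fact locally_constant_submod : submod_closed locally_constantb.
Proof.
split; first by apply/asboolP => x; near=> y.
move=> a F1 F2 /asboolP F1c /asboolP F2c; apply/asboolP => x.
near=> y; rewrite !fctE; congr (a *: _ + _); near: y; [exact: F1c|exact: F2c].
Unshelve. all: by end_near. Qed.
HB.instance Definition _ := GRing.isSubmodClosed.Build R[i] (T -> R[i])
  locally_constantb locally_constant_submod.

Record smooth := Smooth {
  smooth_fun :> T -> R[i];
  smoothP : smooth_fun \in locally_constantb
}.
HB.instance Definition _ := [isSub for smooth_fun].
HB.instance Definition _ := [Choice of smooth by <:].
HB.instance Definition _ := [SubChoice_isSubLmodule of smooth by <:].

Fact smooth_one_proof : (fun=> 1) \in locally_constantb.
Proof. by apply/asboolP => x; near=> y. Unshelve. all: by end_near. Qed.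
Definition smooth_one := Smooth smooth_one_proof.

End LocallyConstant.

Section ComplementarySeries.
Variables (R : realType) (q : prime_number).

Definition compl_act (z : R) (g : PGL2 q) (F : Omega q -> R[i]) :
    Omega q -> R[i] :=
  fun w => F (boundary_act g^-1%g w) * (q%:R `^ (z * (busemann g w)%:~R))%:C%C.

Definition C_infty := smooth R (Omega q).

(* A model of the representation of G on the completion of C_infty for its
   normalized invariant inner product. The image of F under pi_z(g) is named
   F' so as not to need a proof that it is locally constant. *)
Record complementary_series (z : R) := ComplementarySeries {
  cs_inner : {dot C_infty for conjC};
  cs_invariant : forall g (F1 F2 F1' F2' : C_infty),
    F1' = compl_act z g F1 :> (Omega q -> R[i]) ->
    F2' = compl_act z g F2 :> (Omega q -> R[i]) ->
    cs_inner F1' F2' = cs_inner F1 F2;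
  cs_normalized : cs_inner (smooth_one R (Omega q)) (smooth_one R (Omega q)) = 1;
  cs_rep :> unitary_rep (PGL2 q) R;
  cs_embed : {linear C_infty -> cs_rep};
  cs_embed_isometry : forall F1 F2,
    inner (cs_embed F1) (cs_embed F2) = cs_inner F1 F2;
  cs_embed_dense : dense (range cs_embed);
  cs_actE : forall g (F F' : C_infty),
    F' = compl_act z g F :> (Omega q -> R[i]) ->
    rep_act g (cs_embed F) = cs_embed F'
}.

Definition complementary_family :=
  forall z : R, 0 < z < 2^-1 -> complementary_series z.

(* H_0 is the trivial representation; the value for z not in [0, 1/2[ is
   irrelevant. *)
Definition rep_of (H : complementary_family) (z : R) : unitary_rep (PGL2 q) R :=
  if @idP (0 < z < 2^-1) is ReflectT z_in then H z z_in else trivial_rep R _.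

End ComplementarySeries.

Section Partitions.
Variable X : ptopologicalType.

Definition borel := g_sigma_algebraType (@open X).

Record admissible_partition := AdmissiblePartition {
  parts : nat;
  part : 'I_parts -> set borel;
  part_measurable : forall i, measurable (part i);
  part_disjoint : trivIset [set: 'I_parts] part;
  part_cover : \bigcup_i part i = [set: borel]
}.
Implicit Type rho : admissible_partition.

Definition refined_by rho rho' :=
  forall j : 'I_(parts rho'), exists i : 'I_(parts rho), part j `<=` part i.

Definition G_of (G : groupType) rho : set (X -> G) :=
  [set f | forall (i : 'I_(parts rho)) x y, part i x -> part i y -> f x = f y].

(* The i-th component of f under the isomorphism of G_rho with G^n; it is 1
   if the i-th part is empty. *)
Definition component (G : groupType) rho (f : X -> G) (i : 'I_(parts rho)) : G :=
  xget 1%g (f @` part i).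

Lemma G_of_refined (G : groupType) rho rho' :
  refined_by rho rho' -> @G_of G rho `<=` G_of rho'.
Proof. by move=> ref f fG j x y xj yj; have [i ji] := ref j; apply: (fG i); apply: ji. Qed.

Lemma componentE (G : groupType) rho (f : X -> G) (i : 'I_(parts rho)) x :
  G_of rho f -> part i x -> component f i = f x.
Proof.
move=> fG xi; rewrite /component.
by case: xgetP => [_ -> [y yi <-]|/(_ (f x))[]]; [exact: (fG i)|exists x].
Qed.

Variables (R : realType) (q : prime_number) (H : complementary_family R q).
Variable mu : {measure set borel -> \bar R}.

Definition H_of rho :=
  tensor_rep (fun i : 'I_(parts rho) => rep_of H (fine (mu (part i)))).

Definition pi_of rho (Hrho : H_of rho) (f : X -> PGL2 q) : Hrho -> Hrho :=
  tensor_act Hrho (component f).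

Definition isometric_embedding rho rho' (H1 : H_of rho) (H2 : H_of rho')
    (j : {linear H1 -> H2}) :=
  forall u v, inner (j u) (j v) = inner u v.

Definition commutes_with_G rho rho' (H1 : H_of rho) (H2 : H_of rho')
    (j : {linear H1 -> H2}) :=
  forall f, G_of rho f -> forall u, j (pi_of f u) = pi_of f (j u).

End Partitions.

(* Main.v *)
(* Only one isometric embedding per refinement is needed: j20 is taken to be
   the composite of j21 and j10.

   The spherical vector of pi_z has one translate e_v for each vertex v of the
   tree. By the Hecke relation, <e_u, e_v> is a combination of a^n and b^n,
   where n = d(u, v), a = q^(-z) and b = q^(z - 1). In the inner products of the
   vectors f_(u,v) = e_v - b e_w, where w is the neighbour of v on the geodesic
   to u, the powers of b disappear: <f_(u,v), f_(u',v')> is c_z a^d(w,w') as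
   soon as the edges (w, v) and (w', v') point away from each other. As q^(-z)
   is multiplicative in z, when z = z_1 + ... + z_k the tensor products of the
   vectors f_(u,v) of the pi_(z_j) have, up to a constant, the inner products
   of the vectors f_(u,v) of pi_z, except for pairs of edges on a common
   geodesic from u. The sum of the f_(u,v) over the sphere of radius n around u
   is a multiple of e_u, and the exceptional pairs contribute O((b / a)^n) to
   the normalized Gram matrices. So the normalized sums over spheres of the
   tensor products converge to vectors with the Gram matrix of the e_u, which
   defines the isometric embedding; it is equivariant because the spheres and
   the edge vectors are. *)

Require Import Defs.
From HB Require Import structures.
From mathcomp Require Import all_boot all_order all_algebra.
From mathcomp Require Import generic_quotient fraction sesquilinear complex.
From mathcomp Require Import all_classical all_reals all_analysis.
From mathcomp Require Import finmap ring lra zify.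

Set Implicit Arguments.
Unset Strict Implicit.
Unset Printing Implicit Defensive.

Import Order.TTheory GRing.Theory Num.Theory.
Import numFieldNormedType.Exports.

Local Open Scope quotient_scope.
Local Open Scope classical_set_scope.
Local Open Scope ring_scope.

Section PadicIntegers.
Variable q : prime_number.
Implicit Types x y : padic_int q.

Lemma prime_number_gt0 : (0 < q)%N.
Proof. by rewrite prime_gt0 ?prime_natP. Qed.

Lemma padic_natr_seq (m n : nat) : (m%:R : padic_int q) n = (m %% (q ^ n)%N)%Z.
Proof.
elim: m => [|m IHm] //.
by rewrite -addn1 natrD [LHS]/= IHm /= modzDm -PoszD.
Qed.

Lemma padic_mod_le x m n : (m <= n)%N -> (x n %% (q ^ m)%N)%Z = x m.
Proof.
move=> /subnK <-; elim: (n - m)%N => [|k IHk]; first exact: padic_modK.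
rewrite addSn -[RHS]IHk -(padic_intP x (k + m)); move: (x _) => a.
rewrite [in LHS](divz_eq a (q ^ (k + m))%N) expnD PoszM mulrA.
by rewrite modzMDl.
Qed.

Lemma padic_seq0 x : x 0%N = 0.
Proof. by rewrite -(padic_modK x 0) expn0 modz1. Qed.

Lemma padic_coprime x n : x 1%N != 0 -> coprimez (x n) (q ^ n)%N.
Proof.
move=> x1; case: n => [|n]; first by rewrite expn0 /coprimez gcdz1.
rewrite coprimezE absz_nat coprime_sym coprimeXl // prime_coprime ?prime_natP //.
apply: contra x1 => qx; rewrite -(@padic_mod_le x 1 n.+1) // expn1.
by apply/eqP/dvdz_mod0P; rewrite dvdzE.
Qed.

Lemma padic_unit_mod x : x 1%N != 0 -> x \is a GRing.unit.
Proof.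
move=> x1; pose s n := (egcdz (x n) (q ^ n)%N).1.
have sP n : ((q ^ n)%N %| x n * s n - 1)%Z.
  rewrite /s; case: egcdzP => u v /= uv _.
  have /eqP <- := padic_coprime n x1.
  by rewrite -uv mulrC opprD addrA subrr sub0r rpredN dvdz_mull.
have s_mod n : (s n.+1 %% (q ^ n)%N)%Z = (s n %% (q ^ n)%N)%Z.
  apply/eqP; rewrite eqz_mod_dvd.
  have : ((q ^ n)%N %| x n * (s n.+1 - s n))%Z.
    have d1 : ((q ^ n)%N %| x n.+1 * s n.+1 - 1)%Z.
      by apply: dvdz_trans (sP n.+1); rewrite expnS PoszM dvdz_mull.
    have d2 : ((q ^ n)%N %| (x n.+1 - x n) * s n.+1)%Z.
      by apply: dvdz_mulr; rewrite -eqz_mod_dvd padic_modK padic_intP.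
    rewrite (_ : x n * _ = x n.+1 * s n.+1 - 1 - (x n.+1 - x n) * s n.+1
                           - (x n * s n - 1)); last by ring.
    by apply: rpredB (sP n); apply: rpredB d1 d2.
  by rewrite Gauss_dvdzr // coprimez_sym padic_coprime.
apply: (@padic_unitP q _ (padic_of s_mod)); apply: padic_ext => n /=.
rewrite modzMml mulrC; apply/eqP; rewrite eqz_mod_dvd; exact: sP.
Qed.

Lemma padic_div_prime x : x 1%N = 0 -> exists y, x = q%:R * y.
Proof.
move=> x1.
have qx n : (Posz q %| x n.+1)%Z.
  by apply/dvdz_mod0P; rewrite -[X in (_ %% X)%Z]/(Posz (q ^ 1)) padic_mod_le.
have q0 : Posz q != 0 by rewrite eqz_nat -lt0n prime_number_gt0.
pose s n := (x n.+1 %/ q)%Z.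
have sE n : x n.+1 = Posz q * s n by rewrite mulrC divzK.
have s_mod n : (s n.+1 %% (q ^ n)%N)%Z = (s n %% (q ^ n)%N)%Z.
  apply/eqP; rewrite eqz_mod_dvd -(@dvdz_mul2l (Posz q)) //.
  rewrite mulrBr -!sE -PoszM -expnS -eqz_mod_dvd.
  by rewrite padic_modK padic_intP.
exists (padic_of s_mod); apply: padic_ext => n /=.
by rewrite padic_natr_seq modzMml modzMmr -sE padic_intP.
Qed.

Lemma padic_seq1_eq0 x : (x 1%N == 0) = (x \isn't a GRing.unit).
Proof.
apply/idP/idP => [/eqP x1|]; last by apply: contraNT => /padic_unit_mod.
apply/negP => /mulVr /(congr1 (fun y : padic_int q => y 1%N)) /=.
rewrite x1 mulr0 mod0z modz_small // expn1 ltz_nat.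
by rewrite prime_gt1 ?prime_natP.
Qed.

Lemma padic_prime_neq0 : q%:R != 0 :> padic_int q.
Proof.
apply/eqP => /(congr1 (fun y : padic_int q => y 2%N)); rewrite padic_natr_seq /=.
rewrite mod0z modz_small ?lez_nat // => [[q0]|].
  by have := prime_number_gt0; rewrite q0.
by rewrite ltz_nat -[X in (X < _)%N]expn1 ltn_exp2l ?prime_gt1 ?prime_natP.
Qed.

Lemma padic_prime_nunit : (q%:R : padic_int q) \isn't a GRing.unit.
Proof. by rewrite -padic_seq1_eq0 padic_natr_seq expn1 modzz. Qed.

Lemma padic_nunitP x : reflect (exists y, x = q%:R * y) (x \isn't a GRing.unit).
Proof.
rewrite -padic_seq1_eq0; apply: (iffP eqP) => [/padic_div_prime //|[y ->]].
by apply/eqP; rewrite padic_seq1_eq0 unitrM negb_and padic_prime_nunit.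
Qed.

Lemma padic_valuation x : x != 0 ->
  exists n u, u \is a GRing.unit /\ x = q%:R ^+ n * u.
Proof.
move=> x0; have [m xm] : exists m, x m != 0.
  apply: contrapT => h; case/eqP: x0; apply: padic_ext => n /=.
  by rewrite mod0z; apply: contrapT => xn; apply: h; exists n; apply/eqP.
elim: m x xm {x0} => [x|m IHm x xm]; first by rewrite padic_seq0.
have [xu|/padic_nunitP[y xE]] := boolP (x \is a GRing.unit).
  by exists 0%N, x; rewrite expr0 mul1r.
have [|n [u [uu yE]]] := IHm y; last by exists n.+1, u; rewrite xE yE exprS mulrA.
apply: contra xm => /eqP ym; rewrite xE /= padic_natr_seq modzMml.
apply/eqP/dvdz_mod0P; rewrite expnS PoszM dvdz_mul //.
by apply/dvdz_mod0P; rewrite padic_intP.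
Qed.

Lemma padic_residue x : exists c : 'I_q, exists y, x = c%:R + q%:R * y.
Proof.
have x1_ge0 : 0 <= x 1%N.
  by rewrite -padic_modK modz_ge0 // expn1 eqz_nat -lt0n prime_number_gt0.
have x1_lt : x 1%N < q.
  by rewrite -padic_modK expn1 ltz_pmod // ltz_nat prime_number_gt0.
have cq : (`|x 1%N| < q)%N by rewrite -ltz_nat gez0_abs.
exists (Ordinal cq) => /=.
have [|y yE] := @padic_div_prime (x - `|x 1%N|%N%:R); last first.
  by exists y; rewrite -yE addrC subrK.
rewrite /= padic_natr_seq gez0_abs // modzDmr -modzDmr modzNm expn1 modzDmr.
by rewrite subrr mod0z.
Qed.

Lemma padic_natr_unit (c : nat) : (0 < c < q)%N ->
  (c%:R : padic_int q) \is a GRing.unit.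
Proof.
move=> /andP[c0 cq]; rewrite -[_ \is a _]negbK -padic_seq1_eq0 padic_natr_seq expn1.
by rewrite modz_small // eqz_nat -lt0n.
Qed.

End PadicIntegers.

Section Matrix2.
Variable R : comNzRingType.

Definition mx2 (a b c d : R) : 'M[R]_2 :=
  \matrix_(i, j) if i == 0 then (if j == 0 then a else b)
                 else (if j == 0 then c else d).

Lemma mx2_eta (A : 'M[R]_2) : A = mx2 (A 0 0) (A 0 1) (A 1 0) (A 1 1).
Proof.
apply/matrixP => i j; rewrite mxE.
by case: (unliftP 0 i) => [i'|] ->; case: (unliftP 0 j) => [j'|] ->;
  rewrite ?(ord1 i') ?(ord1 j') //=; congr (A _ _); apply/val_inj.
Qed.

Lemma ord2P (i : 'I_2) : i = 0 \/ i = 1.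
Proof. by case: i => [[|[|]] //= i]; [left|right]; apply: val_inj. Qed.

Lemma mx2_mul a b c d a' b' c' d' :
  mx2 a b c d *m mx2 a' b' c' d' =
  mx2 (a * a' + b * c') (a * b' + b * d') (c * a' + d * c') (c * b' + d * d').
Proof.
rewrite [LHS]mx2_eta; congr mx2;
by rewrite !mxE !big_ord_recl big_ord0 !mxE /= addr0.
Qed.

Lemma mx2_scale k a b c d : k *: mx2 a b c d = mx2 (k * a) (k * b) (k * c) (k * d).
Proof. by rewrite [LHS]mx2_eta; congr mx2; rewrite !mxE. Qed.

Lemma mx2_det a b c d : \det (mx2 a b c d) = a * d - b * c.
Proof. by rewrite (expand_det_row _ 0) !big_ord_recl big_ord0 /cofactor !det_mx11 !mxE /=;
  ring. Qed.

Lemma mx2_scalar k : k%:M = mx2 k 0 0 k.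
Proof. by rewrite [LHS]mx2_eta; congr mx2; rewrite !mxE. Qed.

End Matrix2.

Section PadicFractions.
Variable q : prime_number.

Lemma of_padic_int_inj : injective (of_padic_int q).
Proof. by move=> x y /eqP; rewrite tofrac_eq => /eqP. Qed.

Lemma padic_fraction (x : padic q) :
  exists a b, b != 0 /\ x = of_padic_int q a / of_padic_int q b.
Proof.
elim/quotW: x => x; have dx := denom_ratioP x.
exists (frac x).1, (frac x).2; split=> //.
have iota_dx : of_padic_int q (frac x).2 != 0 by rewrite tofrac_eq0.
apply: (mulIf iota_dx); rewrite divfK // /of_padic_int.
rewrite /GRing.mul /= !piE; apply/eqP; rewrite FracField.equivf_def.
by rewrite /FracField.mulf !numden_Ratio ?mulf_neq0 ?oner_neq0 // !mulr1 mulrC.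
Qed.

End PadicFractions.

(* [q] is a prime element of the discrete valuation ring [O], whose residue
   field is [{0, ..., q - 1}], and [K] is the field of fractions of [O]. The
   tree is studied in this generality because unification is very slow on the
   concrete field of fractions. *)
Record discrete_valuation (O : idomainType) (K : fieldType)
    (iota : {rmorphism O -> K}) (q : nat) : Prop := DiscreteValuation {
  dv_inj : injective iota;
  dv_fraction : forall x : K, exists a b, b != 0 /\ x = iota a / iota b;
  dv_nunitP : forall x : O, x \isn't a GRing.unit <-> exists y, x = q%:R * y;
  dv_valuation : forall x : O, x != 0 ->
    exists n u, u \is a GRing.unit /\ x = q%:R ^+ n * u;
  dv_residue : forall x : O, exists c : 'I_q, exists y, x = c%:R + q%:R * y;
  dv_natr_unit : forall c, (0 < c < q)%N -> (c%:R : O) \is a GRing.unit;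
  dv_prime_neq0 : q%:R != 0 :> O
}.

Lemma padic_discrete_valuation (q : prime_number) :
  discrete_valuation (of_padic_int q) q.
Proof.
split; [exact: of_padic_int_inj|exact: padic_fraction|by move=> x; split=> /padic_nunitP
  |exact: padic_valuation|exact: padic_residue|exact: padic_natr_unit
  |exact: padic_prime_neq0].
Qed.

Section BruhatTitsTree.
Variables (O : idomainType) (K : fieldType) (iota : {rmorphism O -> K}) (q : nat).
Hypothesis dv : discrete_valuation iota q.
Local Notation vertex := (vertex iota).
Local Notation o := (base_vertex iota).
Local Notation "A ^F" := (map_mx iota A) (at level 2, format "A ^F").
Local Notation p := (q%:R : O).

Lemma map_mx_unit (A : 'M[O]_2) : \det A != 0 -> A^F \in unitmx.
Proof.
move=> A0; rewrite unitmxE det_map_mx unitfE.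
by rewrite -(rmorph0 iota) (inj_eq (dv_inj dv)).
Qed.

Lemma map_mx_inj2 (A B : 'M[O]_2) : A^F = B^F -> A = B.
Proof.
move=> /matrixP E; apply/matrixP => i j; apply: (dv_inj dv).
by have := E i j; rewrite !mxE.
Qed.

Lemma map_unitmx (A : 'M[O]_2) : A \in unitmx -> A^F \in unitmx.
Proof. by rewrite !unitmxE det_map_mx; exact: rmorph_unit. Qed.

Lemma zspan_subP (B B' : 'M[K]_2) :
  zspan iota B' `<=` zspan iota B <-> exists X : 'M[O]_2, B' = B *m X^F.
Proof.
split=> [sub|[X ->] _ [x _ <-]]; last first.
  by exists (X *m x) => //; rewrite map_mxM mulmxA.
have colP j : exists x : 'cV[O]_2, col j B' = B *m x^F.
  have [|x _ <-] := sub (col j B'); last by exists x.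
  exists (delta_mx j 0) => //; rewrite colE; congr (_ *m _).
  exact: map_delta_mx.
have [x xE] := choice colP.
exists (\matrix_(i, j) x j i 0); apply/matrixP => i j.
have /matrixP/(_ i 0) := xE j; rewrite !mxE => ->.
by apply: eq_bigr => k _; rewrite !mxE.
Qed.

Lemma zspan_scale (c : K) (B : 'M[K]_2) :
  [set c *: v | v in zspan iota B] = zspan iota (c *: B).
Proof.
by rewrite /zspan image_comp; apply: eq_imagel => x _ /=; rewrite scalemxAl.
Qed.

Lemma zspan_eqP (B B' : 'M[K]_2) : B \in unitmx -> B' \in unitmx ->
  zspan iota B' = zspan iota B <->
  exists2 X : 'M[O]_2, X \in unitmx & B' = B *m X^F.
Proof.
move=> Bu Bu'; split=> [E|[X Xu ->]].
  have [X XE] : exists X : 'M[O]_2, B' = B *m X^F by apply/zspan_subP; rewrite E.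
  have [Y YE] : exists X : 'M[O]_2, B = B' *m X^F by apply/zspan_subP; rewrite E.
  exists X => //; apply: (mulmx1_unit (B := Y) _).1.
  apply: map_mx_inj2; rewrite map_mxM map_mx1.
  by apply: (can_inj (mulKmx Bu)); rewrite mulmxA -XE -YE mulmx1.
apply/seteqP; split; apply/zspan_subP; first by exists X.
by exists (invmx X); rewrite -mulmxA -map_mxM mulmxV // map_mx1 mulmx1.
Qed.

(* The vertex of the lattice spanned by the columns of [B]; singular matrices
   are sent to the base vertex. *)
Definition mxvertex (B : 'M[K]_2) : vertex :=
  vertex_act (\pi_(pgl2 K) (insubd (gl2_one K) B)) o.

Lemma mxvertexE (B : 'M[K]_2) (L : lattice iota) :
  B \in unitmx -> lattice_set L = zspan iota B -> mxvertex B = \pi_vertex L.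
Proof.
move=> Bu LE; rewrite /mxvertex vertex_actE; congr (\pi_vertex _).
apply/val_inj; rewrite /= LE /zspan image_comp.
by apply: eq_imagel => x _ /=; rewrite insubdK // mul1mx.
Qed.

Lemma lattice_mx (L : lattice iota) :
  exists2 B, B \in unitmx & lattice_set L = zspan iota B.
Proof. by have /asboolP := latticeP L. Qed.

Lemma mxvertex_surj (v : vertex) : exists2 B, B \in unitmx & v = mxvertex B.
Proof.
elim/quotW: v => L; have [B Bu LE] := lattice_mx L.
by exists B => //; rewrite (mxvertexE Bu LE).
Qed.

Lemma mxvertex_act (A B : 'M[K]_2) (Au : A \in unitmx) : B \in unitmx ->
  vertex_act (\pi_(pgl2 K) (GL2 Au)) (mxvertex B) = mxvertex (A *m B).
Proof.
move=> Bu; rewrite /mxvertex -vertex_actM; congr (vertex_act _ _).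
rewrite [LHS]pgl2_mulE; congr (\pi_(pgl2 K) _); apply/val_inj => /=.
by rewrite !insubdK // [_ \in _]unitmx_mul Au.
Qed.

Lemma mxvertex1 : mxvertex 1%:M = o.
Proof. by rewrite (mxvertexE (unitmx1 _ _) (L := standard_lattice iota)). Qed.

Lemma mxvertex_eqP (B B' : 'M[K]_2) : B \in unitmx -> B' \in unitmx ->
  mxvertex B = mxvertex B' <->
  exists c (X : 'M[O]_2), [/\ c != 0, X \in unitmx & B' = c *: (B *m X^F)].
Proof.
move=> Bu Bu'.
have latP (C : 'M[K]_2) : C \in unitmx -> `[< is_lattice iota (zspan iota C) >].
  by move=> Cu; apply/asboolP; exists C.
rewrite (mxvertexE Bu (L := Lattice (latP _ Bu))) //.
rewrite (mxvertexE Bu' (L := Lattice (latP _ Bu'))) //.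
split=> [/eqP/vertex_eqP[c c0 /=]|[c [X [c0 Xu B'E]]]].
  rewrite zspan_scale => /zspan_eqP[]//; first by rewrite unitmxZ ?unitfE.
  by move=> X Xu ->; exists c, X; rewrite scalemxAl.
apply/eqP/vertex_eqP; exists c => //=; rewrite zspan_scale B'E.
apply/zspan_eqP; rewrite ?unitmxZ ?unitfE // ?unitmx_mul ?Bu ?map_unitmx //.
by exists X => //; rewrite scalemxAl.
Qed.

Lemma mxvertex_mulr (B : 'M[K]_2) (X : 'M[O]_2) : B \in unitmx -> X \in unitmx ->
  mxvertex (B *m X^F) = mxvertex B.
Proof.
move=> Bu Xu; apply/esym/mxvertex_eqP; rewrite ?unitmx_mul ?Bu ?map_unitmx //.
by exists 1, X; rewrite oner_neq0 scale1r.
Qed.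

Lemma mxvertexZ (B : 'M[K]_2) (c : K) : B \in unitmx -> c != 0 ->
  mxvertex (c *: B) = mxvertex B.
Proof.
move=> Bu c0; apply/esym/mxvertex_eqP; rewrite ?unitmxZ ?unitfE //.
by exists c, 1%:M; rewrite c0 unitmx1 map_mx1 mulmx1.
Qed.

Definition primitive (A : 'M[O]_2) := [exists i, exists j, A i j \is a GRing.unit].

Lemma nprimitiveP A : reflect (exists B, A = p *: B) (~~ primitive A).
Proof.
apply: (iffP idP) => [|[B ->]].
  rewrite negb_exists => /forallP A_nu.
  have AE i j : exists y, A i j = p * y.
    by apply/(dv_nunitP dv); have := A_nu i; rewrite negb_exists => /forallP.
  have [f fE] := choice (fun ij : 'I_2 * 'I_2 => AE ij.1 ij.2).
  by exists (\matrix_(i, j) f (i, j)); apply/matrixP => i j; rewrite !mxE -fE.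
rewrite negb_exists; apply/forallP => i; rewrite negb_exists; apply/forallP => j.
by rewrite mxE; apply/(dv_nunitP dv); exists (B i j).
Qed.

Lemma primitive_mul (X A Y : 'M[O]_2) : X \in unitmx -> Y \in unitmx ->
  primitive (X *m A *m Y) = primitive A.
Proof.
move=> Xu Yu; apply/idP/idP; apply: contraTT => /nprimitiveP[B E];
  apply/nprimitiveP.
  by exists (X *m B *m Y); rewrite E -scalemxAr -scalemxAl.
exists (invmx X *m B *m invmx Y).
by rewrite scalemxAl scalemxAr -E !mulmxA mulVmx // mul1mx mulmxK.
Qed.

Definition has_valuation n (x : O) := exists2 u, u \is a GRing.unit & x = p ^+ n * u.

Lemma valuation_uniq n m (x : O) : has_valuation n x -> has_valuation m x -> n = m.
Proof.
wlog nm : n m / (n <= m)%N.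
  by move=> h hn hm; case/orP: (leq_total n m) => /h; [|move=> /(_ hm hn)]; auto.
move=> [u uu ->] [w wu]; rewrite -(subnKC nm) exprD -mulrA.
have /mulfI h : p ^+ n != 0 by rewrite expf_neq0 // (dv_prime_neq0 dv).
move=> /h uE; case: (m - n)%N uE => [|k uE]; first by rewrite addn0.
suff : u \isn't a GRing.unit by rewrite uu.
by apply/(dv_nunitP dv); exists (p ^+ k * w); rewrite uE exprS mulrA.
Qed.

Lemma has_valuation0 u : u \is a GRing.unit -> has_valuation 0 u.
Proof. by move=> uu; exists u => //; rewrite expr0 mul1r. Qed.

Lemma has_valuationX n : has_valuation n (p ^+ n).
Proof. by exists 1; rewrite ?unitr1 ?mulr1. Qed.

Lemma has_valuationM n m x y :
  has_valuation n x -> has_valuation m y -> has_valuation (n + m) (x * y).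
Proof.
move=> [u uu ->] [w wu ->]; exists (u * w); first by rewrite unitrM uu.
by rewrite exprD; ring.
Qed.

Lemma has_valuation_unitl n u x :
  u \is a GRing.unit -> has_valuation n x -> has_valuation n (u * x).
Proof. by move=> /has_valuation0 u0 /(has_valuationM u0). Qed.

Lemma has_valuation_neq0 n x : has_valuation n x -> x != 0.
Proof.
move=> [u uu ->]; rewrite mulf_neq0 ?expf_neq0 ?(dv_prime_neq0 dv) //.
by apply: contraTneq uu => ->; rewrite unitr0.
Qed.

Definition level_of n (v : vertex) := exists A : 'M[O]_2,
  [/\ primitive A, has_valuation n (\det A) & v = mxvertex A^F].

Lemma level_ex v : exists n, level_of n v.
Proof.
have [B Bu ->] := mxvertex_surj v.
have [c [A [c0 AE]]] : exists c, exists A : 'M[O]_2, c != 0 /\ A^F = c *: B.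
  have [f fE] := choice (fun ij : 'I_2 * 'I_2 => dv_fraction dv (B ij.1 ij.2)).
  have [h hE] := choice fE.
  exists (\prod_ij iota (h ij)).
  exists (\matrix_(i, j) (f (i, j) * \prod_(ij | ij != (i, j)) h ij)); split.
    apply/prodf_neq0 => ij _; rewrite -(rmorph0 iota) (inj_eq (dv_inj dv)).
    by have [] := hE ij.
  apply/matrixP => i j; have [h0 /= BE] := hE (i, j).
  rewrite !mxE BE [in RHS](bigD1 (i, j)) //= rmorphM rmorph_prod mulrAC.
  by rewrite mulrCA divff ?mulr1 // -(rmorph0 iota) (inj_eq (dv_inj dv)).
have A0 : \det A != 0.
  apply: contraTneq Bu => A0; rewrite unitmxE unitfE -(can_eq (mulKf c0)) mulr0.
  rewrite -(can_eq (mulKf c0)) mulr0 mulrA -expr2 -detZ -AE det_map_mx A0.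
  by rewrite rmorph0 eqxx.
have -> : mxvertex B = mxvertex A^F by rewrite AE mxvertexZ.
have [n [u [uu AuE]]] := dv_valuation dv A0.
elim/ltn_ind: n A {c0 AE A0} u uu AuE => n IHn A u uu AuE.
have [Ap|/nprimitiveP[A1 AE]] := boolP (primitive A).
  by exists n, A; split=> //; exists u.
have detA : \det A = p ^+ 2 * \det A1 by rewrite AE detZ.
have A0 : \det A != 0 by apply: (@has_valuation_neq0 n); exists u.
have [m [w [wu A1E]]] : exists n u, u \is a GRing.unit /\ \det A1 = p ^+ n * u.
  by apply: (dv_valuation dv); apply: contraNneq A0; rewrite detA => ->; rewrite mulr0.
have nE : n = (2 + m)%N.
  apply: (@valuation_uniq _ _ (\det A)); first by exists u.
  by exists w; rewrite // detA A1E mulrA -exprD.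
have -> : mxvertex A^F = mxvertex A1^F.
  rewrite AE (_ : (p *: A1)^F = iota p *: A1^F); last first.
    by apply/matrixP => i j; rewrite !mxE rmorphM.
  rewrite mxvertexZ ?map_mx_unit //.
    by apply: contraNneq A0; rewrite detA => ->; rewrite mulr0.
  by rewrite -(rmorph0 iota) (inj_eq (dv_inj dv)) (dv_prime_neq0 dv).
by apply: IHn A1E => //; rewrite nE ltnS leqW.
Qed.

Lemma level_uniq n m v : level_of n v -> level_of m v -> n = m.
Proof.
move=> [A [Ap An ->]] [B [Bp Bm]].
have A0 := has_valuation_neq0 An; have B0 := has_valuation_neq0 Bm.
move=> /mxvertex_eqP[]; rewrite ?map_mx_unit // => c [X [c0 Xu BE]].
have integral (d : K) (C D : 'M[O]_2) : primitive C -> D^F = d *: C^F ->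
    exists e, d = iota e.
  move=> /existsP[i /existsP[j Cij]] /matrixP/(_ i j); rewrite !mxE => DE.
  exists (D i j / C i j); rewrite rmorphM rmorphV // DE mulfK //.
  by rewrite -(rmorph0 iota) (inj_eq (dv_inj dv)); apply: contraTneq Cij => ->; rewrite unitr0.
rewrite -map_mxM in BE.
have AXp : primitive (A *m X) by rewrite -(mul1mx A) primitive_mul ?unitmx1.
have [a aE] := integral _ _ _ AXp BE.
have [b bE] : exists b, c^-1 = iota b.
  by apply: (integral _ _ _ Bp); rewrite BE scalerA mulVf // scale1r.
have ba : b * a = 1.
  by apply: (dv_inj dv); rewrite rmorphM rmorph1 -aE -bE mulVf.
have au : a \is a GRing.unit by apply/unitrP; exists b; rewrite [a * b]mulrC ba.
have BE' : B = a *: (A *m X).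
  by apply: map_mx_inj2; rewrite BE aE; apply/matrixP => i j; rewrite !mxE rmorphM.
apply: valuation_uniq Bm; rewrite BE' detZ det_mulmx mulrCA.
rewrite -[n]addn0; apply: has_valuationM An _; apply: has_valuation0.
by rewrite unitrM unitrX // -unitmxE.
Qed.

Definition level v := projT1 (cid (level_ex v)).

Lemma levelP v : level_of (level v) v.
Proof. exact: projT2 (cid (level_ex v)). Qed.

Lemma level_mx n (A : 'M[O]_2) :
  primitive A -> has_valuation n (\det A) -> level (mxvertex A^F) = n.
Proof. by move=> Ap An; apply: level_uniq (levelP _) _; exists A. Qed.

Lemma smith (A : 'M[O]_2) n : primitive A -> has_valuation n (\det A) ->
  exists X Y, [/\ X \in unitmx, Y \in unitmx & A = X *m mx2 1 0 0 (p ^+ n) *m Y].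
Proof.
have unit0 (B : 'M[O]_2) : B 0 0 \is a GRing.unit -> has_valuation n (\det B) ->
  exists X Y, [/\ X \in unitmx, Y \in unitmx & B = X *m mx2 1 0 0 (p ^+ n) *m Y].
  rewrite (mx2_eta B) !mxE /= mx2_det.
  move: (B 0 0) (B 0 1) (B 1 0) (B 1 1) => a b c d au [u uu detB].
  exists (mx2 1 0 (c / a) 1), (mx2 a b 0 (u / a)).
  split; rewrite ?unitmxE ?mx2_det ?mulr0 ?mul0r ?subr0 ?mulr1 ?unitr1 //.
    by rewrite unitrM au unitrM uu unitrV.
  rewrite !mx2_mul; congr mx2; rewrite ?(mul1r, mul0r, mulr0, addr0, add0r, mulr1) //.
    by rewrite divrK.
  rewrite (_ : _ + _ = (b * c + p ^+ n * u) / a); last by ring.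
  by rewrite -detB addrC subrK [a * d]mulrC mulrK.
pose w : 'M[O]_2 := mx2 0 1 1 0.
have wu : w \in unitmx by rewrite unitmxE mx2_det mul0r sub0r mulr1 unitrN unitr1.
have ww : w *m w = 1%:M.
  by rewrite mx2_mul mx2_scalar; congr mx2; ring.
move=> Ap An.
have det_wl (B : 'M[O]_2) : has_valuation n (\det B) -> has_valuation n (\det (w *m B)).
  by move=> Bn; rewrite det_mulmx; apply: has_valuation_unitl; rewrite -?unitmxE.
have det_wr (B : 'M[O]_2) : has_valuation n (\det B) -> has_valuation n (\det (B *m w)).
  by move=> Bn; rewrite det_mulmx mulrC; apply: has_valuation_unitl; rewrite -?unitmxE.
have E : [|| A 0 0 \is a GRing.unit, (A *m w) 0 0 \is a GRing.unit,
   (w *m A) 0 0 \is a GRing.unit | (w *m A *m w) 0 0 \is a GRing.unit].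
  have -> : (A *m w) 0 0 = A 0 1.
    by rewrite {1}(mx2_eta A) mx2_mul mxE /= mulr0 mulr1 add0r.
  have wA : w *m A = mx2 (A 1 0) (A 1 1) (A 0 0) (A 0 1).
    by rewrite {1}(mx2_eta A) mx2_mul; congr mx2; ring.
  have -> : (w *m A *m w) 0 0 = A 1 1.
    by rewrite wA mx2_mul mxE /= mulr0 mulr1 add0r.
  rewrite wA mxE /=; move/existsP: Ap => [i /existsP[j]].
  by case: (ord2P i) => ->; case: (ord2P j) => -> ->; rewrite ?orbT.
case/or4P: E => /unit0.
- by apply.
- move=> /(_ (det_wr _ An))[X [Y [Xu Yu AE]]].
  exists X, (Y *m w); rewrite unitmx_mul Xu Yu wu; split=> //.
  by rewrite mulmxA -AE -mulmxA ww mulmx1.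
- move=> /(_ (det_wl _ An))[X [Y [Xu Yu AE]]].
  exists (w *m X), Y; rewrite unitmx_mul Xu Yu wu; split=> //.
  by rewrite -!mulmxA [X *m _]mulmxA -AE mulmxA ww mul1mx.
- move=> /(_ (det_wr _ (det_wl _ An)))[X [Y [Xu Yu AE]]].
  exists (w *m X), (Y *m w); rewrite !unitmx_mul Xu Yu wu; split=> //.
  have -> : A = w *m (w *m A *m w) *m w.
    by rewrite !mulmxA ww mul1mx -mulmxA ww mulmx1.
  by rewrite AE !mulmxA.
Qed.

Lemma valuation1_primitive (X : 'M[O]_2) : has_valuation 1 (\det X) -> primitive X.
Proof.
move=> [u uu detX]; have [//|/nprimitiveP[Y XE]] := boolP (primitive X).
suff : u \isn't a GRing.unit by rewrite uu.
apply/(dv_nunitP dv); exists (\det Y); apply: (mulfI (dv_prime_neq0 dv)).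
by rewrite mulrA -expr2 -detZ -XE detX expr1.
Qed.

Lemma valuation_ex x : x != 0 -> exists n, has_valuation n x.
Proof. by move=> /(dv_valuation dv)[n [u [uu ->]]]; exists n, u. Qed.

Lemma unitmx_valuation (X : 'M[O]_2) : has_valuation 0 (\det X) -> X \in unitmx.
Proof. by move=> [u uu]; rewrite expr0 mul1r unitmxE => ->. Qed.

Lemma mx_mulFI (B : 'M[K]_2) (X Y : 'M[O]_2) : B \in unitmx ->
  B *m X^F = B *m Y^F -> X = Y.
Proof. by move=> Bu /(can_inj (mulKmx Bu)) /map_mx_inj2. Qed.

Lemma map_mxZ2 (a : O) (X : 'M[O]_2) : (a *: X)^F = iota a *: X^F.
Proof. by apply/matrixP => i j; rewrite !mxE rmorphM. Qed.

Lemma iota_prime_neq0 : iota p != 0.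
Proof. by rewrite -(rmorph0 iota) (inj_eq (dv_inj dv)) (dv_prime_neq0 dv). Qed.

Lemma mxvertex_mull (A B B' : 'M[K]_2) : A \in unitmx -> B \in unitmx ->
  B' \in unitmx -> mxvertex B = mxvertex B' -> mxvertex (A *m B) = mxvertex (A *m B').
Proof. by move=> Au Bu Bu' E; rewrite -!(mxvertex_act Au) // E. Qed.

Lemma adjacent_mxP (B : 'M[K]_2) v : B \in unitmx ->
  Defs.adjacent q (mxvertex B) v <->
  exists2 X : 'M[O]_2, has_valuation 1 (\det X) & v = mxvertex (B *m X^F).
Proof.
move=> Bu; split=> [/andP[_ /asboolP[L [L' [BL ->]]]]|[X X1 ->]].
  have [C Cu LE] := lattice_mx L; have [C' Cu' LE'] := lattice_mx L'.
  rewrite LE LE' zspan_scale -[q%:R]/(q%:R) => -[qLL' L'qL] [L'L LL'].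
  have [X XE] : exists X : 'M[O]_2, C' = C *m X^F by apply/zspan_subP.
  have [Y YE] : exists Y : 'M[O]_2, q%:R *: C = C' *m Y^F by apply/zspan_subP.
  have XY : X *m Y = p%:M.
    apply: (mx_mulFI Cu); rewrite map_mxM mulmxA -XE -YE map_scalar_mx rmorph_nat.
    by rewrite mul_mx_scalar.
  have XY2 : has_valuation 2 (\det X * \det Y).
    by rewrite -det_mulmx XY det_scalar; apply: has_valuationX.
  have := has_valuation_neq0 XY2; rewrite mulf_eq0 negb_or => /andP[X0 Y0].
  have [m Xm] := valuation_ex X0; have [k Yk] := valuation_ex Y0.
  have mk := valuation_uniq XY2 (has_valuationM Xm Yk).
  have m1 : m = 1%N.
    case: m mk Xm => [|[//|[|//]]] mk Xm.
      case: LL'; apply/zspan_subP; exists (invmx X).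
      by rewrite XE -mulmxA -map_mxM mulmxV ?unitmx_valuation // map_mx1 mulmx1.
    have k0 : k = 0%N by case: mk.
    rewrite k0 in Yk; case: L'qL; apply/zspan_subP; exists (invmx Y).
    by rewrite YE -mulmxA -map_mxM mulmxV ?unitmx_valuation // map_mx1 mulmx1.
  move: (Xm); rewrite m1 => X1.
  have /mxvertex_eqP[//|//|c [Z [c0 Zu CE]]] : mxvertex B = mxvertex C.
    by rewrite BL (mxvertexE Cu LE).
  exists (Z *m X).
    by rewrite det_mulmx; apply: has_valuation_unitl; rewrite -?unitmxE.
  rewrite -(mxvertexE Cu' LE') XE CE -scalemxAl mxvertexZ //.
    by rewrite map_mxM mulmxA.
  by rewrite !unitmx_mul Bu map_unitmx // map_mx_unit // (has_valuation_neq0 Xm).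
have Xp := valuation1_primitive X1.
have XF : X^F \in unitmx by rewrite map_mx_unit // (has_valuation_neq0 X1).
have BXu : B *m X^F \in unitmx by rewrite unitmx_mul Bu.
apply/andP; split.
  apply/eqP => E.
  have := level_mx Xp X1; rewrite -[X^F](mulKmx Bu) -(@mxvertex_mull _ B) ?unitmx_inv //.
  rewrite mulVmx // -(map_mx1 iota) (@level_mx 0) //.
    by apply/existsP; exists 0; apply/existsP; exists 0; rewrite mxE unitr1.
  by rewrite det1; apply: has_valuation0; rewrite unitr1.
have latP (C : 'M[K]_2) : C \in unitmx -> `[< is_lattice iota (zspan iota C) >].
  by move=> Cu; apply/asboolP; exists C.
apply/asboolP; exists (Lattice (latP _ Bu)), (Lattice (latP _ BXu)).
case: (X1) => u uu detX.
split; [exact: mxvertexE|exact: mxvertexE| |]; rewrite /= ?zspan_scale.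
  split; apply/zspan_subP.
    exists (u^-1 *: \adj X); rewrite -mulmxA -map_mxM -scalemxAr mul_mx_adj.
    rewrite detX expr1 scale_scalar_mx mulrC mulrK //.
    by rewrite map_scalar_mx rmorph_nat mul_mx_scalar.
  move=> [Z]; rewrite -scalemxAl scalemxAr -(rmorph_nat iota) -map_mxZ2.
  by move=> /(mx_mulFI Bu) XE; case/nprimitiveP: Xp; exists Z.
split; apply/zspan_subP; first by exists X.
move=> [Z]; rewrite -mulmxA -map_mxM -[LHS]mulmx1 -(map_mx1 iota).
move=> /(mx_mulFI Bu) XZ; have [] := mulmx1_unit (esym XZ); rewrite unitmxE => Xu _.
by have := valuation_uniq X1 (has_valuation0 Xu).
Qed.

Definition nbr_mx : seq 'M[O]_2 :=
  mx2 p 0 0 1 :: [seq mx2 1 0 (c : nat)%:R p | c : 'I_q].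

Lemma size_nbr_mx : size nbr_mx = q.+1.
Proof. by rewrite /= size_image card_ord. Qed.

Lemma nbr_mxP N : N \in nbr_mx -> has_valuation 1 (\det N).
Proof.
rewrite inE => /orP[/eqP ->|/mapP[c _ ->]]; rewrite mx2_det mul0r subr0.
  by rewrite mulr1 -[p]expr1; apply: has_valuationX.
by rewrite mul1r -[p]expr1; apply: has_valuationX.
Qed.

Lemma nbr_mx_factor (X : 'M[O]_2) : has_valuation 1 (\det X) ->
  exists2 N, N \in nbr_mx & exists2 Z, Z \in unitmx & X = N *m Z.
Proof.
have h0 (Y : 'M[O]_2) : Y 0 0 \is a GRing.unit -> has_valuation 1 (\det Y) ->
    exists2 N, N \in nbr_mx & exists2 Z, Z \in unitmx & Y = N *m Z.
  rewrite (mx2_eta Y) !mxE /= mx2_det.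
  move: (Y 0 0) (Y 0 1) (Y 1 0) (Y 1 1) => a b c d au [u uu]; rewrite expr1 => detY.
  have [c0 [y cE]] := dv_residue dv (c / a).
  exists (mx2 1 0 (c0 : nat)%:R p); first by rewrite inE fintype.image_f ?orbT.
  exists (mx2 1 0 y (u / a) *m mx2 a b 0 1).
    rewrite unitmx_mul !unitmxE !mx2_det !mul1r !mul0r !mulr0 !subr0 mulr1 au.
    by rewrite andbT unitrM uu unitrV.
  rewrite mulmxA !mx2_mul; congr mx2; rewrite ?(mul1r, mul0r, mulr0, addr0, add0r, mulr1) //.
    by rewrite -cE divrK.
  rewrite -cE (_ : _ + _ = (b * c + p * u) / a); last by ring.
  by rewrite -detY addrC subrK [a * d]mulrC mulrK.
move=> X1; have [a0|a0] := boolP (X 0 0 \is a GRing.unit); first exact: h0.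
pose w : 'M[O]_2 := mx2 0 1 1 0.
have ww : w *m w = 1%:M by rewrite mx2_mul mx2_scalar; congr mx2; ring.
have wu : w \in unitmx by rewrite unitmxE mx2_det mul0r sub0r mulr1 unitrN unitr1.
have [b0|b0] := boolP (X 0 1 \is a GRing.unit).
  have [||N Nn [Z Zu XE]] := h0 (X *m w).
  - by rewrite [X]mx2_eta mx2_mul !mxE /= mulr0 mulr1 add0r.
  - by rewrite det_mulmx mulrC; apply: has_valuation_unitl; rewrite -?unitmxE.
  exists N => //; exists (Z *m w); first by rewrite unitmx_mul Zu.
  by rewrite mulmxA -XE -mulmxA ww mulmx1.
move: X1 a0 b0; rewrite (mx2_eta X) !mxE /= mx2_det.
move: (X 0 0) (X 0 1) (X 1 0) (X 1 1) => a b c d [u uu]; rewrite expr1 => detX.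
move=> /(dv_nunitP dv)[a' aE] /(dv_nunitP dv)[b' bE].
exists (mx2 p 0 0 1); first by rewrite inE eqxx.
exists (mx2 a' b' c d).
  rewrite unitmxE mx2_det; suff -> : a' * d - b' * c = u by [].
  by apply: (mulfI (dv_prime_neq0 dv)); rewrite -detX aE bE; ring.
by rewrite mx2_mul; congr mx2; rewrite ?(mul1r, mul0r, mulr0, addr0, add0r, mulr1).
Qed.

Lemma mxvertex_nbrP (B : 'M[K]_2) v : B \in unitmx ->
  v \in [seq mxvertex (B *m N^F) | N <- nbr_mx] <-> Defs.adjacent q (mxvertex B) v.
Proof.
move=> Bu; rewrite (adjacent_mxP _ Bu); split=> [/mapP[N Nn ->]|[X X1 ->]].
  by exists N => //; apply: nbr_mxP.
have [N Nn [Z Zu ->]] := nbr_mx_factor X1; apply/mapP; exists N => //.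
rewrite map_mxM mulmxA mxvertex_mulr // unitmx_mul Bu map_mx_unit //.
exact: has_valuation_neq0 (nbr_mxP Nn).
Qed.

Lemma mxvertex_nbr_uniq (B : 'M[K]_2) : B \in unitmx ->
  uniq [seq mxvertex (B *m N^F) | N <- nbr_mx].
Proof.
move=> Bu.
have level0 c : c != 0 -> level (mxvertex (c%:M)^F) = 0%N.
  move=> c0; rewrite -scalemx1 map_mxZ2 mxvertexZ ?map_mx1 ?unitmx1 //; last first.
    by rewrite -(rmorph0 iota) (inj_eq (dv_inj dv)).
  rewrite -(map_mx1 iota); apply: level_mx.
    by apply/existsP; exists 0; apply/existsP; exists 0; rewrite mxE unitr1.
  by rewrite det1; apply: has_valuation0; rewrite unitr1.
have distinct (M N N' : 'M[O]_2) : N \in nbr_mx -> N' \in nbr_mx ->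
    M *m N = p%:M -> primitive (M *m N') -> has_valuation 1 (\det M) ->
    mxvertex (B *m N^F) != mxvertex (B *m N'^F).
  move=> Nn Nn' MN MN' M1; apply/eqP => E.
  have det0 (Y : 'M[O]_2) : has_valuation 1 (\det Y) -> Y^F \in unitmx.
    by move=> /has_valuation_neq0 ?; rewrite map_mx_unit.
  have Nu := det0 _ (nbr_mxP Nn); have Nu' := det0 _ (nbr_mxP Nn').
  have : mxvertex (M *m N)^F = mxvertex (M *m N')^F.
    rewrite !map_mxM; apply: (mxvertex_mull (det0 _ M1) Nu Nu').
    rewrite -[N^F](mulKmx Bu) -[N'^F](mulKmx Bu).
    by apply: mxvertex_mull; rewrite ?unitmx_inv // unitmx_mul Bu ?Nu ?Nu'.
  move=> /(congr1 level); rewrite MN level0 ?(dv_prime_neq0 dv) //.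
  rewrite (@level_mx 2) // det_mulmx -[2%N]/(1 + 1)%N.
  by apply: has_valuationM => //; apply: nbr_mxP.
have p1 : has_valuation 1 p by rewrite -[X in has_valuation _ X]expr1; apply: has_valuationX.
have nbr_c (c : 'I_q) : mx2 1 0 (c : nat)%:R p \in nbr_mx by rewrite inE fintype.image_f ?orbT.
rewrite /= -map_comp; apply/andP; split.
  apply/mapP => -[c _ /eqP]; apply/negP/(distinct (mx2 1 0 0 p)) => //=.
  - by rewrite inE eqxx.
  - by rewrite mx2_mul mx2_scalar; congr mx2; ring.
  - rewrite mx2_mul; apply/existsP; exists 0; apply/existsP; exists 0.
    by rewrite mxE /= mul0r mulr1 addr0 unitr1.
  - by rewrite mx2_det mul0r mul1r subr0.
rewrite map_inj_in_uniq ?enum_uniq // => c c' _ _ /= E; apply/val_inj => /=.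
wlog cc' : c c' E / (c < c')%N.
  move=> h; case: (ltngtP c c') => // cc'; first exact: h cc'.
  by apply/esym; apply: h cc'; rewrite E.
move/eqP: E; apply: contraTeq => _; apply: (distinct (mx2 p 0 (- c%:R) 1)) => //.
- by rewrite mx2_mul mx2_scalar; congr mx2; ring.
- rewrite mx2_mul; apply/existsP; exists 1; apply/existsP; exists 0.
  rewrite mxE /= mulr1 mul1r addrC -natrB 1?ltnW //; apply: (dv_natr_unit dv).
  by rewrite subn_gt0 cc' (leq_ltn_trans (leq_subr _ _)).
- by rewrite mx2_det mul0r subr0 mulr1.
Qed.

Fact nbrs_key : unit. Proof. by []. Qed.
Definition nbrs v : seq vertex := locked_with nbrs_key
  [seq mxvertex (s2val (cid2 (mxvertex_surj v)) *m N^F) | N <- nbr_mx].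

Lemma nbrsP v w : w \in nbrs v <-> Defs.adjacent q v w.
Proof.
by rewrite /nbrs unlock; case: cid2 => B /= Bu ->; apply: mxvertex_nbrP.
Qed.

Lemma nbrs_uniq v : uniq (nbrs v).
Proof. by rewrite /nbrs unlock; case: cid2 => B /= Bu _; apply: mxvertex_nbr_uniq. Qed.

Lemma size_nbrs v : size (nbrs v) = q.+1.
Proof. by rewrite /nbrs unlock size_map size_nbr_mx. Qed.

Lemma level_smith v : exists2 X : 'M[O]_2, X \in unitmx &
  v = mxvertex ((X *m mx2 1 0 0 (p ^+ level v))^F).
Proof.
have [A [Ap An vE]] := levelP v; have [X [Y [Xu Yu AE]]] := smith Ap An.
exists X => //; rewrite {1}vE AE [in LHS]map_mxM mxvertex_mulr //.
rewrite map_mxM unitmx_mul map_unitmx // map_mx_unit // mx2_det mul0r subr0 mul1r.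
by rewrite expf_neq0 // (dv_prime_neq0 dv).
Qed.

Lemma level_nbrs v : exists w s, [/\ perm_eq (nbrs v) (w :: s), size s = q,
  level w = (if level v == 0 then 1 else (level v).-1)%N &
  all (fun x => level x == (level v).+1) s].
Proof.
have [X Xu] := level_smith v; move: (level v) => n vE.
have p0 k : p ^+ k != 0 by rewrite expf_neq0 // (dv_prime_neq0 dv).
have prim1 a b c : primitive (mx2 1 a b c).
  by apply/existsP; exists 0; apply/existsP; exists 0; rewrite mxE unitr1.
have XDu : (X *m mx2 1 0 0 (p ^+ n))^F \in unitmx.
  by rewrite map_mxM unitmx_mul map_unitmx // map_mx_unit // mx2_det mul0r subr0 mul1r.
have level_X Y k : primitive Y -> has_valuation k (\det Y) ->
    level (mxvertex (X *m Y)^F) = k.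
  move=> Yp Yk; apply: level_mx.
    by rewrite -[X *m Y]mulmx1 primitive_mul ?unitmx1.
  by rewrite det_mulmx; apply: has_valuation_unitl; rewrite -?unitmxE.
have : perm_eq (nbrs v)
    [seq mxvertex ((X *m mx2 1 0 0 (p ^+ n))^F *m N^F) | N <- nbr_mx].
  apply: uniq_perm; [exact: nbrs_uniq|exact: mxvertex_nbr_uniq|move=> w].
  by apply/idP/idP; rewrite nbrsP mxvertex_nbrP // vE.
rewrite /= => /perm_trans -/(_ _ (perm_refl _)) nbrsE.
eexists; eexists; split; [exact: nbrsE| | |].
- by rewrite size_map size_image card_ord.
- rewrite -map_mxM -mulmxA mx2_mul !(mul1r, mul0r, mulr0, addr0, add0r, mulr1).
  case: n {vE XDu nbrsE} => [|n] /=.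
    apply: level_X; last by rewrite mx2_det mul0r subr0 expr0 mulr1; apply: (has_valuationX 1).
    by apply/existsP; exists 1; apply/existsP; exists 1; rewrite mxE /= expr0 unitr1.
  have -> : mx2 p 0 0 (p ^+ n.+1) = p *: mx2 1 0 0 (p ^+ n).
    by rewrite mx2_scale exprS mulr1 mulr0.
  rewrite -scalemxAr map_mxZ2 mxvertexZ ?iota_prime_neq0 //.
    by apply: level_X; rewrite // mx2_det mul0r subr0 mul1r; apply: has_valuationX.
  by rewrite map_mxM unitmx_mul map_unitmx // map_mx_unit // mx2_det mul0r subr0 mul1r.
- apply/allP => w /mapP[N /mapP[c _ ->] ->]; apply/eqP.
  rewrite -map_mxM -mulmxA mx2_mul !(mul1r, mul0r, mulr0, addr0, add0r, mulr1).
  by apply: level_X; rewrite // mx2_det mul0r subr0 mul1r -exprSr; apply: has_valuationX.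
Qed.

Lemma level_eq0 v : level v = 0%N -> v = o.
Proof.
have [X Xu vE] := level_smith v => v0; rewrite v0 expr0 -mx2_scalar mulmx1 in vE.
by rewrite vE -[X^F]mul1mx mxvertex_mulr ?unitmx1 // mxvertex1.
Qed.

Lemma level0 : level o = 0%N.
Proof.
rewrite -mxvertex1 -(map_mx1 iota); apply: level_mx.
  by apply/existsP; exists 0; apply/existsP; exists 0; rewrite mxE unitr1.
by rewrite det1; apply: has_valuation0; rewrite unitr1.
Qed.

End BruhatTitsTree.

Lemma flatten_map_uniq (T1 T2 : eqType) (f : T1 -> seq T2) (s : seq T1) :
  uniq s -> (forall x, x \in s -> uniq (f x)) ->
  (forall x y z, x \in s -> y \in s -> z \in f x -> z \in f y -> x = y) ->
  uniq (flatten (map f s)).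
Proof.
elim: s => //= x s IHs /andP[xs s_uniq] f_uniq f_disj.
rewrite cat_uniq f_uniq ?mem_head //= IHs //; last 2 first.
- by move=> y ys; apply: f_uniq; rewrite inE ys orbT.
- by move=> y y' z ys y's; apply: f_disj; rewrite inE ?ys ?y's orbT.
rewrite andbT; apply/hasPn => z /flatten_mapP[y ys zy].
apply: contra xs => /= zx; suff -> : x = y by [].
by apply: f_disj zx zy; rewrite inE ?eqxx ?ys ?orbT.
Qed.

Section TreeMetric.
Variables (O : idomainType) (K : fieldType) (iota : {rmorphism O -> K}) (q : nat).
Hypothesis dv : discrete_valuation iota q.
Local Notation vertex := (vertex iota).
Local Notation o := (base_vertex iota).
Local Notation d := (@tree_dist O K iota q).
Local Notation nbrs := (@nbrs O K iota q).
Implicit Types (u v w x : vertex) (g : pgl2 K).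

Lemma adjacent_sym v w : Defs.adjacent q v w -> Defs.adjacent q w v.
Proof.
have [B Bu ->] := mxvertex_surj v.
move=> /(adjacent_mxP dv _ Bu)[X X1 ->]; case: (X1) => u uu detX.
have X0 : \det X != 0 := has_valuation_neq0 dv X1.
have BXu : B *m map_mx iota X \in unitmx by rewrite unitmx_mul Bu (map_mx_unit dv).
pose Y := u^-1 *: \adj X.
have XY : X *m Y = q%:R%:M.
  by rewrite -scalemxAr mul_mx_adj detX expr1 scale_scalar_mx mulrC mulrK.
apply/(adjacent_mxP dv _ BXu); exists Y.
  exists u^-1; first by rewrite unitrV.
  apply: (mulfI X0); rewrite -det_mulmx XY det_scalar detX expr1 expr2.
  by rewrite -!mulrA [u * _]mulrCA mulrV // mulr1.
rewrite -mulmxA -map_mxM XY map_scalar_mx mul_mx_scalar (mxvertexZ dv) //.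
exact: iota_prime_neq0.
Qed.

Lemma nbrs_sym v w : (w \in nbrs v) = (v \in nbrs w).
Proof.
by apply/idP/idP => /(nbrsP dv)/adjacent_sym/(nbrsP dv).
Qed.

Lemma level_adjacent v w : w \in nbrs v ->
  level dv w = (level dv v).+1 \/ (level dv w).+1 = level dv v.
Proof.
have [x [s [E _ xE /allP sE]]] := level_nbrs dv v.
rewrite (perm_mem E) inE => /orP[/eqP ->|/sE/eqP ->]; last by left.
by rewrite xE; case: (level dv v) => [|n]; [left|right].
Qed.

Lemma level_path v s : path (Defs.adjacent q) v s ->
  (level dv (last v s) <= level dv v + size s)%N.
Proof.
elim: s v => [|w s IHs] v /=; first by rewrite addn0.
move=> /andP[/(nbrsP dv)/level_adjacent vw /IHs]; move/leq_trans; apply.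
by case: vw; lia.
Qed.

Lemma joined_level v : joined_by q o v (level dv v).
Proof.
move nE : (level dv v) => n; elim: n v nE => [|n IHn] v nE.
  by apply/asboolP; exists [::]; split=> //=; rewrite (level_eq0 nE).
have [w [s [E _ wE _]]] := level_nbrs dv v; rewrite nE /= in wE.
have /asboolP[t [ot tw tn]] := IHn w wE.
apply/asboolP; exists (rcons t v); rewrite last_rcons size_rcons tn; split=> //.
rewrite rcons_path ot tw; apply: adjacent_sym; apply/(nbrsP dv).
by rewrite (perm_mem E) mem_head.
Qed.

Lemma tree_dist_level v : d o v = level dv v.
Proof.
rewrite /tree_dist; case: pselect => [ov|[]]; last first.
  by exists (level dv v); apply: joined_level.
case: ex_minnP => n /asboolP[s [os sv sn]] /(_ _ (joined_level v)) nv.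
apply/eqP; rewrite eqn_leq nv /=.
by have := level_path os; rewrite sv sn level0.
Qed.

Lemma vertex_transitive v : exists g, vertex_act g o = v.
Proof.
by have [B Bu ->] := mxvertex_surj v; eexists; reflexivity.
Qed.

Lemma vertex_actKV g : cancel (vertex_act g^-1%g) (@vertex_act O K iota g).
Proof. by move=> v; rewrite -vertex_actM mulgV vertex_act1. Qed.

Lemma adjacent_actE g v w :
  Defs.adjacent q (vertex_act g v) (vertex_act g w) = Defs.adjacent q v w.
Proof.
apply/idP/idP => [|]; last exact: adjacent_act.
by move=> /(@adjacent_act _ _ _ _ g^-1%g); rewrite !vertex_actK.
Qed.

Lemma nbrs_act g v : perm_eq (nbrs (vertex_act g v)) (map (vertex_act g) (nbrs v)).
Proof.
apply: uniq_perm; first exact: nbrs_uniq.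
  by rewrite map_inj_uniq ?nbrs_uniq //; apply: can_inj (vertex_actK g).
move=> w; rewrite -[w](vertex_actKV g) mem_map; last exact: can_inj (vertex_actK g).
by apply/idP/idP => /(nbrsP dv) vw; apply/(nbrsP dv); move: vw; rewrite adjacent_actE.
Qed.

Lemma mem_nbrs_act g v w : (vertex_act g w \in nbrs (vertex_act g v)) = (w \in nbrs v).
Proof.
by rewrite (perm_mem (nbrs_act g v)) mem_map //; apply: can_inj (vertex_actK g).
Qed.

Lemma dist_nbrs u v : exists w s, [/\ perm_eq (nbrs v) (w :: s), size s = q,
  d u w = (if d u v == 0 then 1 else (d u v).-1)%N &
  forall x, x \in s -> d u x = (d u v).+1].
Proof.
have [g gu] := vertex_transitive u.
have dE x : d u x = level dv (vertex_act g^-1%g x).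
  by rewrite -tree_dist_level -[in RHS](vertex_actK g o) gu tree_dist_act.
have [w [s [E sq wE /allP sE]]] := level_nbrs dv (vertex_act g^-1%g v).
exists (vertex_act g w), (map (vertex_act g) s); rewrite size_map; split=> //.
- rewrite -map_cons; apply: perm_trans (perm_map _ E).
  by rewrite -{1}[v](vertex_actKV g) nbrs_act.
- by rewrite !dE vertex_actK.
- by move=> x /mapP[y /sE/eqP yE ->]; rewrite !dE vertex_actK.
Qed.

Lemma dist_eq0 u v : (d u v == 0%N) = (u == v).
Proof.
have [g gu] := vertex_transitive u.
rewrite -[d u v](@tree_dist_act _ _ _ _ g^-1%g) -gu vertex_actK tree_dist_level.
apply/eqP/eqP => [/level_eq0 E|<-]; first by rewrite -E vertex_actKV.
by rewrite vertex_actK level0.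
Qed.

Lemma distxx u : d u u = 0%N.
Proof. by apply/eqP; rewrite dist_eq0. Qed.

Lemma dist_adjacent u v w : w \in nbrs v ->
  d u w = (d u v).+1 \/ (d u w).+1 = d u v.
Proof.
have [x [s [E _ xE sE]]] := dist_nbrs u v.
rewrite (perm_mem E) inE => /orP[/eqP ->|/sE ->]; last by left.
by rewrite xE; case: (d u v) => [|n]; [left|right].
Qed.

Lemma dist_nbr v w : w \in nbrs v -> d v w = 1%N.
Proof. by move=> /(dist_adjacent v); rewrite distxx => -[]. Qed.

(* The neighbour of [v] on the geodesic to [u], or [v] itself if [v = u]. *)
Definition parent u v := xget v [set w | w \in nbrs v /\ (d u w).+1 = d u v].

Lemma closer_unique u v w x : w \in nbrs v -> (d u w).+1 = d u v ->
  x \in nbrs v -> (d u x).+1 = d u v -> w = x.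
Proof.
have [y [s [E _ _ sE]]] := dist_nbrs u v.
have closer z : z \in nbrs v -> (d u z).+1 = d u v -> z = y.
  by rewrite (perm_mem E) inE => /orP[/eqP //|/sE ->] /eqP; lia.
by move=> wv dw xv dx; rewrite (closer w) // (closer x).
Qed.

Lemma parent_closer u v : u != v ->
  parent u v \in nbrs v /\ (d u (parent u v)).+1 = d u v.
Proof.
move=> uv; rewrite /parent; case: xgetP => [//|no_closer].
have [y [s [E _ yE _]]] := dist_nbrs u v.
case: (no_closer y); split; first by rewrite (perm_mem E) mem_head.
by move: uv yE; rewrite -dist_eq0; case: (d u v) => //= n _ ->.
Qed.

Lemma parentE u v w : w \in nbrs v -> (d u w).+1 = d u v -> parent u v = w.
Proof.
move=> wv dw; have uv : u != v by rewrite -dist_eq0 -dw.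
by have [pv dp] := parent_closer uv; apply: closer_unique dw.
Qed.

Lemma joined_dist u v : joined_by q u v (d u v).
Proof.
have [g <-] := vertex_transitive u; rewrite -{1 2}[v](vertex_actKV g).
rewrite joined_by_act tree_dist_act tree_dist_level; exact: joined_level.
Qed.

Lemma dist_path u v s : path (Defs.adjacent q) v s -> (d u (last v s) <= d u v + size s)%N.
Proof.
elim: s v => [|w s IHs] v /=; first by rewrite addn0.
move=> /andP[/(nbrsP dv)/(dist_adjacent u) vw /IHs]; move/leq_trans; apply.
by case: vw; lia.
Qed.

Lemma dist_triangle v u w : (d u w <= d u v + d v w)%N.
Proof.
by have /asboolP[s [vs <- <-]] := joined_dist v w; apply: dist_path.
Qed.

Lemma dist_sym u v : d u v = d v u.
Proof.
suff h a b : (d a b <= d b a)%N by apply/eqP; rewrite eqn_leq !h.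
have /asboolP[s [bs sa <-]] := joined_dist b a.
have : path (Defs.adjacent q) (last b s) (rev (belast b s)).
  rewrite rev_path; apply: sub_path bs => x y; exact: adjacent_sym.
move=> /(dist_path a); rewrite sa distxx size_rev size_belast add0n.
suff -> : last a (rev (belast b s)) = b by [].
by case: s sa {bs} => [//|x s] _ /=; rewrite rev_cons last_rcons.
Qed.

Lemma transitive_pairs u v u' v' : d u v = d u' v' ->
  exists g, vertex_act g u = u' /\ vertex_act g v = v'.
Proof.
have base w : exists g, vertex_act g o = o /\
    vertex_act g (mxvertex iota (map_mx iota (mx2 1 0 0 (q%:R ^+ level dv w)))) = w.
  have [X Xu wE] := level_smith dv w.
  have XFu := map_unitmx iota Xu.
  exists (\pi_(pgl2 K) (GL2 XFu)); split.
    by rewrite -mxvertex1 mxvertex_act ?unitmx1 // mulmx1 -[map_mx _ _]mul1mx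
      (mxvertex_mulr dv) ?unitmx1.
  rewrite mxvertex_act; first by rewrite -map_mxM -wE.
  rewrite (map_mx_unit dv) // mx2_det mul0r subr0 mul1r.
  by rewrite expf_neq0 // (dv_prime_neq0 dv).
have [g gu] := vertex_transitive u; have [g' gu'] := vertex_transitive u'.
rewrite -{1}[v](vertex_actKV g) -{1}[v'](vertex_actKV g') -{1}gu -{1}gu'.
rewrite !tree_dist_act !tree_dist_level => E.
have [h [ho hv]] := base (vertex_act g^-1%g v).
have [h' [ho' hv']] := base (vertex_act g'^-1%g v').
exists (g' * h' * h^-1 * g^-1)%g; rewrite !vertex_actM.
split; first by rewrite -gu vertex_actK -{1}ho vertex_actK ho' gu'.
by rewrite -hv vertex_actK E hv' vertex_actKV.
Qed.

Lemma parent_act g u v : parent (vertex_act g u) (vertex_act g v) = vertex_act g (parent u v).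
Proof.
have [->|uv] := eqVneq u v; last first.
  have [pv dp] := parent_closer uv.
  by apply: parentE; rewrite ?mem_nbrs_act // !tree_dist_act.
have none x : parent x x = x.
  by rewrite /parent; case: xgetP => // w _ [_]; rewrite distxx.
by rewrite !none.
Qed.

Definition on_geodesic u v x := (d u v + d v x == d u x)%N.

Lemma on_geodesic_edge u v w x : w \in nbrs v -> d u v = (d u w).+1 ->
  d x w = (d x v).+1 -> on_geodesic u v x.
Proof.
move nE : (d v x) => n; elim: n v w nE => [|n IHn] v w nE wv uvw xwv.
  by move/eqP: nE; rewrite dist_eq0 => /eqP ->; rewrite /on_geodesic distxx addn0.
have xv : x != v by rewrite -dist_eq0 dist_sym nE.
have [pv dp] := parent_closer xv.
set y := parent x v in pv dp.
have yw : y != w by apply/eqP => yw; move: dp; rewrite yw xwv; lia.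
have uy : d u y = (d u v).+1.
  have [//|uy] := dist_adjacent u pv; case/eqP: yw.
  by apply: closer_unique pv uy wv (esym uvw).
have : on_geodesic u y x.
  have vy : v \in nbrs y by rewrite nbrs_sym.
  apply: (IHn y v) vy uy _; last by rewrite dp.
  by apply/eqP; rewrite -eqSS dist_sym dp dist_sym nE.
by rewrite /on_geodesic uy [d y x]dist_sym [d v x]dist_sym -dp addnS addSn.
Qed.

Lemma off_geodesic u v x : u != v -> ~~ on_geodesic u v x ->
  d v x = (d (parent u v) x).+1.
Proof.
move=> uv off; have [pv dp] := parent_closer uv.
rewrite ![d _ x]dist_sym; have [xp|-> //] := dist_adjacent x pv.
by have := on_geodesic_edge pv (esym dp) xp; rewrite (negbTE off).
Qed.

Lemma on_geodesic_parent u v x : u != x -> on_geodesic u v x -> v != x ->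
  on_geodesic u v (parent u x).
Proof.
move=> ux vx v_neq_x; have [px dp] := parent_closer ux.
have [h|h] := dist_adjacent v px; last first.
  by move: vx; rewrite /on_geodesic -h -dp addnS eqSS.
have := on_geodesic_edge px (esym dp) h.
rewrite /on_geodesic dist_sym in vx *.
have v0 : (d v x != 0)%N by rewrite dist_eq0.
by rewrite [d x v]dist_sym; move: vx v0; rewrite [d v u]dist_sym; lia.
Qed.

Lemma geodesic_unique u v v' x : on_geodesic u v x -> on_geodesic u v' x ->
  d u v = d u v' -> v = v'.
Proof.
move nE : (d u x) => n; elim: n x nE => [|n IHn] x nE vx v'x vv'.
  have d0 w : on_geodesic u w x -> w = u.
    by rewrite /on_geodesic nE addn_eq0 dist_eq0 => /andP[/eqP].
  by rewrite (d0 v) // (d0 v').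
have ux : u != x by rewrite -dist_eq0 nE.
have [_ dp] := parent_closer ux.
have far w : on_geodesic u w x -> (w == x) = (d u w == n.+1).
  move=> wx; rewrite -dist_eq0 -nE; move: wx; rewrite /on_geodesic => /eqP <-.
  by rewrite -[X in _ = (X == _)]addn0 eqn_add2l eq_sym.
have [/eqP vxE|v_neq_x] := boolP (v == x).
  by apply/eqP; rewrite vxE eq_sym (far _ v'x) -vv' -(far _ vx) vxE.
have v'_neq_x : v' != x by rewrite (far _ v'x) -vv' -(far _ vx).
apply: (IHn (parent u x)) => //; last 2 first.
- exact: on_geodesic_parent.
- exact: on_geodesic_parent.
by move: dp; rewrite nE => -[].
Qed.

Fixpoint sphere u n : seq vertex :=
  if n is m.+1 then flatten [seq [seq w <- nbrs v | d u w == m.+1] | v <- sphere u m]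
  else [:: u].

Lemma sphereS u n : sphere u n.+1 =
  flatten [seq [seq w <- nbrs v | d u w == n.+1] | v <- sphere u n].
Proof. by []. Qed.

Lemma mem_sphere u n v : (v \in sphere u n) = (d u v == n).
Proof.
elim: n v => [|n IHn] v /=; first by rewrite inE dist_eq0 eq_sym.
apply/flatten_mapP/eqP => [[w wn]|uv]; first by rewrite mem_filter => /andP[/eqP].
have u_neq_v : u != v by rewrite -dist_eq0 uv.
have [pv dp] := parent_closer u_neq_v; exists (parent u v).
  by rewrite IHn -eqSS dp uv.
by rewrite mem_filter uv eqxx nbrs_sym.
Qed.

Lemma sphere_uniq u n : uniq (sphere u n).
Proof.
elim: n => [//|n IHn] /=; apply: flatten_map_uniq => //.
  by move=> v _; rewrite filter_uniq ?nbrs_uniq.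
move=> v v' w; rewrite !mem_sphere !mem_filter => /eqP uv /eqP uv' /andP[/eqP uw vw].
move=> /andP[_ v'w]; apply: (@closer_unique u w); rewrite 1?nbrs_sym ?uv ?uv' ?uw //.
Qed.

Lemma size_sphere u n : size (sphere u n) = (if n is m.+1 then q.+1 * q ^ m else 1)%N.
Proof.
have child v : size [seq w <- nbrs v | d u w == (d u v).+1] = (if d u v == 0 then q.+1 else q)%N.
  have [w [s [E sq wE sE]]] := dist_nbrs u v.
  have := perm_size (perm_filter (fun w => d u w == (d u v).+1) E) => -> /=.
  rewrite (eq_in_filter (a2 := predT)) ?filter_predT; last first.
    by move=> x /sE ->; rewrite /= eqxx.
  rewrite wE; case: (d u v) => [|k]; first by rewrite /= sq.
  by rewrite /= -[k == _]/(k == k.+2) ltn_eqF ?sq //; lia.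
have sizeS n' : size (sphere u n'.+1) =
    ((if n' == 0 then q.+1 else q) * size (sphere u n'))%N.
  rewrite /= size_flatten /shape -map_comp sumnE big_map mulnC.
  rewrite -sum1_size big_distrl /=; apply: eq_big_seq => v.
  by rewrite mem_sphere /= => /eqP vn; rewrite mul1n -{1}vn child vn.
elim: n => [//|n IHn]; rewrite sizeS IHn; case: n {IHn} => [|n]; first by rewrite muln1.
by rewrite expnS mulnCA.
Qed.

End TreeMetric.

Arguments sphere : simpl never.

Section TreeBoundary.
Variables (O : idomainType) (K : fieldType) (iota : {rmorphism O -> K}) (q : nat).
Hypothesis dv : discrete_valuation iota q.
Local Notation vertex := (vertex iota).
Local Notation o := (base_vertex iota).
Local Notation d := (@tree_dist O K iota q).
Local Notation nbrs := (@nbrs O K iota q).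
Local Notation parent := (@parent O K iota q).
Local Notation ray := (ray iota q).
Local Notation boundary := (boundary iota q).
Implicit Types (u v w x : vertex) (g : pgl2 K) (r s : ray) (e : boundary).

Lemma dist_eq1 v w : d v w = 1%N -> w \in nbrs v.
Proof.
move=> vw; have v_neq_w : v != w by rewrite -(dist_eq0 dv) vw.
have [pw] := parent_closer dv v_neq_w; rewrite vw => -[/eqP].
by rewrite (dist_eq0 dv) => /eqP ->; rewrite (nbrs_sym dv).
Qed.

Lemma dist_ray r m n : (m <= n)%N -> d (r m) (r n) = (n - m)%N.
Proof. by have /asboolP := rayP r; apply. Qed.

Lemma ray_nbr r k : r k.+1 \in nbrs (r k).
Proof. by apply: dist_eq1; rewrite dist_ray // subSnn. Qed.

Lemma nonbacktracking_step u x y z : y \in nbrs x -> z \in nbrs y -> z != x ->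
  d u y = (d u x).+1 -> d u z = (d u y).+1.
Proof.
move=> yx zy zx uy; have [//|uz] := dist_adjacent dv u zy.
case/eqP: zx; apply: (closer_unique dv zy uz) => //; by rewrite (nbrs_sym dv).
Qed.

Lemma ray_step u r k : d u (r k.+1) = (d u (r k)).+1 ->
  d u (r k.+2) = (d u (r k.+1)).+1.
Proof.
apply: nonbacktracking_step; rewrite ?ray_nbr //.
by rewrite eq_sym -(dist_eq0 dv) dist_ray ?leqW // subSn // subSnn.
Qed.

Lemma ray_steps u r n k : d u (r n.+1) = (d u (r n)).+1 ->
  d u (r (n + k)%N) = (d u (r n) + k)%N.
Proof.
move=> un; have step j : d u (r (n + j).+1) = (d u (r (n + j)%N)).+1.
  by elim: j => [|j IHj]; rewrite ?addn0 // addnS; apply: ray_step.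
by elim: k => [|k IHk]; rewrite ?addn0 // !addnS step IHk.
Qed.

Lemma ray_away u r : exists n, d u (r n.+1) = (d u (r n)).+1.
Proof.
apply: contrapT => /forallNP near_u.
have closer k : (d u (r k) + k = d u (r 0%N))%N.
  elim: k => [|k <-]; first by rewrite addn0.
  have [/near_u //|<-] := dist_adjacent dv u (ray_nbr r k).
  by rewrite addnS addSn.
by have := closer (d u (r 0%N)).+1; lia.
Qed.

Definition is_ray (f : nat -> vertex) :=
  (forall k, f k.+1 \in nbrs (f k)) /\ (forall k, f k.+2 != f k).

Lemma is_rayP (f : nat -> vertex) : is_ray f -> exists r, f =1 r.
Proof.
move=> [f_nbr f_nb].
have step m k : d (f m) (f (m + k)%N) = k /\
    d (f m) (f (m + k).+1) = k.+1.
  elim: k => [|k [IHk IHk']]; rewrite ?addnS ?addn0.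
    by rewrite (distxx dv) (dist_nbr dv).
  split=> //; rewrite (@nonbacktracking_step _ (f (m + k)%N) (f (m + k).+1)) ?IHk' //.
  by rewrite IHk.
suff fP : `[< forall m n, (m <= n)%N -> d (f m) (f n) = (n - m)%N >].
  by exists (Ray fP).
by apply/asboolP => m n /subnKC {1}<-; have [] := step m (n - m)%N.
Qed.

Lemma level_is_ray u (f : nat -> vertex) : (forall k, f k.+1 \in nbrs (f k)) ->
  (forall k, d u (f k) = k) -> is_ray f.
Proof.
move=> f_nbr fk; split=> // k; apply/eqP => /(congr1 (d u)); rewrite !fk; lia.
Qed.

Lemma ray_parent u r n k : d u (r n.+1) = (d u (r n)).+1 ->
  parent u (r (n + k).+1) = r (n + k)%N.
Proof.
move=> un; apply: (parentE dv); first by rewrite (nbrs_sym dv) ray_nbr.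
by rewrite -addnS !ray_steps // addnS.
Qed.

Lemma ray_from u r : exists s : ray, s 0%N = u /\ \pi_boundary s = \pi_boundary r.
Proof.
have [n un] := ray_away u r; set D := d u (r n).
pose f k := iter D (parent u) (r (n + k)%N).
have level k j : (j <= D + k)%N -> d u (iter j (parent u) (r (n + k)%N)) = (D + k - j)%N.
  elim: j => [_|j IHj jD]; first by rewrite /= ray_steps // subn0.
  have IHj' := IHj (ltnW jD); rewrite iterS.
  have u_neq : u != iter j (parent u) (r (n + k)%N).
    by rewrite -(dist_eq0 dv) IHj' subn_eq0 -ltnNge.
  by have [_] := parent_closer dv u_neq; rewrite IHj'; lia.
have fk k : d u (f k) = k by rewrite level ?leq_addr // addKn.
have f_parent k : f k = parent u (f k.+1).
  by rewrite /f -iterS iterSr addnS ray_parent.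
have f_nbr k : f k.+1 \in nbrs (f k).
  have u_neq : u != f k.+1 by rewrite -(dist_eq0 dv) fk.
  by have [] := parent_closer dv u_neq; rewrite -f_parent (nbrs_sym dv).
have [s fs] := is_rayP (level_is_ray f_nbr fk).
exists s; split; first by apply/esym/eqP; rewrite -(dist_eq0 dv) -fs fk.
apply/eqP; rewrite eqmodE; apply/asboolP; exists D, n => k; rewrite -fs /f.
elim: D k {fk level f_parent f_nbr fs f} => [//|D IHD] k.
by rewrite iterSr addSn addnS ray_parent // IHD.
Qed.

(* The Busemann function of the end [e], normalized to vanish at [o]. *)
Definition horofunction e v : int := xget 0 [set c : int |
  exists n, forall k, (n <= k)%N ->
    (d o (repr e k))%:Z - (d v (repr e k))%:Z = c].

Lemma horofunctionP v r : exists n, forall k, (n <= k)%N ->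
  (d o (r k))%:Z - (d v (r k))%:Z = horofunction (\pi_boundary r) v.
Proof.
have limit s : exists c : int, exists n, forall k, (n <= k)%N ->
    (d o (s k))%:Z - (d v (s k))%:Z = c.
  have [m om] := ray_away o s; have [n vn] := ray_away v s.
  exists ((d o (s (m + n)%N))%:Z - (d v (s (m + n)%N))%:Z), (m + n)%N => k mnk.
  have := ray_steps (k - m) om; have := ray_steps n om.
  have := ray_steps (k - n) vn; have := ray_steps m vn.
  rewrite !subnKC; try lia.
  by rewrite (addnC n m); lia.
set e := \pi_boundary r.
have [m [n rE]] : exists m n, forall k, repr e (m + k)%N = r (n + k)%N.
  have : \pi_boundary (repr e) == \pi_boundary r by rewrite reprK.
  by rewrite eqmodE => /asboolP.
rewrite /horofunction; case: xgetP => [_ -> [N NP]|no_limit].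
  exists (n + N)%N => k Nk; rewrite -(subnKC (leq_trans (leq_addr N n) Nk)) -rE.
  by apply: NP; lia.
by have [c cP] := limit (repr e); case: (no_limit c).
Qed.

Lemma horofunction_seq (l : seq vertex) r : exists n, forall v, v \in l ->
  forall k, (n <= k)%N ->
  (d o (r k))%:Z - (d v (r k))%:Z = horofunction (\pi_boundary r) v.
Proof.
elim: l => [|v l [n IHn]]; first by exists 0%N.
have [m vm] := horofunctionP v r; exists (m + n)%N => w.
rewrite inE => /orP[/eqP ->|wl] k mnk; [apply: vm|apply: IHn => //]; lia.
Qed.

Lemma horofunction_base e : horofunction e o = 0.
Proof.
rewrite -[e]reprK; have [n /(_ n (leqnn n)) <-] := horofunctionP o (repr e).
by rewrite subrr.
Qed.

Lemma horofunction_le e v : horofunction e v <= d o v.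
Proof.
rewrite -[e]reprK; have [n /(_ n (leqnn n)) <-] := horofunctionP v (repr e).
by have := dist_triangle dv v o (repr e n); lia.
Qed.

Lemma horofunction_nbrs e v : exists w (s : seq vertex), [/\ perm_eq (nbrs v) (w :: s), size s = q,
  horofunction e w = horofunction e v + 1 &
  forall x, x \in s -> horofunction e x = horofunction e v - 1].
Proof.
rewrite -[e]reprK; set r := repr e.
have [n nP] := horofunction_seq (v :: nbrs v) r.
have [k nk rk] : exists2 k, (n <= k)%N & r k != v.
  have [rv|] := eqVneq (r n) v; last by exists n.
  exists n.+1; rewrite // eq_sym -rv -(dist_eq0 dv) dist_ray //; lia.
have [w [s [E sq wE sE]]] := dist_nbrs dv (r k) v.
rewrite (dist_eq0 dv) (negbTE rk) in wE.
have dv0 : d (r k) v != 0%N by rewrite (dist_eq0 dv).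
have hE x : x \in v :: nbrs v ->
    horofunction (\pi_boundary r) x = (d o (r k))%:Z - (d (r k) x)%:Z.
  by move=> xv; rewrite -(nP x xv k nk) (dist_sym dv x).
have in_nbrs x : x \in w :: s -> x \in v :: nbrs v.
  by move=> xs; rewrite inE (perm_mem E) xs orbT.
exists w, s; split=> // [|x xs].
  by rewrite !hE ?mem_head ?in_nbrs ?mem_head // wE; lia.
rewrite !hE ?mem_head ?in_nbrs //; last by rewrite inE xs orbT.
by rewrite sE //; lia.
Qed.

Lemma ray_to_ray r v : r 0%N = o -> ray_to o (\pi_boundary r) v -> v = r (d o v).
Proof.
move=> r0 [s [s0 /eqP]]; rewrite eqmodE => /asboolP[m [n rs]] [k sk].
have dE (t : ray) j : t 0%N = o -> d o (t j) = j.
  by move=> <-; rewrite dist_ray // subn0.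
have mn : m = n by have := congr1 (d o) (rs 0%N); rewrite !dE // !addn0.
have ov : d o v = k by rewrite -sk dE.
apply: (@geodesic_unique _ _ _ _ dv o _ _ (r (m + k)%N)); rewrite /on_geodesic.
- by rewrite -sk rs -mn !dE // dist_ray ?leq_addl // addnK addnC.
- by rewrite !dE // ov dist_ray ?leq_addl // addnK addnC.
- by rewrite dE.
Qed.

Lemma ray_toP e v : ray_to o e v <-> horofunction e v = d o v.
Proof.
have [r [r0 rE]] := ray_from o (repr e); rewrite reprK in rE.
have dE j : d o (r j) = j by rewrite -r0 dist_ray // subn0.
have [n nP] := horofunctionP v r; rewrite -rE; split=> [/(ray_to_ray r0) vE|hv].
  rewrite -(nP (n + d o v)%N (leq_addr _ _)) dE {2}vE dist_ray ?leq_addl //; lia.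
exists r; split=> //; exists (d o v).
apply: (@geodesic_unique _ _ _ _ dv o _ _ (r (n + d o v)%N)); rewrite ?dE //.
  by rewrite /on_geodesic !dE dist_ray ?leq_addl // addnK addnC.
have := nP (n + d o v)%N (leq_addr _ _); rewrite hv dE /on_geodesic dE; lia.
Qed.

Lemma busemannE g e : busemann g e = horofunction e (vertex_act g o).
Proof.
rewrite /busemann; set go := vertex_act g o.
have [r1 [r10 r1E]] := ray_from o (repr e); have [r2 [r20 r2E]] := ray_from go (repr e).
rewrite reprK in r1E r2E.
case: xgetP => [x _ [] |no_common]; last first.
  have : \pi_boundary r1 == \pi_boundary r2 by rewrite r1E r2E.
  rewrite eqmodE => /asboolP[m [n r12]].
  case: (no_common (r1 (m + 0)%N)); split; first by exists r1; split=> //; exists (m + 0)%N.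
  by exists r2; split=> //; exists (n + 0)%N; rewrite -r12.
move=> [s1 [s10 s1E [m xE]]] [s2 [s20 s2E [n xE']]].
have : \pi_boundary s1 == \pi_boundary s2 by rewrite -s1E -s2E.
rewrite eqmodE => /asboolP[a [b ab]].
have [N NP] := horofunctionP go s1; rewrite s1E.
rewrite -(NP (a + (N + m + n))%N) -?s1E; last by lia.
have d1 j : d o (s1 j) = j by rewrite -s10 dist_ray // subn0.
have d2 j : d go (s2 j) = j by rewrite -s20 dist_ray // subn0.
have : d x (s1 (a + (N + m + n))%N) = d x (s2 (b + (N + m + n))%N) by rewrite ab.
rewrite -{1}xE -{1}xE' !dist_ray; try lia.
by rewrite d1 ab d2 -{1}xE -xE' d1 d2; lia.
Qed.

Lemma ray_to_nbhs e v : ray_to o e v -> nbhs e [set e' | ray_to o e' v].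
Proof.
move=> ev; exists [set e' | ray_to o e' v]; split=> //.
exists [set [set e' : boundary | ray_to o e' v]]; last by rewrite bigcup_set1.
by move=> _ ->; apply: finI_from1.
Qed.

Lemma nbhs_ray_to e (U : set boundary) : nbhs e U ->
  exists2 v, ray_to o e v & [set e' | ray_to o e' v] `<=` U.
Proof.
have [r [r0 rE]] := ray_from o (repr e); rewrite reprK in rE.
have dE j : d o (r j) = j by rewrite -r0 dist_ray // subn0.
have on_r k : ray_to o e (r k) by exists r; split=> //; exists k.
have sub k j e' : (k <= j)%N -> ray_to o e' (r j) -> ray_to o e' (r k).
  move=> kj; have [s [s0 sE]] := ray_from o (repr e'); rewrite reprK in sE.
  rewrite -sE => /(ray_to_ray s0); rewrite dE => rj; exists s; split=> //.
  exists k; have sdE i : d o (s i) = i by rewrite -s0 dist_ray // subn0.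
  apply: (@geodesic_unique _ _ _ _ dv o _ _ (r j)); rewrite ?dE ?sdE //;
  rewrite /on_geodesic ?dE ?sdE; last by rewrite dist_ray // subnKC.
  by rewrite rj dist_ray // subnKC.
move=> [_ [[D' D'D <-] [A D'A Ae] subU]].
have [fs _ fsA] := D'D _ D'A.
exists (r (\max_(v <- (fs : seq vertex)) d o v)%N) => // e' e'r; apply: subU.
have AE : (A : set boundary) = [set e1 | forall v, v \in fs -> ray_to o e1 v] := esym fsA.
suff Ae' : (A : set boundary) e' by exists A.
rewrite AE => v /= v_fs.
have ev : ray_to o e v by move: (Ae : (A : set boundary) e); rewrite AE; apply.
rewrite -rE in ev; rewrite (ray_to_ray r0 ev); apply: sub e'r.
by rewrite (big_rem v) //= leq_maxl.
Qed.

Lemma horofunction_locally_constant v e :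
  \forall e' \near e, horofunction e' v = horofunction e v.
Proof.
have [r [r0 rE]] := ray_from o (repr e); rewrite reprK in rE.
have [n vn] := ray_away v r.
have hE (s : ray) : s 0%N = o -> d v (s n.+1) = (d v (s n)).+1 ->
    horofunction (\pi_boundary s) v = n%:Z - (d v (s n))%:Z.
  move=> s0 sn; have [N NP] := horofunctionP v s.
  rewrite -(NP (n + N)%N); last by lia.
  by rewrite -{1}s0 dist_ray // ray_steps //; lia.
have er : ray_to o e (r n.+1) by exists r; split=> //; exists n.+1.
apply: filterS (ray_to_nbhs er) => e' /=.
have [s [s0 sE]] := ray_from o (repr e'); rewrite reprK in sE.
rewrite -sE -rE => /(ray_to_ray s0); rewrite -{1}r0 dist_ray // subn0 => sr.
have parent_o (t : ray) : t 0%N = o -> parent o (t n.+1) = t n.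
  move=> t0; apply: (parentE dv); first by rewrite (nbrs_sym dv) ray_nbr.
  by rewrite -t0 !dist_ray // !subn0.
have sn : s n = r n by rewrite -parent_o // -sr parent_o.
by rewrite !hE // -?sr ?sn.
Qed.

Lemma branch_end (f : nat -> vertex) : f 0%N = o ->
  (forall k, f k.+1 \in nbrs (f k)) -> (forall k, d o (f k) = k) ->
  exists e, forall U, nbhs e U -> exists k, [set e' | ray_to o e' (f k)] `<=` U.
Proof.
move=> f0 f_nbr fk; have [r fr] := is_rayP (level_is_ray f_nbr fk).
exists (\pi_boundary r) => U /nbhs_ray_to[v /ray_to_ray vE vU].
by exists (d o v); rewrite fr -vE // -fr.
Qed.

End TreeBoundary.

Section HilbertSpaces.
Variable R : realType.
Local Notation C := R[i].
Implicit Type H : hilbertType R.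

Lemma innerDl H (u v w : H) : inner (u + v) w = inner u w + inner v w.
Proof. exact: linearDl. Qed.

Lemma innerZl H a (u w : H) : inner (a *: u) w = a * inner u w.
Proof. exact: linearZl_LR. Qed.

Lemma innerC H (u v : H) : inner u v = (inner v u)^*.
Proof. by rewrite [LHS]hermC expr0 mul1r. Qed.

Lemma innerDr H (u v w : H) : inner u (v + w) = inner u v + inner u w.
Proof. exact: linearDr. Qed.

Lemma innerZr H a (u w : H) : inner u (a *: w) = a^* * inner u w.
Proof. exact: linearZr_LR. Qed.

Lemma innerBl H (u v w : H) : inner (u - v) w = inner u w - inner v w.
Proof. exact: linearBl. Qed.

Lemma innerBr H (u v w : H) : inner u (v - w) = inner u v - inner u w.
Proof. exact: linearBr. Qed.

Lemma innerNl H (u w : H) : inner (- u) w = - inner u w.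
Proof. exact: linearNl. Qed.

Lemma innerNr H (u w : H) : inner u (- w) = - inner u w.
Proof. exact: linearNr. Qed.

Lemma inner_suml H I (r : seq I) (F : I -> H) w :
  inner (\sum_(i <- r) F i) w = \sum_(i <- r) inner (F i) w.
Proof. exact: linear_sumlz. Qed.

Lemma inner_sumr H I (r : seq I) (F : I -> H) w :
  inner w (\sum_(i <- r) F i) = \sum_(i <- r) inner w (F i).
Proof. exact: linear_sumr. Qed.

Lemma inner_eq0 H (u : H) : inner u u = 0 -> u = 0.
Proof. by rewrite -inner_norm => /eqP; rewrite sqrf_eq0 normr_eq0 => /eqP. Qed.

Lemma inner_polarization H (u v : H) : 4 * inner u v =
  `|u + v| ^+ 2 - `|u - v| ^+ 2 + 'i * (`|u + 'i *: v| ^+ 2 - `|u - 'i *: v| ^+ 2).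
Proof.
rewrite !inner_norm !(innerDl, innerDr, innerNl, innerNr, innerZl, innerZr).
rewrite conjCi; move: (inner u u) (inner u v) (inner v u) (inner v v) => a b c e.
have ii : 'i * 'i = -1 :> C by rewrite -expr2 sqrCi.
rewrite (_ : 'i * _ = - 2 * ('i * 'i) * b + 2 * ('i * 'i) * c); last by ring.
by rewrite ii; ring.
Qed.

Lemma isometry_inner H (H' : hilbertType R) (f : {linear H -> H'}) :
  (forall u, `|f u| = `|u|) -> forall u v, inner (f u) (f v) = inner u v.
Proof.
move=> f_norm u v; have /mulfI : 4 != 0 :> C by rewrite pnatr_eq0.
by apply; rewrite !inner_polarization -!linearZ -!linearD -!linearB !f_norm.
Qed.

Lemma cvg_inner H (T : Type) (F : set_system T) {FF : ProperFilter F} (f g : T -> H)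
    (u v : H) : f @ F --> u -> g @ F --> v ->
  (fun t => inner (f t) (g t)) @ F --> (inner u v : C^o).
Proof.
move=> fu gv; have n4 : 4 != 0 :> C by rewrite pnatr_eq0.
have E (x y : H) : inner x y = 4^-1 * (`|x + y| ^+ 2 - `|x - y| ^+ 2 +
    'i * (`|x + 'i *: y| ^+ 2 - `|x - 'i *: y| ^+ 2)).
  by rewrite -inner_polarization mulKf.
rewrite E; under eq_fun do rewrite E.
have sq (h : T -> H) w : h @ F --> w -> (fun t => `|h t| ^+ 2 : C^o) @ F --> (`|w| ^+ 2 : C^o).
  by move=> hw; under eq_fun do rewrite expr2; rewrite expr2; apply: cvgM; apply: cvg_norm.
apply: cvgMr; apply: cvgD; first by apply: cvgB; apply: sq; [apply: cvgD|apply: cvgB].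
apply: cvgMr; apply: cvgB; apply: sq; [apply: cvgD|apply: cvgB] => //; exact: cvgZr.
Qed.

Lemma dense_approx H (A : set H) : dense A <->
  forall w (e : C), 0 < e -> exists2 a, A a & `|w - a| < e.
Proof.
split=> [A_dense w e e0|approx U [w Uw] oU].
  have [||a [wa Aa]] := A_dense (ball w e); last first.
  - by exists a => //; move: wa; rewrite -ball_normE.
  - exact: ball_open.
  - by exists w; apply: ballxx.
have /nbhs_ballP[e /= e0 eU] : nbhs w U by apply: open_nbhs_nbhs.
by have [a Aa wa] := approx w e e0; exists a; split=> //; apply: eU; rewrite -ball_normE.
Qed.

Lemma complex_invn_lt (e : C) : 0 < e ->
  exists N, forall n, (N <= n)%N -> n.+1%:R^-1 < e.
Proof.
case: e => x y; rewrite ltcE /= => /andP[/eqP -> x0].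
have [N _ NP] := near_infty_natSinv_lt (PosNum x0).
exists N => n Nn; have := NP n Nn; rewrite /= -ltcR.
by rewrite fmorphV rmorph_nat.
Qed.

Lemma cauchy_sequence_cvg H (u : nat -> H) :
  (forall e : C, 0 < e -> exists N, forall n, (N <= n)%N -> `|u N - u n| < e) ->
  cvgn u.
Proof.
move=> u_cauchy; apply: cauchy_cvg; apply: cauchy_exP => e e0.
have [N NP] := u_cauchy e e0; exists (u N); exists N => // n Nn /=.
by rewrite -ball_normE; apply: NP.
Qed.

Definition lspan S H (x : S -> H) : set H :=
  [set \sum_(p <- l) p.1 *: x p.2 | l in [set: seq (C * S)]].

Lemma lspan_sub S H (x : S -> H) (W : set H) :
  W 0 -> (forall a u w, W u -> W w -> W (a *: u + w)) ->
  (forall s, W (x s)) -> lspan x `<=` W.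
Proof.
move=> W0 WD Wx _ [l _ <-]; elim: l => [|[a s] l IHl]; first by rewrite big_nil.
by rewrite big_cons; apply: WD.
Qed.

Lemma lspan0 S H (x : S -> H) : lspan x 0.
Proof. by exists [::]; rewrite ?big_nil. Qed.

Lemma lspanP S H (x : S -> H) a u w : lspan x u -> lspan x w -> lspan x (a *: u + w).
Proof.
move=> [l _ <-] [l' _ <-]; exists ([seq (a * p.1, p.2) | p <- l] ++ l') => //.
rewrite big_cat big_map scaler_sumr; congr (_ + _).
by apply: eq_bigr => p _; rewrite scalerA.
Qed.

Lemma lspan_mem S H (x : S -> H) s : lspan x (x s).
Proof. by exists [:: (1, s)]; rewrite // big_seq1 scale1r. Qed.

Lemma lspan_sum S H (x : S -> H) I (r : seq I) (P : pred I) (F : I -> H) :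
  (forall i, P i -> lspan x (F i)) -> lspan x (\sum_(i <- r | P i) F i).
Proof.
move=> Fx; apply: big_ind Fx; first exact: lspan0.
by move=> u w ux wx; rewrite -[u]scale1r; apply: lspanP.
Qed.

Lemma lspanZ S H (x : S -> H) a u : lspan x u -> lspan x (a *: u).
Proof. by move=> ux; rewrite -[_ *: _]addr0; apply: lspanP => //; apply: lspan0. Qed.

Definition lclosure S H (x : S -> H) : set H :=
  [set u | forall e : C, 0 < e -> exists2 a, lspan x a & `|u - a| < e].

Lemma lspan_closure S H (x : S -> H) : lspan x `<=` lclosure x.
Proof. by move=> u xu e e0; exists u; rewrite // subrr normr0. Qed.

Lemma lclosureP S H (x : S -> H) a u w :
  lclosure x u -> lclosure x w -> lclosure x (a *: u + w).
Proof.
move=> xu xw e e0; have ea0 : 0 < e / 2 / (`|a| + 1).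
  by rewrite !divr_gt0 // ltr_wpDl.
have [b xb ub] := xu _ ea0; have [c xc wc] := xw (e / 2) (divr_gt0 e0 (ltr0Sn _ 1)).
exists (a *: b + c); first exact: lspanP.
rewrite opprD addrACA -scalerBr (le_lt_trans (ler_normD _ _)) //.
rewrite [e]splitr ler_ltD // normrZ.
rewrite (le_trans (ler_pM _ _ (lexx _) (ltW ub))) // mulrCA ger_pMr ?divr_gt0 //.
by rewrite ler_pdivrMr ?mul1r ?lerDl // ltr_wpDl.
Qed.

Lemma lclosure_closed S H (x : S -> H) w :
  (forall e : C, 0 < e -> exists2 a, lclosure x a & `|w - a| < e) -> lclosure x w.
Proof.
move=> xw e e0; have e20 : 0 < e / 2 by rewrite divr_gt0.
have [u /(_ _ e20)[a xa ua] wu] := xw _ e20; exists a => //.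
by rewrite [e]splitr -(subrKA u) (le_lt_trans (ler_normD _ _)) // ltrD.
Qed.

Lemma dense_lspan_trans S T H (x : S -> H) (y : T -> H) :
  dense (lspan x) -> (forall s, lclosure y (x s)) -> dense (lspan y).
Proof.
move=> /dense_approx x_dense xy; apply/dense_approx => w.
apply: lclosure_closed => e e0; have [a xa wa] := x_dense w e e0; exists a => //.
apply: lspan_sub xa => //; first exact/lspan_closure/lspan0.
by move=> *; apply: lclosureP.
Qed.

Lemma gram_isometry S H (H' : hilbertType R) (x : S -> H) (y : S -> H') :
  dense (lspan x) ->
  (forall s t, inner (y s) (y t) = inner (x s) (x t)) ->
  exists2 J : {linear H -> H'}, forall u v, inner (J u) (J v) = inner u v &
    forall s, J (x s) = y s.
Proof.
move=> /dense_approx x_dense gram.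
pose comb V (z : S -> V : lmodType C) l := \sum_(p <- l : seq (C * S)) p.1 *: z p.2.
have comb_norm l : `|comb _ y l| = `|comb _ x l|.
  apply: (@pexpIrn _ 2); rewrite ?nnegrE // !inner_norm !inner_suml.
  apply: eq_bigr => p _; rewrite !inner_sumr; apply: eq_bigr => p' _.
  by rewrite !innerZl !innerZr gram.
have comb_lin a l l' : exists l'', forall V (z : S -> V : lmodType C),
    comb V z l'' = a *: comb V z l + comb V z l'.
  exists ([seq (a * p.1, p.2) | p <- l] ++ l') => V z.
  rewrite /comb big_cat big_map scaler_sumr; congr (_ + _).
  by apply: eq_bigr => p _; rewrite scalerA.
pose P (h : H) (k : H') := exists l : nat -> seq (C * S),
  (fun n => comb _ x (l n)) @ \oo --> h /\ (fun n => comb _ y (l n)) @ \oo --> k.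
have P_ex h : exists k, P h k.
  have approx n : exists l, `|h - comb _ x l| < n.+1%:R^-1.
    by have [|_ [l _ <-] hl] := x_dense h n.+1%:R^-1; [rewrite invr_gt0|exists l].
  have [l lP] := choice approx.
  have lh : (fun n => comb _ x (l n)) @ \oo --> h.
    apply/cvgrPdist_lt => e e0; have [N NP] := complex_invn_lt e0.
    by exists N => // n Nn; apply: lt_trans (lP n) (NP n Nn).
  suff /cvg_ex[k lk] : cvgn (fun n => comb _ y (l n)) by exists k, l.
  apply: cauchy_sequence_cvg => e e0.
  have [N NP] := complex_invn_lt (divr_gt0 e0 (ltr0Sn _ 1)).
  exists N => n Nn; have [l' l'E] := comb_lin (-1) (l n) (l N).
  rewrite distrC -opprB normrN.
  have -> : comb _ y (l N) - comb _ y (l n) = comb _ y l'.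
    by rewrite l'E scaleN1r addrC.
  rewrite comb_norm l'E scaleN1r addrC -(subrKA h) [e]splitr.
  rewrite (le_lt_trans (ler_normD _ _)) // ltrD //.
    by rewrite distrC (lt_trans (lP N)) ?NP.
  by rewrite (lt_trans (lP n)) ?NP.
have P_lin a h k h' k' : P h k -> P h' k' -> P (a *: h + h') (a *: k + k').
  move=> [l [lh lk]] [l' [l'h l'k]].
  have [l'' l''E] := choice (fun n => comb_lin a (l n) (l' n)).
  exists l''; split; under eq_fun do rewrite l''E; apply: cvgD => //; exact: cvgZr.
have P_norm h k : P h k -> `|k| = `|h|.
  move=> [l [/cvg_norm lh /cvg_norm]]; under eq_fun do rewrite comb_norm.
  by move=> lk; apply: cvg_unique lk lh; apply: norm_hausdorff.
have P_uniq h k k' : P h k -> P h k' -> k = k'.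
  move=> hk hk'; have := P_norm _ _ (P_lin (-1) _ _ _ _ hk hk').
  rewrite !scaleN1r addNr normr0 => /eqP; rewrite normr_eq0 addrC subr_eq0.
  by move=> /eqP.
have [f fP] := choice P_ex.
have f_lin : linear f.
  by move=> a u v; apply: (P_uniq (a *: u + v)) => //; apply: P_lin.
pose fL := GRing.isLinear.Build C H H' *:%R f f_lin.
pose J : {linear H -> H'} := HB.pack f fL.
exists J; first by apply: isometry_inner => u; apply: P_norm.
move=> s; apply: (P_uniq (x s)) => //; exists (fun=> [:: (1, s)]).
by rewrite /comb; split; under eq_fun do rewrite big_seq1 scale1r; apply: cvg_cst.
Qed.

(* Convergence of the Gram matrices makes the sequences [y^~ s] Cauchy, because
   [|y m s - y n s|^2] only involves their entries. *)
Lemma limit_isometry S H (H' : hilbertType R) (x : S -> H) (y : nat -> S -> H')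
    (D : S -> S -> nat) : dense (lspan x) -> (forall s, D s s = 0%N) ->
  (forall s t (e : C), 0 < e -> exists N, forall m n, (N <= m)%N -> (m + D s t <= n)%N ->
     `|inner (y m s) (y n t) - inner (x s) (x t)| < e) ->
  exists2 J : {linear H -> H'}, forall u v, inner (J u) (J v) = inner u v &
    forall s, y^~ s @ \oo --> J (x s).
Proof.
move=> x_dense D0 gram.
have y_cvg s : cvgn (y^~ s).
  apply: cauchy_sequence_cvg => e e0.
  have [N NP] := gram s s (e ^+ 2 / 4) (divr_gt0 (exprn_gt0 _ e0) (ltr0Sn _ 3)).
  exists N => n Nn; rewrite D0 in NP.
  have real : (inner (x s) (x s))^* = inner (x s) (x s) by rewrite -innerC.
  set g := inner (x s) (x s) in real NP.
  have small m k : (N <= m)%N -> (m <= k)%N -> `|inner (y m s) (y k s) - g| < e ^+ 2 / 4.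
    by move=> Nm mk; apply: NP; rewrite ?addn0.
  rewrite -(@ltr_pXn2r _ 2) ?nnegrE ?(ltW e0) // -[ltLHS]ger0_norm ?exprn_ge0 //.
  rewrite inner_norm innerBl !innerBr.
  rewrite (_ : _ - _ = (inner (y N s) (y N s) - g) - (inner (y N s) (y n s) - g)
     - ((inner (y N s) (y n s) - g)^* - (inner (y n s) (y n s) - g))); last first.
    by rewrite rmorphB /= real -innerC; ring.
  have -> : e ^+ 2 = e ^+ 2 / 4 + e ^+ 2 / 4 + (e ^+ 2 / 4 + e ^+ 2 / 4) by field.
  rewrite (le_lt_trans (ler_normB _ _)) // ltrD // (le_lt_trans (ler_normB _ _)) //.
    by rewrite ltrD // small.
  by rewrite norm_conjC ltrD // small.
have [Y YP] := choice (fun s => (cvg_ex _).1 (y_cvg s)).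
suff gramY s t : inner (Y s) (Y t) = inner (x s) (x t).
  have [J J_iso JY] := gram_isometry x_dense gramY.
  by exists J => // s; rewrite JY.
have shift : (fun n => y (n + D s t)%N t) @ \oo --> Y t by rewrite (cvg_shiftn (D s t) (y^~ t)).
have lim1 := cvg_inner (FF := _) (YP s) shift.
have lim2 : (fun n => inner (y n s) (y (n + D s t)%N t)) @ \oo --> (inner (x s) (x t) : C^o).
  apply/cvgrPdist_lt => e e0; have [N NP] := gram s t e e0.
  by exists N => // n Nn /=; rewrite distrC; apply: NP.
exact: (cvg_unique (@norm_hausdorff _ _) (lim1 _) lim2).
Qed.

Section TensorDensity.
Variables (n : nat) (H : 'I_n -> hilbertType R) (T : hilbert_tensor H).
Variables (S : Type) (x : forall i, S -> H i).

Lemma pure_tensor_scale (u : forall i, H i) i (a : C) (w : H i) :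
  pure_tensor T (dfwith u i (a *: w)) = a *: pure_tensor T (dfwith u i w).
Proof.
have h0 : pure_tensor T (dfwith u i 0) = 0.
  have := @pure_multilinear _ _ _ T u i 1 0 0; rewrite !scale1r addr0 => /eqP.
  by rewrite -subr_eq0 opprD addrA subrr sub0r oppr_eq0 => /eqP.
by have := @pure_multilinear _ _ _ T u i a w 0; rewrite addr0 h0 addr0.
Qed.

Lemma pure_tensorB (u : forall i, H i) i (w w' : H i) :
  pure_tensor T (dfwith u i (w - w')) =
  pure_tensor T (dfwith u i w) - pure_tensor T (dfwith u i w').
Proof.
have := @pure_multilinear _ _ _ T u i (-1) w' w.
by rewrite !scaleN1r addrC => ->; rewrite addrC.
Qed.

Lemma pure_tensor_norm (u : forall i, H i) :
  `|pure_tensor T u| = \prod_i `|u i|.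
Proof.
apply: (@pexpIrn _ 2); rewrite ?nnegrE ?prodr_ge0 // inner_norm pure_inner.
by rewrite -prodrXl; apply: eq_bigr => i _; rewrite inner_norm.
Qed.

Lemma dense_pure_tensors : (forall i, dense (lspan (x i))) ->
  dense (lspan (fun s : 'I_n -> S => pure_tensor T (fun i => x i (s i)))).
Proof.
move=> x_dense; set y := fun s => _.
suff pureW u : lclosure y (pure_tensor T u).
  apply: (@dense_lspan_trans _ _ _ (pure_tensor T)) => [|u]; last exact: pureW.
  apply/dense_approx => w e e0.
  have /dense_approx/(_ w e e0)[_ [m [a [v ->]]] wa] := @pure_dense _ _ _ T.
  exists (\sum_(k < m) a k *: pure_tensor T (v k)) => //.
  by apply: lspan_sum => k _; apply: lspanZ; exact: (lspan_mem (pure_tensor T)).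
suff h k (v : forall i, H i) :
    (forall i : 'I_n, (k <= i)%N -> exists s, v i = x i s) -> lclosure y (pure_tensor T v).
  by apply: (h n) => i; rewrite leqNgt ltn_ord.
elim: k v => [|k IHk] v vx.
  have [s sE] := choice (fun i => vx i (leq0n i)).
  apply: lspan_closure; have -> : v = (fun i => x i (s i)).
    exact: functional_extensionality_dep.
  exact: (lspan_mem y).
have [nk|kn] := leqP n k.
  by apply: IHk => i ki; have := ltn_ord i; rewrite ltnNge (leq_trans nk).
pose i0 := Ordinal kn; pose f w := pure_tensor T (dfwith v i0 w).
have fx w : lspan (x i0) w -> lclosure y (f w).
  apply: (@lspan_sub _ _ _ [set w | lclosure y (f w)]) => /=.
  - rewrite /f -(scale0r 0) pure_tensor_scale scale0r.
    exact/lspan_closure/lspan0.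
  - by move=> a u1 u2 fu1 fu2; rewrite /f pure_multilinear; apply: lclosureP.
  move=> s; apply: IHk => i; case: dfwithP => [_|j i0j kj]; first by exists s.
  by apply: vx; rewrite ltn_neqAle kj andbT.
have -> : pure_tensor T v = f (v i0).
  congr pure_tensor; apply: functional_extensionality_dep => i.
  by case: dfwithP.
pose c := \prod_(i | i != i0) `|v i|.
have fB w w' : `|f w - f w'| = c * `|w - w'|.
  rewrite -pure_tensorB pure_tensor_norm (bigD1 i0) //= dfwithin mulrC.
  congr (_ * _); apply: eq_bigr => i ii0; by rewrite dfwithout 1?eq_sym.
have c0 : 0 <= c by apply: prodr_ge0.
apply: lclosure_closed => e e0; have ec0 : 0 < e / (c + 1).
  by rewrite divr_gt0 // ltr_wpDl.
have /dense_approx/(_ (v i0) _ ec0)[a xa va] := x_dense i0.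
exists (f a); first exact: fx.
rewrite fB (le_lt_trans (ler_wpM2l c0 (ltW va))) // mulrCA gtr_pMr //.
by rewrite ltr_pdivrMr ?mul1r ?ltrDl // ltr_wpDl.
Qed.

End TensorDensity.

End HilbertSpaces.

Section SphericalFunctions.
Variables (R : realType) (q : nat) (z : R).
Hypotheses (q_gt1 : (1 < q)%N) (z_range : 0 <= z < 2^-1).

Definition slow_rate : R := q%:R `^ (- z).
Definition fast_rate : R := q%:R `^ (z - 1).
Local Notation a := slow_rate.
Local Notation b := fast_rate.

Definition slow_coef := (b^-1 - b) / ((a - b) * q.+1%:R).
Definition fast_coef := (a^-1 - a) / ((b - a) * q.+1%:R).
Definition spherical_function n := slow_coef * a ^+ n + fast_coef * b ^+ n.
Local Notation phi := spherical_function.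

Lemma q_gt0 : 0 < q%:R :> R. Proof. by rewrite ltr0n ltnW. Qed.
Lemma slow_rate_gt0 : 0 < a. Proof. exact: powR_gt0 q_gt0. Qed.
Lemma fast_rate_gt0 : 0 < b. Proof. exact: powR_gt0 q_gt0. Qed.

Lemma rateM : q%:R * a * b = 1.
Proof.
rewrite -mulrA /a /b -powRD; last by rewrite (gt_eqF q_gt0) implybT.
by rewrite addrA addNr sub0r powR_inv1 ?divff ?gt_eqF ?q_gt0 // ltW ?q_gt0.
Qed.

Lemma fast_lt_slow : b < a.
Proof.
have /andP[_ z_lt] := z_range.
have q0 : (q%:R == 0 :> R) = false by rewrite gt_eqF ?q_gt0.
rewrite /fast_rate /slow_rate /powR q0 ltr_expR ltr_pM2r ?ln_gt0 ?ltr1n //.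
lra.
Qed.

Lemma slow_rate_le1 : a <= 1.
Proof.
have /andP[z_ge0 _] := z_range.
by rewrite -(powRr0 q%:R) ler_powR ?oppr_le0 // ler1n ltnW.
Qed.

Lemma fast_rate_lt1 : b < 1.
Proof. exact: lt_le_trans fast_lt_slow slow_rate_le1. Qed.

Lemma rate_inv : a^-1 = q%:R * b /\ b^-1 = q%:R * a.
Proof.
have a0 := slow_rate_gt0; have b0 := fast_rate_gt0.
split; [apply: (mulIf (lt0r_neq0 a0))|apply: (mulIf (lt0r_neq0 b0))].
  by rewrite mulVf ?lt0r_neq0 // mulrAC rateM.
by rewrite mulVf ?lt0r_neq0 // rateM.
Qed.

Lemma slow_coef_gt0 : 0 < slow_coef.
Proof.
rewrite divr_gt0 // ?subr_gt0; last by rewrite mulr_gt0 ?subr_gt0 ?fast_lt_slow ?ltr0Sn.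
by rewrite (lt_trans fast_rate_lt1) // invf_gt1 ?fast_rate_gt0 ?fast_rate_lt1.
Qed.

Lemma spherical_function0 : phi 0 = 1.
Proof.
rewrite /phi !expr0 !mulr1 /slow_coef /fast_coef.
have [-> ->] := rate_inv.
have ab0 : a - b != 0 by rewrite subr_eq0 gt_eqF ?fast_lt_slow.
have ba0 : b - a != 0 by rewrite subr_eq0 lt_eqF ?fast_lt_slow.
have q1 : q.+1%:R != 0 :> R by rewrite pnatr_eq0.
rewrite -natr1 in q1 *; field; rewrite ?ab0 ?ba0 ?q1 //.
Qed.

Lemma spherical_function1 : q.+1%:R * phi 1 = q%:R * (a + b).
Proof.
rewrite /phi !expr1 /slow_coef /fast_coef.
have ab0 : a - b != 0 by rewrite subr_eq0 gt_eqF ?fast_lt_slow.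
have ba0 : b - a != 0 by rewrite subr_eq0 lt_eqF ?fast_lt_slow.
have q1 : q.+1%:R != 0 :> R by rewrite pnatr_eq0.
by have [-> ->] := rate_inv; field; rewrite ab0 ba0 addrC natr1 q1.
Qed.

Lemma spherical_function_rec n :
  phi n + q%:R * phi n.+2 = q%:R * (a + b) * phi n.+1.
Proof.
rewrite /phi !exprS; have := rateM; move: (a ^+ n) (b ^+ n) => x y ab1.
have : (slow_coef * x + fast_coef * y) * (q%:R * a * b - 1) = 0 by rewrite ab1 subrr mulr0.
lra.
Qed.

Lemma spherical_function_le n : `|phi n| <= (`|slow_coef| + `|fast_coef|) * a ^+ n.
Proof.
rewrite /phi (le_trans (ler_normD _ _)) // mulrDl !normrM.
have a0 := ltW slow_rate_gt0; have b0 := ltW fast_rate_gt0.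
rewrite lerD // ?(ger0_norm (exprn_ge0 _ _)) // ler_wpM2l //.
by rewrite lerXn2r // ?nnegrE // ltW ?fast_lt_slow.
Qed.

End SphericalFunctions.

Lemma sum_at_most_one (R : numDomainType) (T : eqType) (s : seq T) (P : pred T)
    (F : T -> R) (c : R) : uniq s -> 0 <= c ->
  (forall x, x \in s -> ~~ P x -> F x = 0) ->
  (forall x y, x \in s -> y \in s -> P x -> P y -> x = y) ->
  (forall x, x \in s -> P x -> F x <= c) -> \sum_(x <- s) F x <= c.
Proof.
move=> s_uniq c0 F0 P1 Fc; have [/hasP[x xs Px]|/hasPn noP] := boolP (has P s).
  rewrite (bigD1_seq x) //= big_seq_cond big1 ?addr0 ?Fc // => y /andP[ys yx].
  by apply: F0 => //; apply: contra yx => Py; apply/eqP/P1.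
by rewrite big_seq big1 // => x xs; rewrite F0 ?noP.
Qed.

Section SphericalVectors.
Variables (R : realType) (O : idomainType) (K : fieldType) (iota : {rmorphism O -> K}).
Variable q : nat.
Hypotheses (dv : discrete_valuation iota q) (q_gt1 : (1 < q)%N).
Local Notation vertex := (vertex iota).
Local Notation d := (@tree_dist O K iota q).
Local Notation nbrs := (@nbrs O K iota q).
Local Notation parent := (@parent O K iota q).
Local Notation sphere := (@sphere O K iota q).
Local Notation on_geodesic := (@on_geodesic O K iota q).
Local Notation C := R[i].
Local Notation G := (pgl2 K).
Implicit Types (u v w x : vertex) (g : G).

(* The vectors [e v], translates of the spherical vector, satisfy the Hecke
   relation of the complementary series of parameter [z]. *)
Record spherical_vectors (z : R) (V : unitary_rep G R) (e : vertex -> V) : Prop :=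
  SphericalVectors {
  spherical_act : forall g v, rep_act g (e v) = e (vertex_act g v);
  spherical_unit : forall v, inner (e v) (e v) = 1;
  spherical_hecke : forall v, \sum_(w <- nbrs v) e w =
    (q%:R * (slow_rate q z + fast_rate q z))%:C%C *: e v;
  spherical_dense : dense (lspan e)
}.

Lemma innerZr_real (H : hilbertType R) (r : R) (u w : H) :
  inner u (r%:C%C *: w) = r%:C%C * inner u w.
Proof. by rewrite innerZr; congr (_ * _); exact: conjc_real. Qed.

Lemma children_perm u v : u != v ->
  perm_eq (nbrs v) (parent u v :: [seq w <- nbrs v | d u w == (d u v).+1]).
Proof.
move=> uv; have [w [s [E _ wE sE]]] := dist_nbrs dv u v.
have duv : d u v != 0%N by rewrite (dist_eq0 dv).
rewrite (negbTE duv) in wE.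
have -> : parent u v = w.
  by apply: (parentE dv); rewrite ?(perm_mem E) ?mem_head // wE prednK ?lt0n.
apply: (perm_trans E); rewrite perm_cons perm_sym.
apply: (perm_trans (perm_filter _ E)) => /=.
rewrite wE ltn_eqF ?ltnS ?leq_pred // (eq_in_filter (a2 := predT)) ?filter_predT //.
by move=> x /sE ->; rewrite /= eqxx.
Qed.

Section OneParameter.
Variables (z : R) (z_range : 0 <= z < 2^-1).
Local Notation a := (slow_rate q z).
Local Notation b := (fast_rate q z).
Local Notation phi := (spherical_function q z).

Definition edge_gram u v u' v' : R :=
  phi (d v v') - b * phi (d v (parent u' v')) - b * phi (d (parent u v) v')
  + b ^+ 2 * phi (d (parent u v) (parent u' v')).

Definition edge_coef : R := slow_coef q z * (a - b) ^+ 2.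

Lemma edge_coef_gt0 : 0 < edge_coef.
Proof.
by rewrite mulr_gt0 ?slow_coef_gt0 // exprn_gt0 // subr_gt0 fast_lt_slow.
Qed.

Lemma edge_gram_away u v u' v' : u != v -> ~~ on_geodesic u v v' ->
  (d u v + d u u' <= d u' v')%N ->
  edge_gram u v u' v' = edge_coef * a ^+ d (parent u v) (parent u' v').
Proof.
move=> uv off far; have [pv dp] := parent_closer dv uv.
have u_v' : u' != v'.
  by rewrite -(dist_eq0 dv) -lt0n (leq_trans _ far) // ltn_addr // -dp.
have v_v' : v != v'.
  by apply: contraNneq off => <-; rewrite /on_geodesic (distxx dv) addn0.
have off1 : ~~ on_geodesic u' v' v.
  apply: contra v_v'; rewrite /on_geodesic => /eqP E; rewrite -(dist_eq0 dv).
  by have := dist_triangle dv u u' v; rewrite (dist_sym dv v) (dist_sym dv u' u); lia.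
have off2 : ~~ on_geodesic u' v' (parent u v).
  rewrite /on_geodesic; apply/eqP => E.
  by have := dist_triangle dv u u' (parent u v); rewrite (dist_sym dv u' u); lia.
have d1 := off_geodesic dv uv off; have d2 := off_geodesic dv u_v' off1.
have d3 := off_geodesic dv u_v' off2.
set m := d (parent u v) (parent u' v').
have w'v : d (parent u v) v' = m.+1 by rewrite (dist_sym dv) d3 (dist_sym dv).
have vw' : d v (parent u' v') = m.+1.
  by apply/eqP; rewrite -eqSS (dist_sym dv v) -d2 (dist_sym dv) d1 w'v.
rewrite /edge_gram d1 w'v vw' /edge_coef /spherical_function !exprS.
by move: (a ^+ m) (b ^+ m) => x y; ring.
Qed.

Definition edge_bound : R :=
  (`|slow_coef q z| + `|fast_coef q z|) * (1 + b) ^+ 2 * a ^- 2.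

Lemma edge_bound_gt0 : 0 < edge_bound.
Proof.
have a0 : 0 < a := slow_rate_gt0 z q_gt1; have b0 : 0 < b := fast_rate_gt0 z q_gt1.
rewrite !mulr_gt0 ?invr_gt0 ?exprn_gt0 ?[0 < 1 + b]addr_gt0 //.
by rewrite ltr_pwDl // normr_gt0 gt_eqF // slow_coef_gt0.
Qed.

Lemma edge_gram_le u v u' v' : u != v -> u' != v' ->
  `|edge_gram u v u' v'| <= edge_bound * a ^+ d v v'.
Proof.
move=> uv uv'; have [/(dist_nbr dv) vp _] := parent_closer dv uv.
have [/(dist_nbr dv) vp' _] := parent_closer dv uv'.
have a0 : 0 < a := slow_rate_gt0 z q_gt1; have b0 : 0 < b := fast_rate_gt0 z q_gt1.
pose c : R := `|slow_coef q z| + `|fast_coef q z|.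
have c0 : (0 : R) <= c by rewrite addr_ge0.
have phi_le x y : (d v v' <= d x y + 2)%N -> `|phi (d x y)| <= c * a ^- 2 * a ^+ d v v'.
  move=> xy; apply: le_trans (spherical_function_le q_gt1 z_range _) _.
  rewrite -mulrA ler_wpM2l // -ler_pdivrMl ?invr_gt0 ?exprn_gt0 //.
  rewrite invrK -exprD addnC; apply: ler_wiXn2l => //; first exact: ltW.
  exact: slow_rate_le1.
have t1 := dist_triangle dv (parent u v) v v'.
have t2 := dist_triangle dv (parent u' v') v v'.
have t3 := dist_triangle dv (parent u' v') (parent u v) v'.
rewrite (dist_sym dv v') in vp'.
have expand (c' x y b' : R) : c' * (1 + b') ^+ 2 * x * y =
    c' * x * y + b' * (c' * x * y) + b' * (c' * x * y) + b' ^+ 2 * (c' * x * y) by ring.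
have -> : edge_bound * a ^+ d v v' = c * a ^- 2 * a ^+ d v v' + b * (c * a ^- 2 * a ^+ d v v')
   + b * (c * a ^- 2 * a ^+ d v v') + b ^+ 2 * (c * a ^- 2 * a ^+ d v v').
  exact: (expand c (a ^- 2) (a ^+ d v v') b).
rewrite /edge_gram (le_trans (ler_normD _ _)) // lerD //.
  rewrite (le_trans (ler_normB _ _)) // lerD //.
    rewrite (le_trans (ler_normB _ _)) // lerD //.
      by apply: phi_le; lia.
    by rewrite normrM gtr0_norm // ler_wpM2l ?(ltW b0) //; apply: phi_le; lia.
  by rewrite normrM gtr0_norm // ler_wpM2l ?(ltW b0) //; apply: phi_le; lia.
rewrite normrM gtr0_norm ?exprn_gt0 // ler_wpM2l ?exprn_ge0 ?(ltW b0) //.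
by apply: phi_le; lia.
Qed.

Variables (V : unitary_rep G R) (e : vertex -> V) (eP : spherical_vectors z e).

Lemma spherical_inner_dist u v u' v' : d u v = d u' v' ->
  inner (e u) (e v) = inner (e u') (e v').
Proof.
move=> /(transitive_pairs dv)[g [<- <-]].
by rewrite -!(spherical_act eP) rep_isometry.
Qed.

Lemma spherical_inner u v : inner (e u) (e v) = (phi (d u v))%:C%C.
Proof.
move nE : (d u v) => n; elim/ltn_ind: n v nE => -[|[|n]] IHn v uv.
- have -> : v = u by apply/esym/eqP; rewrite -(dist_eq0 dv) uv.
  by rewrite (spherical_unit eP) spherical_function0.
- have /(congr1 (inner^~ (e u))) := spherical_hecke eP u.
  rewrite innerZl inner_suml (spherical_unit eP) mulr1.
  rewrite (eq_big_seq (fun=> inner (e u) (e v))); last first.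
    move=> w wu; apply: spherical_inner_dist.
    by rewrite (dist_sym dv) (dist_nbr dv) // uv.
  rewrite big_const_seq count_predT size_nbrs iter_addr_0.
  rewrite -(spherical_function1 q_gt1 z_range).
  rewrite rmorphM /= rmorph_nat -[_ *+ _]mulr_natl; apply: mulfI.
  by rewrite pnatr_eq0.
have u_neq_v : u != v by rewrite -(dist_eq0 dv) uv.
have [pv dp] := parent_closer dv u_neq_v; set v' := parent u v in pv dp.
have uv' : d u v' = n.+1 by move: dp; rewrite uv => -[].
have [w [s [E sq wE sE]]] := dist_nbrs dv u v'; rewrite uv' /= in wE sE.
have /(congr1 (inner (e u))) := spherical_hecke eP v'.
rewrite innerZr_real inner_sumr (perm_big _ E) big_cons /= (IHn _ _ _ wE) //.
rewrite (eq_big_seq (fun=> inner (e u) (e v))); last first.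
  by move=> x /sE ux; apply: spherical_inner_dist; rewrite ux uv.
rewrite big_const_seq count_predT sq iter_addr_0 (IHn _ _ _ uv') //.
rewrite -rmorphM /= -(spherical_function_rec z q_gt1).
rewrite [X in _ = X -> _]rmorphD /= => /eqP.
rewrite (inj_eq (addrI _)) => /eqP.
rewrite rmorphM /= rmorph_nat -[_ *+ _]mulr_natl; apply: mulfI.
by rewrite pnatr_eq0 -lt0n ltnW.
Qed.

Definition edge_vector u v : V := e v - b%:C%C *: e (parent u v).

Lemma edge_vector_inner u v u' v' :
  inner (edge_vector u v) (edge_vector u' v') = (edge_gram u v u' v')%:C%C.
Proof.
rewrite /edge_vector innerBl !innerBr !innerZl !innerZr_real !spherical_inner.
rewrite -!rmorphM -!rmorphB /=; congr (_%:C%C); rewrite /edge_gram.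
by move: (phi _) (phi _) (phi _) (phi _) => x1 x2 x3 x4; ring.
Qed.

Lemma edge_vector_sum u n : \sum_(v <- sphere u n.+1) edge_vector u v =
  ((q%:R * a) ^+ n * (q%:R * a - b))%:C%C *: e u.
Proof.
have coefZ (x y : R) (w : V) : x%:C%C *: w - y%:C%C *: w = (x - y)%:C%C *: w.
  by rewrite rmorphB scalerBl.
elim: n => [|n IHn].
  have -> : \sum_(v <- sphere u 1) edge_vector u v =
      \sum_(v <- nbrs u) (e v - b%:C%C *: e u).
    rewrite /sphere /= cats0 (eq_in_filter (a2 := predT)) ?filter_predT; last first.
      by move=> v /(dist_nbr dv) ->.
    apply: eq_big_seq => v vu; congr (_ - _ *: e _).
    apply: (parentE dv); first by rewrite (nbrs_sym dv).
    by rewrite (distxx dv) (dist_nbr dv vu).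
  rewrite sumrB (spherical_hecke eP) big_const_seq count_predT size_nbrs iter_addr_0.
  rewrite scalerMnl -rmorphMn coefZ expr0 mul1r; congr (_%:C%C *: _).
  by rewrite mulrS -mulr_natl; ring.
have -> : \sum_(v <- sphere u n.+2) edge_vector u v =
    \sum_(v <- sphere u n.+1) (q%:R * a)%:C%C *: edge_vector u v.
  rewrite sphereS big_flatten big_map; apply: eq_big_seq => v.
  rewrite (mem_sphere dv) => /eqP uv.
  have u_neq_v : u != v by rewrite -(dist_eq0 dv) uv.
  have chE := children_perm u_neq_v; rewrite uv in chE.
  have parE w : w \in [seq w <- nbrs v | d u w == n.+2] -> parent u w = v.
    rewrite mem_filter => /andP[/eqP uw wv].
    by apply: (parentE dv); [rewrite (nbrs_sym dv)|rewrite uw uv].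
  rewrite (eq_big_seq (fun w => e w - b%:C%C *: e v)); last first.
    by move=> w /parE <-.
  rewrite sumrB big_const_seq count_predT iter_addr_0.
  have -> : size [seq w <- nbrs v | d u w == n.+2] = q.
    by apply/eqP; rewrite -eqSS -(size_nbrs q v) (perm_size chE).
  have := spherical_hecke eP v; rewrite (perm_big _ chE) big_cons /= addrC.
  move=> /(canRL (addrK _)) ->.
  rewrite /edge_vector scalerBr scalerA -rmorphM /= rateM // scale1r.
  rewrite addrAC scalerMnl -rmorphMn coefZ; congr (_%:C%C *: _ - _).
  by rewrite -mulr_natl; ring.
by rewrite -scaler_sumr IHn scalerA -rmorphM /= mulrA -exprS.
Qed.

Lemma edge_gram_sum u u' n m :
  b ^+ n.+1 * b ^+ m.+1 *
    \sum_(v <- sphere u n.+1) \sum_(v' <- sphere u' m.+1) edge_gram u v u' v' =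
  (1 - b ^+ 2) ^+ 2 * phi (d u u').
Proof.
have norm k : b ^+ k.+1 * ((q%:R * a) ^+ k * (q%:R * a - b)) = 1 - b ^+ 2.
  have ab : b * (q%:R * a) = 1 by rewrite mulrC rateM.
  by rewrite exprS mulrA -(mulrA b) -exprMn ab expr1n mulr1 mulrBr ab expr2.
apply: complexI; rewrite rmorphM /= [in LHS]rmorph_sum /=.
have -> : \sum_(v <- sphere u n.+1) (\sum_(v' <- sphere u' m.+1) edge_gram u v u' v')%:C%C
    = inner (\sum_(v <- sphere u n.+1) edge_vector u v)
            (\sum_(v' <- sphere u' m.+1) edge_vector u' v').
  rewrite inner_suml; apply: eq_bigr => v _; rewrite inner_sumr rmorph_sum.
  by apply: eq_bigr => v' _; rewrite edge_vector_inner.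
rewrite !edge_vector_sum innerZl innerZr_real spherical_inner -!rmorphM /=.
congr (_%:C%C); rewrite expr2 -{1}(norm n) -(norm m); ring.
Qed.

End OneParameter.

Section ManyParameters.
Variables (k : nat) (P : pred 'I_k) (zs : 'I_k -> R) (z : R).
Hypotheses (zs_range : forall j, 0 <= zs j < 2^-1) (z_range : 0 <= z < 2^-1).
Hypothesis zE : z = \sum_(j | P j) zs j.
Variables (V : unitary_rep G R) (e : vertex -> V) (eP : spherical_vectors z e).
Local Notation a := (slow_rate q z).
Local Notation b := (fast_rate q z).
Local Notation phi := (spherical_function q z).

Definition tensor_gram u v u' v' := \prod_(j | P j) edge_gram (zs j) u v u' v'.

Definition tensor_coef := \prod_(j | P j) edge_coef (zs j) / edge_coef z.

Definition tensor_gram_limit u u' := tensor_coef * ((1 - b ^+ 2) ^+ 2 * phi (d u u')).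

Lemma slow_rate_prod n : \prod_(j | P j) slow_rate q (zs j) ^+ n = a ^+ n.
Proof.
rewrite prodrXl; congr (_ ^+ n); rewrite /slow_rate zE -sumrN.
have q0 : q%:R != 0 :> R by rewrite pnatr_eq0 -lt0n ltnW.
apply/esym/big_morph => [x y|]; last exact: powRr0.
by rewrite powRD // q0 implybT.
Qed.

Lemma tensor_coef_gt0 : 0 < tensor_coef.
Proof.
by rewrite divr_gt0 ?edge_coef_gt0 // prodr_gt0 // => j _; apply: edge_coef_gt0.
Qed.

Lemma tensor_gram_away u v u' v' : u != v -> ~~ on_geodesic u v v' ->
  (d u v + d u u' <= d u' v')%N ->
  tensor_gram u v u' v' = tensor_coef * edge_gram z u v u' v'.
Proof.
move=> uv off far; rewrite edge_gram_away //.
rewrite mulrA divfK ?gt_eqF ?edge_coef_gt0 // -slow_rate_prod -big_split /=.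
by apply: eq_bigr => j _; rewrite edge_gram_away.
Qed.

Definition tensor_bound := \prod_(j | P j) edge_bound (zs j).

Lemma tensor_gram_le u v u' v' : u != v -> u' != v' ->
  `|tensor_gram u v u' v'| <= tensor_bound * a ^+ d v v'.
Proof.
move=> uv uv'; rewrite normr_prod -slow_rate_prod -big_split /=.
by apply: ler_prod => j _; rewrite normr_ge0 edge_gram_le.
Qed.

Definition normalized_gram u u' n m := b ^+ n * b ^+ m *
  \sum_(v <- sphere u n) \sum_(v' <- sphere u' m) tensor_gram u v u' v'.

Lemma normalized_gram_cvg u u' n m : (n.+1 + d u u' <= m.+1)%N ->
  `|normalized_gram u u' n.+1 m.+1 - tensor_gram_limit u u'| <=
  (tensor_bound + tensor_coef * edge_bound z) * q.+1%:R * a ^- (d u u') * (b / a) ^+ n.+1.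
Proof.
move=> nm; rewrite /tensor_gram_limit -(edge_gram_sum z_range eP u u' n m).
rewrite mulrCA -mulrBr [in X in _ * (X - _)]exchange_big [in X in _ * (_ - _ * X)]exchange_big /=.
rewrite mulr_sumr -sumrB normrM.
have a0 : 0 < a := slow_rate_gt0 z q_gt1; have b0 : 0 < b := fast_rate_gt0 z q_gt1.
set D := d u u'; set X := tensor_bound + tensor_coef * edge_bound z.
have X0 : 0 <= X.
  apply: addr_ge0; last exact: mulr_ge0 (ltW tensor_coef_gt0) (ltW (edge_bound_gt0 _)).
  by apply: prodr_ge0 => j _; apply/ltW/edge_bound_gt0.
have bound v' : v' \in sphere u' m.+1 ->
  `|\sum_(v <- sphere u n.+1) tensor_gram u v u' v' -
    tensor_coef * \sum_(v <- sphere u n.+1) edge_gram z u v u' v'|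
    <= X * a ^+ (m - n - D).
  rewrite (mem_sphere dv) => /eqP uv'.
  rewrite mulr_sumr -sumrB (le_trans (ler_norm_sum _ _ _)) //.
  have u'_neq : u' != v' by rewrite -(dist_eq0 dv) uv'.
  apply: (@sum_at_most_one _ _ _ (fun v => on_geodesic u v v')).
  - exact: sphere_uniq.
  - by rewrite mulr_ge0 ?exprn_ge0 ?(ltW a0).
  - move=> v; rewrite (mem_sphere dv) => /eqP uv off.
    have u_neq : u != v by rewrite -(dist_eq0 dv) uv.
    by rewrite tensor_gram_away ?subrr ?normr0 // uv uv'.
  - move=> v w; rewrite !(mem_sphere dv) => /eqP uv /eqP uw vv' wv'.
    by apply: (geodesic_unique dv vv' wv'); rewrite uv uw.
  - move=> v; rewrite (mem_sphere dv) => /eqP uv vv'.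
    have u_neq : u != v by rewrite -(dist_eq0 dv) uv.
    rewrite (le_trans (ler_normB _ _)) //.
    rewrite (@le_trans _ _ (X * a ^+ d v v')) //.
      rewrite mulrDl lerD ?tensor_gram_le // normrM gtr0_norm ?tensor_coef_gt0 //.
      by rewrite -mulrA ler_wpM2l ?edge_gram_le // ltW ?tensor_coef_gt0.
    rewrite ler_wpM2l //; apply: ler_wiXn2l; [exact: ltW|exact: slow_rate_le1|].
    have := dist_triangle dv u u' v'; rewrite uv' (dist_sym dv u') -/D.
    by move: vv'; rewrite /on_geodesic uv; lia.
rewrite (le_trans (ler_wpM2l _ (ler_norm_sum _ _ _))) ?normr_ge0 //.
have size_bound : \sum_(v' <- sphere u' m.+1) X * a ^+ (m - n - D) =
    X * a ^+ (m - n - D) * (q.+1 * q ^ m)%:R.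
  by rewrite big_const_seq count_predT (size_sphere dv) iter_addr_0 mulr_natr.
rewrite (@le_trans _ _ (`|b ^+ n.+1 * b ^+ m.+1| * (X * a ^+ (m - n - D) * (q.+1 * q ^ m)%:R))) //.
  rewrite ler_wpM2l // -size_bound big_seq [leRHS]big_seq.
  by apply: ler_sum => v' /bound.
rewrite gtr0_norm ?mulr_gt0 ?exprn_gt0 // natrM natrX.
have bq : b * q%:R = a^-1 by have [-> _] := rate_inv z q_gt1; rewrite mulrC.
have -> : b ^+ n.+1 * b ^+ m.+1 * (X * a ^+ (m - n - D) * (q.+1%:R * q%:R ^+ m)) =
    X * q.+1%:R * (b ^+ n.+1 * (b * (a ^- m * a ^+ (m - n - D)))).
  have shuffle (x1 x2 x3 x4 x5 x6 x7 : R) : x1 * (x2 * x3) * (x4 * x5 * (x6 * x7)) =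
    x4 * x6 * (x1 * (x2 * (x3 * x7 * x5))) by ring.
  by rewrite -exprVn -bq exprMn [b ^+ m.+1]exprS shuffle.
rewrite -[leRHS]mulrA ler_wpM2l ?mulr_ge0 // expr_div_n [leRHS]mulrCA ler_wpM2l ?exprn_ge0 ?(ltW b0) //.
have -> : a ^- m = a ^- (m - n - D) * (a ^- n * a ^- D).
  by rewrite -!exprVn -!exprD; congr (_ ^+ _); lia.
rewrite mulrAC mulVf ?mul1r ?expf_neq0 ?gt_eqF // exprS invfM [a^-1 * _]mulrC.
rewrite mulrCA [a ^- D * _]mulrC -!mulrA ler_wpM2l ?invr_ge0 ?exprn_ge0 ?(ltW a0) //.
rewrite ler_wpM2r ?invr_ge0 ?exprn_ge0 ?(ltW a0) //.
by rewrite -bq ler_peMr ?(ltW b0) // ler1n ltnW.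
Qed.

End ManyParameters.

End SphericalVectors.

Section HorosphericalFunctions.
Variables (R : realType) (O : idomainType) (K : fieldType) (iota : {rmorphism O -> K}).
Variable q : nat.
Hypotheses (dv : discrete_valuation iota q) (q_gt1 : (1 < q)%N).
Variables (z : R) (z_gt0 : 0 < z).
Local Notation vertex := (vertex iota).
Local Notation o := (base_vertex iota).
Local Notation d := (@tree_dist O K iota q).
Local Notation nbrs := (@nbrs O K iota q).
Local Notation boundary := (boundary iota q).
Local Notation C := R[i].
Implicit Types (u v w x : vertex) (g : pgl2 K) (e : boundary).

Definition horospherical v e : C := (q%:R `^ (z * (horofunction e v)%:~R))%:C%C.

Lemma qpowD (x y : R) : q%:R `^ (x + y) = q%:R `^ x * q%:R `^ y :> R.
Proof.
have q0 : q%:R != 0 :> R by rewrite pnatr_eq0 -lt0n ltnW.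
by rewrite powRD // q0 implybT.
Qed.

Lemma horofunction_act g v e :
  horofunction e (vertex_act g v) =
  horofunction (boundary_act g^-1%g e) v + horofunction e (vertex_act g o).
Proof.
rewrite -[e]reprK; set r := repr e; rewrite boundary_actE.
have [n1 P1] := horofunctionP dv (vertex_act g v) r.
have [n2 P2] := horofunctionP dv v (ray_act g^-1%g r).
have [n3 P3] := horofunctionP dv (vertex_act g o) r.
pose k := (n1 + n2 + n3)%N.
have k1 : (n1 <= k)%N by rewrite /k; lia.
have k2 : (n2 <= k)%N by rewrite /k; lia.
have k3 : (n3 <= k)%N by rewrite /k; lia.
rewrite -(P1 k k1) -(P2 k k2) -(P3 k k3) /=.
rewrite -!(@tree_dist_act _ _ _ _ g _ (vertex_act g^-1%g (r k))) (vertex_actKV g).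
by lia.
Qed.

Lemma horospherical_act g v e : horospherical (vertex_act g v) e =
  horospherical v (boundary_act g^-1%g e) * (q%:R `^ (z * (busemann g e)%:~R))%:C%C.
Proof.
rewrite /horospherical horofunction_act (busemannE dv) intrD mulrDr qpowD.
by rewrite rmorphM.
Qed.

Lemma horospherical_base e : horospherical o e = 1.
Proof. by rewrite /horospherical (horofunction_base dv) mulr0 powRr0. Qed.

Lemma horospherical_locally_constant v : locally_constant (horospherical v).
Proof.
move=> e; apply: filterS (horofunction_locally_constant dv v e) => e' /= E.
by rewrite /horospherical E.
Qed.

Lemma horospherical_hecke v e : \sum_(w <- nbrs v) horospherical w e =
  (q%:R * (slow_rate q z + fast_rate q z))%:C%C * horospherical v e.
Proof.
have [w [s [E sq wE sE]]] := horofunction_nbrs dv e v.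
rewrite (perm_big _ E) big_cons /= /horospherical wE.
rewrite (eq_big_seq (fun=> (q%:R `^ (z * (horofunction e v - 1)%:~R))%:C%C)); last first.
  by move=> x /sE ->.
rewrite big_const_seq count_predT sq iter_addr_0 -rmorphMn -rmorphD -rmorphM /=.
congr (_%:C%C); set h := (horofunction e v).
have -> : z * (h + 1)%:~R = z * h%:~R + z :> R by rewrite intrD; ring.
have -> : z * (h - 1)%:~R = z * h%:~R - z :> R by rewrite intrB; ring.
rewrite /fast_rate !qpowD powR_inv1 ?ler0n // mulrDr [q%:R * (_ / _)]mulrCA divff.
  by rewrite -mulr_natl mulr1 /slow_rate; ring.
by rewrite pnatr_eq0 -lt0n ltnW.
Qed.

Definition in_horospherical_span (F : boundary -> C) :=
  exists l : seq (C * vertex), forall e, F e = \sum_(p <- l) p.1 * horospherical p.2 e.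

Lemma horospherical_spanP a (F1 F2 : boundary -> C) :
  in_horospherical_span F1 -> in_horospherical_span F2 ->
  in_horospherical_span (fun e => a * F1 e + F2 e).
Proof.
move=> [l1 l1E] [l2 l2E]; exists ([seq (a * p.1, p.2) | p <- l1] ++ l2) => e.
rewrite big_cat big_map l1E l2E mulr_sumr; congr (_ + _).
by apply: eq_bigr => p _; rewrite mulrA.
Qed.

Lemma horospherical_span0 : in_horospherical_span (fun=> 0).
Proof. by exists [::] => e; rewrite big_nil. Qed.

Lemma horospherical_span_mem v : in_horospherical_span (horospherical v).
Proof. by exists [:: (1, v)] => e; rewrite big_seq1 mul1r. Qed.

Lemma horospherical_span_sum (s : seq vertex) (F : vertex -> boundary -> C) :
  (forall v, v \in s -> in_horospherical_span (F v)) ->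
  in_horospherical_span (fun e => \sum_(v <- s) F v e).
Proof.
elim: s => [_|v s IHs Fs].
  by exists [::] => e; rewrite !big_nil.
have Fs' w : w \in s -> in_horospherical_span (F w).
  by move=> ws; apply: Fs; rewrite inE ws orbT.
have [l lE] := horospherical_spanP 1 (Fs v (mem_head v s)) (IHs Fs').
by exists l => e; rewrite big_cons -lE mul1r.
Qed.

Lemma horofunction_child e v w : w \in nbrs v -> d o v = (d o w).+1 ->
  horofunction e w = if horofunction e v == (d o v)%:Z
    then (d o w)%:Z else horofunction e v + 1.
Proof.
move=> wv ov; have hv : horofunction e v = horofunction e w + 1 ->
    horofunction e v = d o v.
  rewrite -[e]reprK; set r := repr e.
  have [k kP] := horofunction_seq dv [:: v; w] r.
  rewrite -(kP v _ k (leqnn k)) ?mem_head // -(kP w _ k (leqnn k)) ?inE ?eqxx ?orbT // => hvw.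
  have : on_geodesic q o v (r k).
    by apply: (on_geodesic_edge dv wv ov); rewrite !(dist_sym dv (r k)); lia.
  by rewrite /on_geodesic => /eqP; lia.
have := horofunction_le dv e w.
have [x [s [E _ xE sE]]] := horofunction_nbrs dv e v.
move: (wv); rewrite (perm_mem E) inE => /orP[/eqP wx|/sE hw].
  by move: xE; rewrite -wx => ->; case: eqP => // hv' hle; lia.
have hv' : horofunction e v = d o v by apply: hv; rewrite hw; lia.
by rewrite hw hv' eqxx ov; lia.
Qed.

Definition branch v e : C := (horofunction e v == (d o v)%:Z)%:R.

Lemma branch_locally_constant_span v : in_horospherical_span (branch v).
Proof.
have [<-|ov] := eqVneq o v.
  have [l lE] := horospherical_span_mem o; exists l => e.
  by rewrite -lE horospherical_base /branch (horofunction_base dv) (distxx dv) eqxx.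
have [pv dp] := parent_closer dv ov; set w := parent q o v in pv dp.
pose c : R := q%:R `^ (z * (d o v)%:R) - q%:R `^ (- z) * q%:R `^ (z * (d o w)%:R).
have cE : c = q%:R `^ (z * (d o w)%:R) * (q%:R `^ z - q%:R `^ (- z)).
  by rewrite /c -dp -natr1 mulrDr mulr1 qpowD; ring.
have q_gt0' : 0 < q%:R :> R by rewrite ltr0n ltnW.
have c0 : c != 0.
  rewrite cE mulf_neq0 //; first by rewrite gt_eqF ?powR_gt0.
  rewrite subr_eq0 gt_eqF // /powR gt_eqF // ltr_expR ltr_pM2r ?ln_gt0 ?ltr1n //.
  by rewrite (lt_trans _ z_gt0) // oppr_lt0.
have [l lE] := horospherical_spanP (- (q%:R `^ (- z))%:C%C) (horospherical_span_mem w)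
  (horospherical_span_mem v).
have [l' l'E] : in_horospherical_span (fun e => c^-1%:C%C *
    (- (q%:R `^ (- z))%:C%C * horospherical w e + horospherical v e) + 0).
  by apply: horospherical_spanP; [exists l|exact: horospherical_span0].
exists l' => e; rewrite -l'E addr0 /branch /horospherical.
have hw := horofunction_child e pv (esym dp).
have toR (x y t : R) : (c^-1)%:C%C * (- x%:C%C * y%:C%C + t%:C%C) =
    (c^-1 * (t - x * y))%:C%C by rewrite rmorphM rmorphB rmorphM /=; ring.
rewrite hw; case: ifP => [/eqP ->|_] /=; rewrite toR.
  by rewrite (_ : _ - _ = c) // mulVf.
rewrite -qpowD intrD (_ : - z + _ = z * (horofunction e v)%:~R); last by ring.
by rewrite subrr mulr0 rmorph0.
Qed.

Lemma branch_children v e :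
  branch v e = \sum_(w <- [seq w <- nbrs v | d o w == (d o v).+1]) branch w e.
Proof.
have child0 w : w \in nbrs v -> d o w = (d o v).+1 -> horofunction e v != d o v ->
    branch w e = 0.
  move=> wv ow; apply: contraNeq; rewrite /branch.
  have vw : v \in nbrs w by rewrite (nbrs_sym dv).
  rewrite (horofunction_child e vw ow) [_%:R == 0]pnatr_eq0 eqb0 negbK.
  by move=> ->.
rewrite {1}/branch; case: eqP => [hv|/eqP hv]; last first.
  rewrite big_seq big1 // => w; rewrite mem_filter => /andP[/eqP ow wv].
  exact: child0.
have [x [s [E _ xE sE]]] := horofunction_nbrs dv e v.
have xv : x \in nbrs v by rewrite (perm_mem E) mem_head.
have ox : d o x = (d o v).+1.
  have := horofunction_le dv e x; rewrite xE hv.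
  by have [->//|] := dist_adjacent dv o xv; lia.
have s_uniq : uniq [seq w <- nbrs v | d o w == (d o v).+1].
  by rewrite filter_uniq ?nbrs_uniq.
rewrite (bigD1_seq x) ?mem_filter ?ox ?eqxx //= {1}/branch xE hv ox.
rewrite (_ : (_ == _) = true); last by apply/eqP; lia.
rewrite big_seq_cond big1 ?addr0 // => w; rewrite mem_filter => /andP[/andP[/eqP ow wv] wx].
move: wv; rewrite (perm_mem E) inE (negbTE wx) /= => /sE hw.
by rewrite /branch hw hv ow (_ : (_ == _) = false) //; apply/eqP; lia.
Qed.

Lemma locally_constant_span (F : boundary -> C) :
  locally_constant F -> in_horospherical_span F.
Proof.
move=> F_lc; apply: contrapT => F_bad.
pose bad v := ~ in_horospherical_span (fun e => F e * branch v e).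
have bad_o : bad o.
  move=> [l lE]; apply: F_bad; exists l => e; rewrite -lE.
  by rewrite /branch (horofunction_base dv) (distxx dv) eqxx mulr1.
have bad_child v : exists w, bad v -> [/\ bad w, w \in nbrs v & d o w = (d o v).+1].
  apply: contrapT => /forallNP no_child.
  have bad_v : bad v by apply: contrapT => good_v; apply: (no_child v).
  apply: bad_v; set s := [seq w <- nbrs v | d o w == (d o v).+1].
  have [l lE] : in_horospherical_span (fun e => \sum_(w <- s) F e * branch w e).
    apply: horospherical_span_sum => w; rewrite mem_filter => /andP[/eqP dw wv].
    by apply: contrapT => bad_w; apply: (no_child w).
  by exists l => e; rewrite -lE branch_children mulr_sumr.
have [next nextP] := choice bad_child.
pose f k := iter k next o.
have f_bad k : bad (f k) by elim: k => [//|k IHk]; have [] := nextP _ IHk.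
have f_nbr k : f k.+1 \in nbrs (f k) by have [] := nextP _ (f_bad k).
have fk k : d o (f k) = k.
  by elim: k => [|k IHk]; [exact: distxx|have [_ _ ->] := nextP _ (f_bad k); rewrite IHk].
have [e eP] := branch_end dv (erefl : f 0%N = o) f_nbr fk.
have [k kP] := eP _ (F_lc e).
apply: (f_bad k); have [l lE] := horospherical_spanP (F e) (branch_locally_constant_span (f k))
  horospherical_span0.
exists l => e'; rewrite -lE addr0 /branch.
have [/(ray_toP dv)/kP /= ->|] := eqVneq (horofunction e' (f k)) (d o (f k))%:Z.
  by [].
by rewrite !mulr0.
Qed.

End HorosphericalFunctions.

Section SphericalSeries.
Variables (R : realType) (q : prime_number).
Let dv := padic_discrete_valuation q.
Let q_gt1 : (1 < q)%N := prime_gt1 (prime_natP q).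
Local Notation iota := (of_padic_int q).

Lemma complementary_spherical (z : R) (V : complementary_series q z) : 0 < z ->
  exists e : vertex iota -> V, spherical_vectors q z e.
Proof.
move=> z_gt0.
pose F v : C_infty R q := Smooth (introT (asboolP _) (horospherical_locally_constant dv z v)).
pose e v : V := cs_embed V (F v).
have actE g v : rep_act g (e v) = e (vertex_act g v).
  apply: cs_actE; apply/funext => w /=; exact: horospherical_act.
have F_base : F (base_vertex iota) = smooth_one R (Omega q).
  by apply/val_inj/funext => w /=; apply: horospherical_base.
exists e; split => //.
- move=> v; have [g <-] := vertex_transitive v.
  by rewrite -actE rep_isometry cs_embed_isometry F_base cs_normalized.
- move=> v; rewrite -linear_sum -linearZ; congr (cs_embed V _).
  apply/val_inj/funext => w; rewrite raddf_sum /= fct_sumE.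
  exact: horospherical_hecke.
apply: (@dense_lspan_trans _ _ _ _ (cs_embed V)).
  apply/dense_approx => w eps eps0.
  have /dense_approx/(_ w eps eps0)[_ [f _ <-] wf] := @cs_embed_dense _ _ _ V.
  by exists (cs_embed V f) => //; apply: lspan_mem.
move=> f; apply: lspan_closure.
have [l lE] := locally_constant_span dv q_gt1 z_gt0 (elimT (asboolP _) (smoothP f)).
exists l => //; under eq_bigr do rewrite -linearZ; rewrite -linear_sum.
congr (cs_embed V _); apply/val_inj/funext => w; rewrite [RHS]lE raddf_sum /= fct_sumE.
by [].
Qed.

Lemma trivial_spherical : exists e : vertex iota -> trivial_rep R (PGL2 q),
  spherical_vectors q 0 e.
Proof.
exists (fun=> 1); split => //.
- by move=> v; rewrite /= /complex_inner mul1r; exact: rmorph1.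
- move=> v; rewrite big_const_seq count_predT size_nbrs iter_addr_0.
  rewrite -[RHS]/(_ * 1) mulr1 /slow_rate /fast_rate oppr0 powRr0 sub0r.
  rewrite powR_inv1 ?ler0n // mulrDr mulr1 divff; last first.
    by rewrite pnatr_eq0 -lt0n ltnW.
  by rewrite natr1 rmorph_nat.
apply/dense_approx => w eps eps0; exists w; last by rewrite subrr normr0.
exists [:: (w, base_vertex iota)] => //; rewrite big_seq1 /=.
exact: mulr1.
Qed.

Lemma rep_of_spherical (H : complementary_family R q) (z : R) : 0 <= z < 2^-1 ->
  exists e : vertex iota -> rep_of H z, spherical_vectors q z e.
Proof.
move=> /andP[z_ge0 z_lt]; rewrite /rep_of; case: {-}_ / idP => [z_in|z_out].
  have /andP[z_gt0 _] := z_in; exact: complementary_spherical.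
have -> : z = 0.
  by apply/eqP; rewrite eq_le z_ge0 andbT leNgt; apply/negP => z_gt0; case: z_out; rewrite z_gt0.
exact: trivial_spherical.
Qed.

End SphericalSeries.

Lemma isometry_norm (R : realType) (H H' : hilbertType R) (f : {linear H -> H'}) :
  (forall u v, inner (f u) (f v) = inner u v) -> forall w, `|f w| = `|w|.
Proof. by move=> f_iso w; apply: (@pexpIrn _ 2); rewrite ?nnegrE // !inner_norm f_iso. Qed.

Lemma isometries_eq (R : realType) (S : Type) (H H' : hilbertType R) (x : S -> H)
    (A B : {linear H -> H'}) : dense (lspan x) ->
  (forall u v, inner (A u) (A v) = inner u v) ->
  (forall u v, inner (B u) (B v) = inner u v) ->
  (forall s, A (x s) = B (x s)) -> forall u, A u = B u.
Proof.
move=> /dense_approx x_dense A_iso B_iso AB u.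
have AB_span a : lspan x a -> A a = B a.
  move=> [l _ <-]; rewrite !linear_sum; apply: eq_bigr => p _.
  by rewrite !linearZ AB.
apply/eqP; rewrite -subr_eq0 -normr_le0; apply/ler_addgt0Pl => e e0.
have [a xa ua] := x_dense u (e / 2) (divr_gt0 e0 (ltr0Sn _ 1)).
rewrite addr0 -(subrKA (A a)) {2}(AB_span a xa) -!linearB.
rewrite (le_trans (ler_normD _ _)) // !isometry_norm // [e]splitr.
by rewrite lerD ?ltW // distrC.
Qed.

Definition far_filter D : set_system (nat * nat) := [set Q |
  exists N, forall n m, (N <= n)%N -> (n + D <= m)%N -> Q (n, m)].

Instance far_filter_filter D : Filter (far_filter D).
Proof.
split; first by exists 0%N.
  move=> P Q [N NP] [M MQ]; exists (maxn N M) => n m.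
  rewrite geq_max => /andP[Nn Mn] nm; split; [exact: NP|exact: MQ].
by move=> P Q PQ [N NP]; exists N => n m Nn nm; apply/PQ/NP.
Qed.

Lemma cvg_prodr (R : realType) (I T : Type) (F : set_system T) {FF : Filter F}
    (r : seq I) (f : I -> T -> R) (l : I -> R) :
  (forall i, f i @ F --> l i) ->
  (fun t => \prod_(i <- r) f i t) @ F --> \prod_(i <- r) l i.
Proof.
move=> fl; elim: r => [|i r IHr].
  by under eq_fun do rewrite big_nil; rewrite big_nil; apply: cvg_cst.
by under eq_fun do rewrite big_cons; rewrite big_cons; apply: cvgM.
Qed.

Section TensorEmbedding.
Variables (R : realType) (O : idomainType) (K : fieldType) (iota : {rmorphism O -> K}).
Variable q : nat.
Hypotheses (dv : discrete_valuation iota q) (q_gt1 : (1 < q)%N).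
Local Notation vertex := (vertex iota).
Local Notation o := (base_vertex iota).
Local Notation d := (@tree_dist O K iota q).
Local Notation sphere := (@sphere O K iota q).
Local Notation C := R[i].
Local Notation G := (pgl2 K).

Variables (n0 n1 : nat) (parent_index : 'I_n1 -> 'I_n0).
Variables (z0 : 'I_n0 -> R) (z1 : 'I_n1 -> R).
Hypotheses (z0_range : forall i, 0 <= z0 i < 2^-1) (z1_range : forall j, 0 <= z1 j < 2^-1).
Hypothesis z0E : forall i, z0 i = \sum_(j | parent_index j == i) z1 j.
Variables (V0 : 'I_n0 -> unitary_rep G R) (V1 : 'I_n1 -> unitary_rep G R).
Variables (e0 : forall i, vertex -> V0 i) (e1 : forall j, vertex -> V1 j).
Hypothesis e0P : forall i, spherical_vectors q (z0 i) (e0 i).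
Hypothesis e1P : forall j, spherical_vectors q (z1 j) (e1 j).
Variables (T0 : tensor_rep V0) (T1 : tensor_rep V1).
Local Notation alpha := parent_index.
Local Notation gram i := (tensor_gram q (fun j => alpha j == i) z1).
Local Notation index := ('I_n0 -> vertex).

Definition vertex_tensor (s : index) : T0 := pure_tensor T0 (fun i => e0 i (s i)).

Lemma vertex_tensor_inner s t : inner (vertex_tensor s) (vertex_tensor t) =
  (\prod_i spherical_function q (z0 i) (d (s i) (t i)))%:C%C.
Proof.
rewrite pure_inner rmorph_prod; apply: eq_bigr => i _.
exact: (spherical_inner dv q_gt1 (z0_range i) (e0P i)).
Qed.

Definition edge_tensor k (s : index) (L : 'I_n0 -> seq vertex) : T1 :=
  \sum_(f : {ffun 'I_n0 -> 'I_k}) pure_tensor T1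
    (fun j => edge_vector q (z1 j) (e1 j) (s (alpha j)) (nth o (L (alpha j)) (f (alpha j)))).

Lemma sum_nth_ord (k : nat) (L : seq vertex) (F : vertex -> R) : size L = k ->
  \sum_(l < k) F (nth o L l) = \sum_(v <- L) F v.
Proof. by move=> <-; rewrite [RHS](big_nth o) big_mkord. Qed.

Lemma edge_tensor_inner k k' s t (L L' : 'I_n0 -> seq vertex) :
  (forall i, size (L i) = k) -> (forall i, size (L' i) = k') ->
  inner (edge_tensor k s L) (edge_tensor k' t L') =
  (\prod_i \sum_(v <- L i) \sum_(v' <- L' i) gram i (s i) v (t i) v')%:C%C.
Proof.
move=> Lk L'k; rewrite inner_suml.
have -> : \prod_i \sum_(v <- L i) \sum_(v' <- L' i) gram i (s i) v (t i) v' =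
    \sum_(f : {ffun 'I_n0 -> 'I_k}) \sum_(f' : {ffun 'I_n0 -> 'I_k'})
      \prod_i gram i (s i) (nth o (L i) (f i)) (t i) (nth o (L' i) (f' i)).
  transitivity (\prod_i \sum_(l < k) \sum_(l' < k')
      gram i (s i) (nth o (L i) l) (t i) (nth o (L' i) l')).
    apply: eq_bigr => i _; rewrite -(@sum_nth_ord k) //; apply: eq_bigr => l _.
    by rewrite -(@sum_nth_ord k').
  rewrite bigA_distr_bigA; apply: eq_bigr => f _.
  by rewrite bigA_distr_bigA.
rewrite rmorph_sum; apply: eq_bigr => f _; rewrite inner_sumr rmorph_sum.
apply: eq_bigr => f' _; rewrite pure_inner.
transitivity (\prod_j (edge_gram q (z1 j) (s (alpha j)) (nth o (L (alpha j)) (f (alpha j)))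
    (t (alpha j)) (nth o (L' (alpha j)) (f' (alpha j)))))%:C%C.
  rewrite rmorph_prod; apply: eq_bigr => j _; exact: edge_vector_inner.
congr (_%:C%C); rewrite (partition_big alpha predT) //=.
by apply: eq_bigr => i _; apply: eq_bigr => j /eqP ->.
Qed.

Local Notation b i := (fast_rate q (z0 i)).
Local Notation phi i := (spherical_function q (z0 i)).

Definition level_coef i := tensor_coef q (fun j => alpha j == i) z1 (z0 i) * (1 - b i ^+ 2) ^+ 2.

Lemma level_coef_gt0 i : 0 < level_coef i.
Proof.
rewrite mulr_gt0 ?(tensor_coef_gt0 q_gt1) // exprn_gt0 // subr_gt0 exprn_ilt1 //.
  exact/ltW/fast_rate_gt0.
exact: fast_rate_lt1.
Qed.

Definition level_scale n : R := \prod_i (b i ^+ n.+1 / Num.sqrt (level_coef i)).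

Definition level_tensor n (s : index) : T1 := (level_scale n)%:C%C *:
  edge_tensor (q.+1 * q ^ n) s (fun i => sphere (s i) n.+1).

Lemma level_scale_gram n m s t (L L' : 'I_n0 -> seq vertex) :
  (forall i, perm_eq (L i) (sphere (s i) n.+1)) ->
  (forall i, perm_eq (L' i) (sphere (t i) m.+1)) ->
  inner ((level_scale n)%:C%C *: edge_tensor (q.+1 * q ^ n) s L)
        ((level_scale m)%:C%C *: edge_tensor (q.+1 * q ^ m) t L') =
  (\prod_i (normalized_gram q (fun j => alpha j == i) z1 (z0 i) (s i) (t i) n.+1 m.+1
            / level_coef i))%:C%C.
Proof.
move=> LE L'E; rewrite innerZl innerZr_real edge_tensor_inner; last 2 first.
- by move=> i; rewrite (perm_size (LE i)) (size_sphere dv).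
- by move=> i; rewrite (perm_size (L'E i)) (size_sphere dv).
rewrite -!rmorphM /= /level_scale -!big_split /=; congr (_%:C%C).
apply: eq_bigr => i _; rewrite /normalized_gram (perm_big _ (LE i)) /=.
under eq_bigr do rewrite (perm_big _ (L'E i)) /=.
have sqrt_coef : Num.sqrt (level_coef i) ^+ 2 = level_coef i.
  by rewrite sqr_sqrtr // ltW ?level_coef_gt0.
have sqrt0 : Num.sqrt (level_coef i) != 0.
  by rewrite gt_eqF // sqrtr_gt0 level_coef_gt0.
rewrite -{3}sqrt_coef; move: (Num.sqrt _) sqrt0 (\sum_(_ <- _) _) => x x0 S.
by field.
Qed.

Lemma level_tensor_inner n m s t : inner (level_tensor n s) (level_tensor m t) =
  (\prod_i (normalized_gram q (fun j => alpha j == i) z1 (z0 i) (s i) (t i) n.+1 m.+1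
            / level_coef i))%:C%C.
Proof. by apply: level_scale_gram. Qed.

Lemma level_tensor_cvg s t (eps : C) : 0 < eps -> exists N, forall n m, (N <= n)%N ->
  (n + \sum_i d (s i) (t i) <= m)%N ->
  `|inner (level_tensor n s) (level_tensor m t)
    - inner (vertex_tensor s) (vertex_tensor t)| < eps.
Proof.
move=> eps0; set D := (\sum_i _)%N.
have cvg1 i : (fun nm : nat * nat =>
    normalized_gram q (fun j => alpha j == i) z1 (z0 i) (s i) (t i) nm.1.+1 nm.2.+1
    / level_coef i) @ far_filter D --> phi i (d (s i) (t i)).
  pose X : R := (tensor_bound q (fun j => alpha j == i) z1 + tensor_coef q (fun j => alpha j == i) z1 (z0 i)
    * edge_bound q (z0 i)) * q.+1%:R * slow_rate q (z0 i) ^- (d (s i) (t i)).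
  have c0 := level_coef_gt0 i; set c := level_coef i in c0 *.
  have lim0 : (fun n => X / c * (b i / slow_rate q (z0 i)) ^+ n.+1) @ \oo --> (0 : R).
    under eq_fun do rewrite exprS mulrA.
    rewrite -(mulr0 (X / c * (b i / slow_rate q (z0 i)))); apply: cvgMr.
    have a0 := slow_rate_gt0 (z0 i) q_gt1; have b0 := fast_rate_gt0 (z0 i) q_gt1.
    apply: cvg_expr; rewrite gtr0_norm ?divr_gt0 // ltr_pdivrMr // mul1r.
    exact: fast_lt_slow.
  apply/cvgrPdist_lt => e e_gt0; move/cvgrPdist_lt: lim0 => /(_ e e_gt0)[N _ NP].
  exists N => n m Nn nm /=.
  have nmi : (n.+1 + d (s i) (t i) <= m.+1)%N.
    by rewrite addSn ltnS (leq_trans _ nm) // leq_add2l /D (bigD1 i) //= leq_addr.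
  have bound := normalized_gram_cvg dv q_gt1 z1_range (z0_range i) (z0E i) (e0P i) nmi.
  have := NP n Nn; rewrite /= sub0r normrN; apply: le_lt_trans.
  rewrite distrC (_ : _ - _ = (normalized_gram q (fun j => alpha j == i) z1 (z0 i) (s i) (t i) n.+1 m.+1
     - tensor_gram_limit q (fun j => alpha j == i) z1 (z0 i) (s i) (t i)) / c).
    rewrite normrM (gtr0_norm (_ : 0 < c^-1)) ?invr_gt0 //.
    rewrite -/X in bound; apply: le_trans (ler_wpM2r _ bound) _; first by rewrite invr_ge0 ltW.
    by rewrite mulrAC ler_norm.
  rewrite mulrBl; congr (_ - _); rewrite /tensor_gram_limit mulrA.
  by rewrite -[_ * _ ^+ 2]/c mulrAC divff ?mul1r // gt_eqF.
have := @cvg_prodr R _ _ _ (far_filter_filter D) (index_enum 'I_n0) _ _ cvg1.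
case: eps eps0 => e e'; rewrite ltcE /= => /andP[/eqP -> e_gt0].
move=> /cvgrPdist_lt /(_ e e_gt0)[N NP]; exists N => n m Nn nm.
rewrite level_tensor_inner vertex_tensor_inner -rmorphB normc_def /= expr0n addr0 sqrtr_sqr.
by rewrite ltcR distrC NP.
Qed.

Lemma vertex_tensor_dense : dense (lspan vertex_tensor).
Proof.
apply: (@dense_pure_tensors R n0 (fun i => V0 i) T0 vertex (fun i => e0 i)) => i.
exact: spherical_dense (e0P i).
Qed.

Lemma tensor_embedding : exists2 J : {linear T0 -> T1},
  forall u v, inner (J u) (J v) = inner u v &
  forall (g0 : 'I_n0 -> G) (g1 : 'I_n1 -> G),
    (forall j (w : V1 j), rep_act (g1 j) w = rep_act (g0 (alpha j)) w) ->
    forall u, J (tensor_act T0 g0 u) = tensor_act T1 g1 (J u).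
Proof.
have [|J J_iso J_lim] := @limit_isometry R _ T0 T1 vertex_tensor level_tensor
  (fun s t => \sum_i d (s i) (t i))%N vertex_tensor_dense _ level_tensor_cvg.
  by move=> s; rewrite big1 // => i _; apply: (distxx dv).
exists J => // g0 g1 g01.
pose gs (s : index) : index := fun i => vertex_act (g0 i) (s i).
have act0 s : tensor_act T0 g0 (vertex_tensor s) = vertex_tensor (gs s).
  rewrite tensor_act_pure; congr pure_tensor.
  by apply: functional_extensionality_dep => i; rewrite (spherical_act (e0P i)).
have act1 n s : tensor_act T1 g1 (level_tensor n s) = (level_scale n)%:C%C *:
    edge_tensor (q.+1 * q ^ n) (gs s) (fun i => map (vertex_act (g0 i)) (sphere (s i) n.+1)).
  rewrite linearZ linear_sum; congr (_ *: _); apply: eq_bigr => f _.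
  rewrite tensor_act_pure; congr pure_tensor.
  apply: functional_extensionality_dep => j; rewrite g01 /edge_vector linearB linearZ.
  rewrite !(spherical_act (e1P j)) (nth_map o) ?(size_sphere dv) //.
  by rewrite (parent_act dv).
apply: (isometries_eq vertex_tensor_dense (A := J \o tensor_act T0 g0)
   (B := tensor_act T1 g1 \o J)) => [u v|u v|s] /=.
- by rewrite J_iso tensor_isometry.
- by rewrite tensor_isometry J_iso.
rewrite act0.
have actE n : tensor_act T1 g1 (level_tensor n s) = level_tensor n (gs s).
  have sphere_act i : perm_eq [seq vertex_act (g0 i) v | v <- sphere (s i) n.+1]
      (sphere (gs s i) n.+1).
    apply: uniq_perm; rewrite ?(sphere_uniq dv) ?(map_inj_uniq (can_inj (vertex_actK (g0 i)))) //.
      exact: (sphere_uniq dv).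
    move=> v; rewrite (mem_sphere dv) -{1}(vertex_actKV (g0 i) v).
    rewrite (mem_map (can_inj (vertex_actK (g0 i)))) (mem_sphere dv) /gs.
    by rewrite -{2}(vertex_actKV (g0 i) v) tree_dist_act.
  apply/eqP; rewrite -subr_eq0 act1 /level_tensor; apply/eqP/inner_eq0.
  by rewrite innerBl !innerBr !level_scale_gram // !subrr.
have lim : (fun n => level_tensor n (gs s)) @ \oo --> tensor_act T1 g1 (J (vertex_tensor s)).
  rewrite -(funext actE).
  apply/cvgrPdist_lt => e e_gt0; move/cvgrPdist_lt: (J_lim s) => /(_ e e_gt0)[N _ NP].
  by exists N => // n Nn; rewrite /= -linearB isometry_norm ?NP //; apply: tensor_isometry.
exact: (cvg_unique (@norm_hausdorff _ _) (J_lim (gs s)) lim).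
Qed.

End TensorEmbedding.

Lemma rep_of0 (R : realType) (q : prime_number) (H : complementary_family R q) (z : R)
    (g : PGL2 q) (w : rep_of H z) : z = 0 -> rep_act g w = w.
Proof.
move=> z0; move: w; rewrite /rep_of; case: {-}_ / idP => // z_in.
by exfalso; move: z_in; rewrite z0 ltxx.
Qed.

Section Refinement.
Variables (R : realType) (X : ptopologicalType) (mu : {measure set (borel X) -> \bar R}).
Hypothesis mu_lt : (mu [set: borel X] < (2^-1)%:E)%E.

Lemma mu_lt_half (A : set (borel X)) : measurable A -> (mu A < (2^-1)%:E)%E.
Proof.
move=> mA; apply: le_lt_trans mu_lt.
by apply: (le_measure mu); [exact: mem_set|apply/mem_set/measurableT|exact: subsetT].
Qed.

Lemma mu_fin_num (A : set (borel X)) : measurable A -> mu A \is a fin_num.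
Proof. by move=> mA; rewrite ge0_fin_numE // (lt_trans (mu_lt_half mA)) ?ltry. Qed.

Lemma fine_mu_range (A : set (borel X)) : measurable A -> 0 <= fine (mu A) < 2^-1.
Proof.
move=> mA; rewrite fine_ge0 //= -lte_fin fineK ?mu_lt_half //; exact: mu_fin_num.
Qed.

Lemma refined_measure rho rho' (alpha : 'I_(parts rho') -> 'I_(parts rho)) :
  (forall j, part j `<=` part (alpha j)) -> forall i : 'I_(parts rho),
  fine (mu (part i)) = \sum_(j | alpha j == i) fine (mu (part j)).
Proof.
move=> part_sub i.
have -> : part i = \big[setU/set0]_(j | alpha j == i) part j.
  rewrite -(bigcup_pred (fun j => alpha j == i)); apply/seteqP; split=> [x xi|x [j /= /eqP <-]]; last exact: part_sub.
  have : setT x by []; rewrite -(part_cover rho').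
  move=> [j _ xj]; exists j => //=; apply/eqP.
  by apply: (@part_disjoint X rho) => //; exists x; split=> //; apply: part_sub.
rewrite measure_bigsetU_ord; [|exact: part_measurable|exact: part_disjoint].
symmetry; apply: sum_fine => j _; apply: mu_fin_num; exact: part_measurable.
Qed.

Variables (q : prime_number) (H : complementary_family R q).

Lemma refinement_embedding rho rho' (H1 : H_of H mu rho) (H2 : H_of H mu rho') :
  refined_by rho rho' -> exists2 j : {linear H1 -> H2},
    isometric_embedding j & commutes_with_G j.
Proof.
move=> ref; have [alpha alphaP] := choice ref.
pose e rho1 (i : 'I_(parts rho1)) := projT1 (cid (rep_of_spherical H (fine_mu_range (part_measurable i)))).
have eP rho1 (i : 'I_(parts rho1)) : spherical_vectors q (fine (mu (part i))) (@e rho1 i) := projT2 (cid _).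
have [J J_iso J_act] := tensor_embedding (padic_discrete_valuation q) (prime_gt1 (prime_natP q))
  (fun i => fine_mu_range (part_measurable i)) (fun j => fine_mu_range (part_measurable j))
  (refined_measure alphaP) (@eP rho) (@eP rho') H1 H2.
exists J => // f fG u; apply: J_act => j w.
have [part0|/set0P[x xj]] := eqVneq (part j) set0.
  by rewrite !rep_of0 // part0 measure0.
by rewrite (componentE (G_of_refined ref fG) xj) (componentE fG (alphaP _ _ xj)).
Qed.
End Refinement.

Theorem proposition7p4 (R : realType) (q : prime_number)
    (q_neq2 : prime_nat q != 2%N)
    (H : complementary_family R q)
    (X : ptopologicalType) (X_compact : compact [set: X])
    (mu : {measure set (borel X) -> \bar R})
    (mu_lt : (mu [set: borel X] < (2^-1)%:E)%E)
    (rho0 rho1 rho2 : admissible_partition X)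
    (rho01 : refined_by rho0 rho1) (rho12 : refined_by rho1 rho2)
    (H0 : H_of H mu rho0) (H1 : H_of H mu rho1) (H2 : H_of H mu rho2) :
  exists (j10 : {linear H0 -> H1}) (j21 : {linear H1 -> H2})
         (j20 : {linear H0 -> H2}),
    [/\ isometric_embedding j10 /\ commutes_with_G j10,
        isometric_embedding j21 /\ commutes_with_G j21,
        isometric_embedding j20 /\ commutes_with_G j20
      & forall u : H0, j21 (j10 u) = j20 u].
Proof.
have [j10 j10_iso j10_G] := refinement_embedding mu_lt H0 H1 rho01.
have [j21 j21_iso j21_G] := refinement_embedding mu_lt H1 H2 rho12.
exists j10, j21, (j21 \o j10); split=> //; split=> [u v|f fG u] /=.
  by rewrite [LHS]j21_iso j10_iso.
by rewrite j10_G // j21_G //; apply: G_of_refined fG.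
Qed.
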